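(* There is a polynomial-space algorithm that solves the 2-Disjoint Connected Subgraphs problem on $n$-vertex graphs in $O^*(1.7804^n)$ time.
   Context: The 2-Disjoint Connected Subgraphs problem: given a connected graph $G=(V,E)$ and two disjoint subsets $Z_1,Z_2\subseteq V$, decide whether there exist disjoint sets $A_1,A_2\subseteq V$ with $Z_1\subseteq A_1$, $Z_2\subseteq A_2$ such that $G[A_1]$ and $G[A_2]$ are both connected. $O^*(f)$ means $O(f\cdot n^{O(1)})$. *)

(* Defs.v *)
From mathcomp Require Import all_boot.
Set Implicit Arguments. Unset Strict Implicit. Unset Printing Implicit Defensive.

Definition simple_graph (n : nat) (adj : rel 'I_n) : Prop :=
  (forall x y, adj x y = adj y x) /\ (forall x, adj x x = false).

Definition induced_connected (n : nat) (adj : rel 'I_n) (A : {set 'I_n}) : Prop :=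
  A != set0 /\
  forall x y, x \in A -> y \in A ->
    connect [rel u v | [&& adj u v, u \in A & v \in A]] x y.

Definition valid_instance (n : nat) (adj : rel 'I_n) (Z1 Z2 : {set 'I_n}) : Prop :=
  simple_graph adj /\ induced_connected adj [set: 'I_n] /\ [disjoint Z1 & Z2].

Definition two_dcs (n : nat) (adj : rel 'I_n) (Z1 Z2 : {set 'I_n}) : Prop :=
  exists A1 A2 : {set 'I_n},
    [/\ [disjoint A1 & A2], Z1 \subset A1, Z2 \subset A2,
        induced_connected adj A1 & induced_connected adj A2].

Definition encode (n : nat) (adj : rel 'I_n) (Z1 Z2 : {set 'I_n}) : seq bool :=
  nseq n true ++ [:: false] ++
  [seq adj i j | i <- enum 'I_n, j <- enum 'I_n] ++
  [seq i \in Z1 | i <- enum 'I_n] ++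
  [seq i \in Z2 | i <- enum 'I_n].

Unset Implicit Arguments.
Record TM := {
  tm_state : finType;
  tm_sym : finType;
  tm_blank : tm_sym;
  tm_in : bool -> tm_sym;
  tm_start : tm_state;
  tm_halt : pred tm_state;
  tm_accept : pred tm_state;
  (* new state, written symbol, move right (true) / left (false) *)
  tm_delta : tm_state -> tm_sym -> tm_state * tm_sym * bool
}.
Set Implicit Arguments.

(* Configuration: state, tape (one-way infinite, cells indexed by nat), head. *)
Definition config (M : TM) : Type := (tm_state M * (nat -> tm_sym M) * nat)%type.

Definition init_config (M : TM) (w : seq bool) : config M :=
  (tm_start M, (fun i => nth (tm_blank M) (map (tm_in M) w) i), 0).

(* One step; halted configurations are fixed; moving left at cell 0 stays. *)
Definition tm_step (M : TM) (c : config M) : config M :=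
  let: (q, tape, pos) := c in
  if tm_halt M q then c else
  let: (q', s, mvr) := tm_delta M q (tape pos) in
  (q', (fun i => if i == pos then s else tape i),
   if mvr then pos.+1 else pos.-1).

Definition tm_run (M : TM) (w : seq bool) (t : nat) : config M :=
  iter t (tm_step (M := M)) (init_config M w).

Definition tm_decides_within (M : TM) (w : seq bool) (t s : nat) (b : bool) : Prop :=
  exists t', t' <= t /\
    tm_halt M (tm_run M w t').1.1 /\
    tm_accept M (tm_run M w t').1.1 = b /\
    forall t'', t'' <= t' -> (tm_run M w t'').2 <= s.

(* Main.v *)
Require Import Defs.
From mathcomp Require Import all_boot.
From mathcomp Require Import zify.
Set Implicit Arguments. Unset Strict Implicit. Unset Printing Implicit Defensive.

(** Let [T] be the smaller of the two terminal sets, [F] the other one and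
    [t = #|T|].  In a solution [(A1, A2)] the set [T] lies in a minimal connected
    subset [X] of [A1], and each nonterminal vertex of [X] cuts some terminal off
    a fixed root of [X].  The algorithm guesses [X] by growing it from the root:
    it processes the reached vertices one at a time, deciding for every undecided
    neighbour of the current vertex whether it belongs to [X].  A reached
    nonterminal owes a child until it gets one, and the vertices in debt cut off
    disjoint nonempty sets of terminals not reached yet.  So a branch is pruned
    when a processed vertex stays in debt, or when the debts outnumber the
    unreached terminals.  Giving weight [8 / 5] to an undecided vertex and [8] to
    each unit of slack (unreached terminals minus debts), the search tree has, up
    to a polynomial factor, at most [(8 / 5) ^ m * 8 ^ t] leaves, where
    [m <= n - 2 * t] is the number of nonterminals; trivially it has at most
    [2 ^ m].  The first bound (for [11 * t <= n]) or the second (otherwise) is at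
    most [1.78 ^ n].  At a leaf, a connected set is grown outside [X] from a
    vertex of [F], and the leaf accepts if this set contains [F].

    The leaves are visited in lexicographic order, replaying all choices from
    scratch for each of them, hence in polynomial space.  One replay is a program
    with bounded loops over arrays and pointers, so it takes polynomially many
    instructions, and a single-tape machine executes an instruction by one sweep
    over the tape: a pointer is a track with a single mark. *)

(** * Arrays and pointers on a multi-track tape *)

(** The weights come from the recurrence at a current vertex. If it owes nothing, taking an
    undecided neighbour adds a debt and spends one unit of slack, worth 8, so each neighbour
    multiplies the weight by [1 + 1 / 8 = 9 / 8]. If it owes a child, the first child taken takes
    over the debt and the slack stays; with [j] undecided neighbours this gives the sum of the
    [(9 / 8) ^ i] for [i < j]. Both values are at most [(8 / 5) ^ j], so an undecided vertex may be
    charged [8 / 5] before it becomes a neighbour of the current vertex. The two bounds meet at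
    [t = n / 11], [m = 9 * n / 11], where they are about [1.763 ^ n] and [1.775 ^ n]. Pruning loses
    no solution because [X] is minimal: if deleting a nonterminal other than the root left all
    terminals connected to the root, the component of the root would be a smaller [X]. The head
    stays within the input and the cell after it. So the program has only bit arrays and pointers
    bounded by the input length [N]; an inner loop always makes [N] rounds, and its surplus rounds
    must be idle. *)

Record store := Mem { arr : nat -> nat -> bool; ptr : nat -> nat }.

Definition set_arr a i b m :=
  Mem (fun a' i' => if (a' == a) && (i' == i) then b else arr m a' i') (ptr m).

Definition set_ptr p x m := Mem (arr m) (fun p' => if p' == p then x else ptr m p').

Inductive instr :=
  | ISet of nat & nat & bool
  | IZero of nat
  | IInc of nat
  | IJA of nat & nat & nat
  | IJP of nat & nat & nat
  | IHalt of bool.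

Section Machine.
(* Tracks below [ka] hold arrays; track [ka + i] holds the single mark of
   pointer [i].  Pointer [ka] stays at cell 0 and pointer [ka + 1] at the first
   cell after the input; track 1 marks the cells of the input. *)
Variables (ka kt : nat) (code : seq instr).
Hypotheses (ka_ge : 1 < ka) (ka_lt : ka.+1 < kt).

Definition sym := {ffun 'I_kt.+1 -> bool}.

Definition bit (s : sym) j := s (inord j).

Definition setbit (s : sym) j b : sym := [ffun o => if o == inord j then b else s o].

Lemma bit_set s j b i : i <= kt -> j <= kt ->
  bit (setbit s j b) i = if i == j then b else bit s i.
Proof.
move=> hi hj; rewrite /bit ffunE; congr (if _ then _ else _).
by apply/eqP/eqP => [/(congr1 (@nat_of_ord _))|-> //]; rewrite !inordK.
Qed.

Definition instr_at pc := nth (IHalt false) code pc.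

Definition iptr i :=
  match i with
  | ISet _ p _ | IZero p | IInc p | IJA _ p _ | IJP p _ _ => p
  | IHalt _ => ka
  end.

(** Jumps are taken when the test fails. [IInc] saturates at the value of pointer [ka.+1], so no
    mark ever leaves the cells up to the first one after the input. *)
Definition step1 (c : nat * store) : nat * store :=
  let: (pc, m) := c in
  match instr_at pc with
  | ISet a p v => (pc.+1, set_arr a (ptr m p) v m)
  | IZero p => (pc.+1, set_ptr p 0 m)
  | IInc p => (pc.+1, if ptr m p == ptr m ka.+1 then m else set_ptr p (ptr m p).+1 m)
  | IJA a p l => (if arr m a (ptr m p) then pc.+1 else l, m)
  | IJP p q l => (if ptr m p == ptr m q then pc.+1 else l, m)
  | IHalt _ => c
  end.

Definition wf_ptr p := (ka <= p <= kt).
Definition wf_wptr p := (ka.+1 < p <= kt).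
Definition wf_instr i :=
  match i with
  | ISet a p _ => (1 < a < ka) && wf_ptr p
  | IZero p | IInc p => wf_wptr p
  | IJA a p l => [&& a < ka, wf_ptr p & l < size code]
  | IJP p q l => [&& wf_ptr p, wf_ptr q & l < size code]
  | IHalt _ => true
  end.

Definition state : finType := ('I_(size code).+1 * 'I_6)%type.
Definition st pc ph : state := (inord pc, inord ph).

(** The second component of a state is a phase. Phase 0 puts the marks of all pointers but [ka.+1]
    into cell 0; phase 1 scans the input and puts the mark of [ka.+1] behind it. Phase 2 rewinds to
    cell 0, recognised by the mark of [ka]; phase 3 looks for the mark of the instruction's pointer
    and acts there. A moved mark is put down again in phase 4, one cell to the right, for [IInc], or
    in phase 5, at cell 0, for [IZero]. *)
Definition delta (q : state) (s : sym) : state * sym * bool :=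
  let pc : nat := q.1 in
  let i := instr_at pc in
  match val q.2 with
  | 0 => (st 0 1, [ffun o : 'I_kt.+1 => if ka <= o then o != ka.+1 :> nat else s o], true)
  | 1 => if bit s 1 then (st 0 1, s, true) else (st 0 2, setbit s ka.+1 true, false)
  | 2 => (st pc (if bit s ka then 3 else 2), s, false)
  | 3 => if ~~ bit s (iptr i) then (st pc 3, s, true) else
    match i with
    | ISet a p v => (st pc.+1 2, setbit s a v, false)
    | IZero p => (st pc 5, setbit s p false, false)
    | IInc p => if bit s ka.+1 then (st pc.+1 2, s, false)
                else (st pc 4, setbit s p false, true)
    | IJA a p l => (st (if bit s a then pc.+1 else l) 2, s, false)
    | IJP p q l => (st (if bit s q then pc.+1 else l) 2, s, false)
    | IHalt _ => (st pc 2, s, false)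
    end
  | 4 => (st pc.+1 2, setbit s (iptr i) true, false)
  | _ => if bit s ka then (st pc.+1 2, setbit s (iptr i) true, false)
         else (st pc 5, s, false)
  end.

Definition halting (q : state) :=
  (q.2 == inord 2) && (if instr_at q.1 is IHalt _ then true else false).
Definition accepting (q : state) := if instr_at q.1 is IHalt b then b else false.

Definition machine : TM :=
  {| tm_state := state; tm_sym := sym; tm_blank := [ffun => false];
     tm_in := fun b => [ffun o : 'I_kt.+1 => if o == 0 :> nat then b else o == 1 :> nat];
     tm_start := st 0 0; tm_halt := halting; tm_accept := accepting;
     tm_delta := delta |}.

(** * Simulation of instructions by sweeps of the head *)

Notation step := (@tm_step machine).

Variable N : nat.

Definition runs (c : config machine) t c' :=
  iter t step c = c' /\ forall t', t' <= t -> (iter t' step c).2 <= N.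

Lemma runs0 (c : config machine) : c.2 <= N -> runs c 0 c.
Proof. by move=> h; split=> // t'; rewrite leqn0 => /eqP ->. Qed.

Lemma runs1 (c c' : config machine) : c.2 <= N -> c'.2 <= N -> step c = c' -> runs c 1 c'.
Proof. by move=> h h' e; split=> // [[|[|t']]] //= _; rewrite e. Qed.

Lemma runs_trans c t c' t' c'' : runs c t c' -> runs c' t' c'' -> runs c (t + t') c''.
Proof.
move=> [e b] [e' b']; split; first by rewrite addnC iterD e.
move=> s hs; case: (leqP s t) => [/b //|lt].
have -> : s = (s - t) + t by lia.
by rewrite iterD e; apply: b'; lia.
Qed.

(* [T j i] is the bit of track [j] in cell [i]. *)
Definition rep (c : config machine) pc ph pos (T : nat -> nat -> bool) :=
  [/\ c.1.1 = st pc ph, c.2 = pos & forall j i, j <= kt -> bit (c.1.2 i) j = T j i].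

Definition updT (T : nat -> nat -> bool) j i b := fun j' i' =>
  if (j' == j) && (i' == i) then b else T j' i'.

Lemma rep_ext c pc ph pos T T' : (forall j i, j <= kt -> T j i = T' j i) ->
  rep c pc ph pos T -> rep c pc ph pos T'.
Proof. by move=> h [e1 e2 e3]; split=> // j i hj; rewrite e3 // h. Qed.

Lemma repP c pc ph pos T : rep c pc ph pos T -> c = (st pc ph, c.1.2, pos).
Proof. by case: c => [[q tp] p] [/= -> -> _]. Qed.

Lemma halting_st pc ph : ph < 6 -> pc <= size code ->
  halting (st pc ph) = (ph == 2) && (if instr_at pc is IHalt _ then true else false).
Proof.
move=> h hpc; rewrite /halting /st /= inordK //; congr (_ && _).
by apply/eqP/eqP => [/(congr1 (@nat_of_ord _))|-> //]; rewrite !inordK.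
Qed.

Lemma stepE c pc ph pos T : rep c pc ph pos T -> ph < 6 -> pc <= size code ->
  (ph == 2) && (if instr_at pc is IHalt _ then true else false) = false ->
  step c = let: (q', s, r) := delta (st pc ph) (c.1.2 pos) in
    (q', (fun i => if i == pos then s else c.1.2 i), if r then pos.+1 else pos.-1).
Proof.
by move=> h hph hpc hh; rewrite {1}(repP h) /tm_step /tm_halt /= halting_st // hh.
Qed.

Lemma delta_st pc ph s : ph < 6 -> pc <= size code -> delta (st pc ph) s =
  let i := instr_at pc in
  match ph with
  | 0 => (st 0 1, [ffun o : 'I_kt.+1 => if ka <= o then o != ka.+1 :> nat else s o], true)
  | 1 => if bit s 1 then (st 0 1, s, true) else (st 0 2, setbit s ka.+1 true, false)
  | 2 => (st pc (if bit s ka then 3 else 2), s, false)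
  | 3 => if ~~ bit s (iptr i) then (st pc 3, s, true) else
    match i with
    | ISet a p v => (st pc.+1 2, setbit s a v, false)
    | IZero p => (st pc 5, setbit s p false, false)
    | IInc p => if bit s ka.+1 then (st pc.+1 2, s, false)
                else (st pc 4, setbit s p false, true)
    | IJA a p l => (st (if bit s a then pc.+1 else l) 2, s, false)
    | IJP p q l => (st (if bit s q then pc.+1 else l) 2, s, false)
    | IHalt _ => (st pc 2, s, false)
    end
  | 4 => (st pc.+1 2, setbit s (iptr i) true, false)
  | _ => if bit s ka then (st pc.+1 2, setbit s (iptr i) true, false)
         else (st pc 5, s, false)
  end.
Proof. by move=> h hpc; rewrite /delta /st /= !inordK. Qed.

Lemma rep_step c pc ph pos T pc' ph' s (r : bool) T' :
  rep c pc ph pos T -> pos <= N -> ph < 6 -> pc <= size code ->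
  (ph == 2) && (if instr_at pc is IHalt _ then true else false) = false ->
  delta (st pc ph) (c.1.2 pos) = (st pc' ph', s, r) ->
  (if r then pos.+1 else pos.-1) <= N ->
  (forall j, j <= kt -> bit s j = T' j pos) ->
  (forall j i, j <= kt -> i != pos -> T j i = T' j i) ->
  exists2 c', runs c 1 c' & rep c' pc' ph' (if r then pos.+1 else pos.-1) T'.
Proof.
move=> h hpos hph hpc hh hd hr hs hT.
have := stepE h hph hpc hh; rewrite hd => e.
eexists; first by apply: runs1 e => //; rewrite (repP h).
case: h => _ _ h; split=> //= j i hj; case: (eqVneq i pos) => [->|ne]; first exact: hs.
by rewrite h // hT.
Qed.

Lemma repB c pc ph pos T : rep c pc ph pos T -> forall j i, j <= kt -> bit (c.1.2 i) j = T j i.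
Proof. by case. Qed.

Lemma run_rewind pc pos c T : rep c pc 2 pos T -> pos <= N -> pc <= size code ->
  (forall i, T ka i = (i == 0)) ->
  (if instr_at pc is IHalt _ then true else false) = false ->
  exists2 c', runs c pos.+1 c' & rep c' pc 3 0 T.
Proof.
elim: pos c => [|pos IH] c h hpos hpc hO hi.
  apply: (rep_step (r := false) (s := c.1.2 0) h) => //.
  - by rewrite delta_st //= (repB h) ?hO //; lia.
  - by move=> j hj; rewrite (repB h).
have [||||||||c1 r1 h1] := rep_step (pc' := pc) (ph' := 2) (r := false) (s := c.1.2 pos.+1) (T' := T) h => //.
- by rewrite delta_st //= (repB h) ?hO //; lia.
- by rewrite /=; lia.
- by move=> j hj; rewrite (repB h).
have [||||c2 r2 h2] := IH _ h1 => //; first by rewrite /=; lia.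
by exists c2 => //; rewrite -add1n; apply: runs_trans r1 r2.
Qed.

Lemma run_scan pc k pos c T : rep c pc 3 pos T -> pos + k <= N -> pc <= size code ->
  iptr (instr_at pc) <= kt -> (forall i, i <= N -> T (iptr (instr_at pc)) i = (i == pos + k)) ->
  exists2 c', runs c k c' & rep c' pc 3 (pos + k) T.
Proof.
elim: k pos c => [|k IH] pos c h hpos hpc hi hT.
  by exists c; [apply: runs0; case: h => _ -> _; lia|rewrite addn0].
have [||||||||c1 r1 h1] := rep_step (pc' := pc) (ph' := 3) (r := true) (s := c.1.2 pos) (T' := T) h => //.
- by lia.
- rewrite delta_st //= (repB h) // hT; last lia.
  by case: eqP => //; lia.
- by lia.
- by move=> j hj; rewrite (repB h).
have [||||c2 r2 h2] := IH _ _ h1 => //; first by lia.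
  by move=> i /hT ->; rewrite addSnnS.
exists c2; last by rewrite -addSnnS.
by rewrite -add1n; apply: runs_trans r1 r2.
Qed.

Lemma run_back pc pos c T : rep c pc 5 pos T -> pos <= N -> pc <= size code ->
  iptr (instr_at pc) <= kt -> (forall i, T ka i = (i == 0)) ->
  exists2 c', runs c pos.+1 c' & rep c' pc.+1 2 0 (updT T (iptr (instr_at pc)) 0 true).
Proof.
elim: pos c => [|pos IH] c h hpos hpc hi hO.
  apply: (rep_step (r := false) (s := setbit (c.1.2 0) (iptr (instr_at pc)) true) h) => //.
  - by rewrite delta_st //= (repB h) ?hO //; lia.
  - by move=> j hj; rewrite bit_set // (repB h) // /updT eqxx andbT.
  - by move=> j i hj /negbTE ne; rewrite /updT ne andbF.
have [||||||||c1 r1 h1] := rep_step (pc' := pc) (ph' := 5) (r := false) (s := c.1.2 pos.+1) (T' := T) h => //.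
- by rewrite delta_st //= (repB h) ?hO //; lia.
- by rewrite /=; lia.
- by move=> j hj; rewrite (repB h).
have [||||c2 r2 h2] := IH _ h1 => //; first by rewrite /=; lia.
by exists c2 => //; rewrite -add1n; apply: runs_trans r1 r2.
Qed.

Definition trk m j i := if j < ka then arr m j i else i == ptr m j.

Definition okmem m := [/\ ptr m ka = 0, ptr m ka.+1 = N & forall p, ptr m p <= N].

Lemma okmem_step1 c : wf_instr (instr_at c.1) -> okmem c.2 -> okmem (step1 c).2.
Proof.
case: c => pc m; rewrite /step1 /=.
have okP p x : wf_wptr p -> x <= N -> okmem m -> okmem (set_ptr p x m).
  rewrite /wf_wptr => hp hx [h1 h2 h3]; split=> [||q] /=; last by case: eqP.
    by case: eqP => // e; lia.
  by case: eqP => // e; lia.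
case: (instr_at pc) => //= p hp hm; first exact: okP.
case: hm (hm) => [h1 h2 h3] hm; case: eqP => // hE; apply: okP => //.
by rewrite h2 in hE; have := h3 p; lia.
Qed.

(** An instruction consists of a rewind, a scan to the mark, the action there and, for [IZero], a
    walk back. Each of these walks has at most about [N] steps. *)
Lemma sim_step c pc m pos : rep c pc 2 pos (trk m) -> okmem m -> pos <= N ->
  pc < size code -> wf_instr (instr_at pc) ->
  (if instr_at pc is IHalt _ then true else false) = false ->
  exists t c' pos', [/\ t <= 4 * N + 8, runs c t c', pos' <= N &
    rep c' (step1 (pc, m)).1 2 pos' (trk (step1 (pc, m)).2)].
Proof.
move=> h [hO hE hN] hpos hpc hwf hh.
have hpc' : pc <= size code by lia.
have kO i : trk m ka i = (i == 0) by rewrite /trk ltnn hO.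
have kE i : trk m ka.+1 i = (i == N) by rewrite /trk ltnNge leqnSn hE.
have kP p i : wf_ptr p -> trk m p i = (i == ptr m p).
  by rewrite /trk /wf_ptr; case: ltnP => //; lia.
have wfi : wf_ptr (iptr (instr_at pc)).
  by case: (instr_at pc) hwf; rewrite /= /wf_ptr /wf_wptr; lia.
have wfi' : iptr (instr_at pc) <= kt by move: wfi; rewrite /wf_ptr; lia.
have [c1 r1 h1] := run_rewind h hpos hpc' kO hh.
have [p ep] : exists p, p = iptr (instr_at pc) by eexists.
rewrite -ep in wfi wfi'.
have [||||c2 r2 h2] := run_scan (k := ptr m p) h1 => //.
- by rewrite add0n.
- by rewrite -ep.
- by move=> i _; rewrite -ep kP.
rewrite add0n in h2.
have r12 := runs_trans r1 r2.
have hp := hN p.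
have bp : bit (c2.1.2 (ptr m p)) p by rewrite (repB h2) // kP //.
(* All instructions except [IZero] and an unsaturated [IInc] are completed in one step at the
   mark. *)
have fin1 pc' s T' : delta (st pc 3) (c2.1.2 (ptr m p)) = (st pc' 2, s, false) ->
    (forall j, j <= kt -> bit s j = T' j (ptr m p)) ->
    (forall j i, j <= kt -> i != ptr m p -> trk m j i = T' j i) ->
  exists t c' pos', [/\ t <= 4 * N + 8, runs c t c', pos' <= N & rep c' pc' 2 pos' T'].
  move=> hd hs hT.
  have [|||||c3 r3 h3] := rep_step (r := false) h2 _ _ _ _ hd _ hs hT => //.
    by rewrite /=; lia.
  exists (pos.+1 + ptr m p + 1), c3, (ptr m p).-1; split=> //; first by lia.
    exact: runs_trans r12 r3.
  by lia.
move: hwf (delta_st (c2.1.2 (ptr m p)) (isT : 3 < 6) hpc') hh; rewrite /= /step1 -ep bp /=.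
move: ep.
case ei: (instr_at pc) => [a q v|q|q|a q l|q q' l|b] //= ep; subst q.
- case/andP=> ha hq hd _; apply: fin1 hd _ _ => j.
    move=> hj; rewrite bit_set //; last by lia.
    rewrite (repB h2) // /trk /= eqxx andbT.
    by case: ltnP => // hj'; case: eqP => // e; lia.
  by move=> i hj /negbTE ne; rewrite /trk /= ne andbF.
- move=> hq hd _.
  have [|||||||c3 r3 h3] := rep_step (r := false) (T' := updT (trk m) p (ptr m p) false) h2 _ _ _ _ hd => //.
  + by rewrite /=; lia.
  + by move=> j hj; rewrite bit_set // (repB h2) // /updT eqxx andbT.
  + by move=> j i hj /negbTE ne; rewrite /updT ne andbF.
  have [|||c4 r4 h4] := run_back h3 _ hpc'; rewrite ?ei //=; first by lia.
    by move=> i; rewrite /updT kO; case: eqP => // e; move: hq; rewrite /wf_wptr -e; lia.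
  exists (pos.+1 + ptr m p + 1 + (ptr m p).-1.+1), c4, 0; split=> //; first by lia.
    exact: runs_trans (runs_trans r12 r3) r4.
  apply: rep_ext h4 => j i hj; rewrite ei /updT /trk /=.
  case: (eqVneq j p) => [->|//] /=.
  have -> : p < ka = false by move: wfi; rewrite /wf_ptr; lia.
  by case: (eqVneq i 0) => // ne; case: eqP.
- move=> hq; rewrite (repB h2) ?kE; last by lia.
  case: eqP => [e|ne] hd _.
    rewrite e hE eqxx; apply: fin1 hd _ _ => // j hj.
    by rewrite (repB h2).
  rewrite hE; case: eqP => // _.
  have [|||||||c3 r3 h3] := rep_step (r := true) (T' := updT (trk m) p (ptr m p) false) h2 _ _ _ _ hd => //.
  + by lia.
  + by move=> j hj; rewrite bit_set // (repB h2) // /updT eqxx andbT.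
  + by move=> j i hj /negbTE ne'; rewrite /updT ne' andbF.
  have hd4 := delta_st (c3.1.2 (ptr m p).+1) (isT : 4 < 6) hpc'.
  rewrite ei /= in hd4.
  have [|||||||c4 r4 h4] := rep_step (r := false) (T' := trk (set_ptr p (ptr m p).+1 m)) h3 _ _ _ _ hd4 => //.
  + by rewrite /=; lia.
  + move=> j hj; rewrite bit_set // (repB h3) // /updT /trk /=.
    have -> : (ptr m p).+1 == ptr m p = false by apply/eqP; lia.
    rewrite andbF; case: (eqVneq j p) => // ->; rewrite eqxx.
    by case: ltnP => // hh; move: wfi; rewrite /wf_ptr; lia.
  + move=> j i hj ne1; rewrite /updT /trk /=; case: (eqVneq j p) => //= ->.
    rewrite (negbTE ne1).
    have -> : p < ka = false by move: wfi; rewrite /wf_ptr; lia.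
    by case: eqP.
  exists (pos.+1 + ptr m p + 1 + 1), c4, (ptr m p); split=> //; first by lia.
  exact: runs_trans (runs_trans r12 r3) r4.
- case/and3P=> ha hq hl hd _.
  move: hd; rewrite (repB h2); last by lia.
  rewrite {1}/trk ha => hd; apply: fin1 hd _ _ => // j hj.
  by rewrite (repB h2).
- case/and3P=> ha hq hl hd _.
  move: hd; rewrite (repB h2); last by move: hq; rewrite /wf_ptr; lia.
  rewrite kP // => hd; apply: fin1 hd _ _ => // j hj.
  by rewrite (repB h2).
Qed.

Lemma sim_steps k c pc m pos : rep c pc 2 pos (trk m) -> okmem m -> pos <= N ->
  all wf_instr code ->
  (forall i, i < k -> (iter i step1 (pc, m)).1 < size code /\
     (if instr_at (iter i step1 (pc, m)).1 is IHalt _ then true else false) = false) ->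
  exists t c' pos', [/\ t <= k * (4 * N + 8), runs c t c', pos' <= N &
    rep c' (iter k step1 (pc, m)).1 2 pos' (trk (iter k step1 (pc, m)).2)].
Proof.
move=> h hm hpos hwf; elim: k => [|k IH] hk.
  by exists 0, c, pos; split=> //; apply: runs0; case: h => _ ->.
have [i lik|t [c1 [pos1 [ht r1 hpos1 h1]]]] := IH; first by apply: hk; lia.
have [hpc hh] := hk k (leqnn _).
have wf i : wf_instr (instr_at i).
  case: (ltnP i (size code)) => hi; first by rewrite (all_nthP _ hwf).
  by rewrite /instr_at nth_default.
have okm : okmem (iter k step1 (pc, m)).2.
  by elim: (k) => [|j IHj] //=; apply: okmem_step1.
have [t2 [c2 [pos2 [ht2 r2 hpos2 h2]]]] := sim_step h1 okm hpos1 hpc (wf _) hh.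
exists (t + t2), c2, pos2; split=> //; first by lia.
  exact: runs_trans r1 r2.
by rewrite iterS; case: (iter k step1 (pc, m)) h2.
Qed.

Definition mem0 (w : seq bool) := 
  Mem (fun a i => if a == 0 then nth false w i else (a == 1) && (i < size w))
      (fun p => if p == ka.+1 then size w else 0).

Lemma sim_init w : 0 < size w -> size w = N ->
  exists c', runs (init_config machine w) N.+1 c' /\ exists2 pos', pos' <= N & rep c' 0 2 pos' (trk (mem0 w)).
Proof.
move=> w0 wN.
pose T0 j i := if j < ka then arr (mem0 w) j i else false.
have h0 : rep (init_config machine w) 0 0 0 T0.
  split=> // j i hj /=; rewrite /T0 /=.
  case: (ltnP i (size w)) => hi.
    rewrite (nth_map false) // /bit ffunE inordK //.
    by rewrite andbT; case: ltnP => hj' //; case: (eqVneq j 0) => ?; [lia|case: eqP; lia].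
  rewrite nth_default ?size_map // /bit ffunE andbF nth_default //.
  by case: ifP => //; case: ifP.
pose T1 j i := if j < ka then arr (mem0 w) j i else (i == 0) && (j != ka.+1).
have hd := delta_st ((init_config machine w).1.2 0) (isT : 0 < 6) (leq0n (size code)).
have [|||||||c1 r1 h1] := rep_step (r := true) (T' := T1) h0 _ _ _ _ hd => //.
- by lia.
- move=> j hj; rewrite /bit ffunE inordK // /T1 leqNgt.
  by case: ltnP => hj' //=; have := repB h0 0 hj; rewrite /bit => ->; rewrite /T0 hj'.
- by move=> j i hj /negbTE ne; rewrite /T0 /T1 ne.
have scan k : k < N -> exists2 c2, runs c1 k c2 & rep c2 0 1 k.+1 T1.
  elim: k => [|k IH] hk; first by exists c1 => //; apply: runs0; case: h1 => _ ->.
  have [|c2 r2 h2] := IH; first lia.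
  have [||||||||c3 r3 h3] := rep_step (pc' := 0) (ph' := 1) (r := true) (s := c2.1.2 k.+1) (T' := T1) h2 => //.
  - by lia.
  - rewrite delta_st //= (repB h2) /T1 /=; last by lia.
    by rewrite ka_ge /= wN hk.
  - by move=> j hj; rewrite (repB h2).
  by exists c3 => //; rewrite -addn1; apply: runs_trans r2 r3.
have [|c2 r2 h2] := scan N.-1; first lia.
have e : N.-1.+1 = N by lia.
rewrite e in h2.
have [||||||||c3 r3 h3] := rep_step (pc' := 0) (ph' := 2) (r := false) (s := setbit (c2.1.2 N) ka.+1 true) (T' := trk (mem0 w)) h2 => //.
- rewrite delta_st //= (repB h2) /T1 /=; last by lia.
  by rewrite ka_ge /= wN ltnn.
- by rewrite /=; lia.
- move=> j hj; rewrite bit_set //; last lia.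
  rewrite (repB h2) // /T1 /trk /=; case: (eqVneq j ka.+1) => [->|ne]; last by rewrite andbT.
  by rewrite ltnNge leqnSn /= wN eqxx.
- move=> j i hj ne; rewrite /T1 /trk /=; case: ltnP => // _.
  by case: (eqVneq j ka.+1) => [_|_]; rewrite ?andbT // andbF wN; apply/esym/negbTE.
exists c3; split; last by exists N.-1 => //; lia.
have -> : N.+1 = 1 + N.-1 + 1 by lia.
exact: runs_trans (runs_trans r1 r2) r3.
Qed.

Theorem machine_correct w k b : 0 < size w -> size w = N -> all wf_instr code ->
  (forall i, i < k -> (iter i step1 (0, mem0 w)).1 < size code /\
     (if instr_at (iter i step1 (0, mem0 w)).1 is IHalt _ then true else false) = false) ->
  (iter k step1 (0, mem0 w)).1 < size code ->
  instr_at (iter k step1 (0, mem0 w)).1 = IHalt b ->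
  tm_decides_within machine w (k * (4 * N + 8) + N.+1) N b.
Proof.
move=> w0 wN wf hk hs hb.
have [c1 [r1 [pos1 hpos1 h1]]] := sim_init w0 wN.
have okm : okmem (mem0 w).
  by split=> [||p] /=; rewrite ?eqxx // ?wN; case: eqP => // ; lia.
have [t [c2 [pos2 [ht r2 hpos2 h2]]]] := sim_steps h1 okm hpos1 wf hk.
have [e bnd] := runs_trans r1 r2.
exists (N.+1 + t); split; first by lia.
rewrite /tm_run e; case: h2 => -> _ _; split; last split.
- by rewrite /= halting_st ?hb //; apply: ltnW.
- by rewrite /= /accepting /st /= inordK ?hb //; apply: ltnW.
- by move=> t' ht'; apply: bnd.
Qed.

End Machine.

(** * Loop programs and their compilation *)

Inductive bexp :=
  | BA of nat & nat | BE of nat & nat | BAdj of nat & nat | BLe of nat & nat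
  | BN of bexp | BAnd of bexp & bexp.

Inductive cmd :=
  | Skip
  | Set_ of nat & nat & bool
  | Zero of nat
  | Inc of nat
  | Seq of cmd & cmd
  | If of bexp & cmd & cmd
  | Rep of cmd.

Section Semantics.
Variables (np N : nat).

(** [BAdj] looks up the adjacency matrix in the input itself; its rows start at cell [n.+1], after
    the unary prefix and the separator. The [minn] reflects that the address will be computed by a
    saturating pointer. *)
Fixpoint bev (b : bexp) (m : store) : bool :=
  match b with
  | BA a p => arr m a (ptr m p)
  | BE p q => ptr m p == ptr m q
  | BAdj p q => let n := ptr m np in arr m 0 (minn N (n.+1 + ptr m p * n + ptr m q))
  | BLe p q => ptr m p <= ptr m q
  | BN b => ~~ bev b m
  | BAnd b b' => bev b m && bev b' m
  end.

Fixpoint den (c : cmd) (m : store) : store :=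
  match c with
  | Skip => m
  | Set_ a p v => set_arr a (ptr m p) v m
  | Zero p => set_ptr p 0 m
  | Inc p => if ptr m p == N then m else set_ptr p (ptr m p).+1 m
  | Seq c1 c2 => den c2 (den c1 m)
  | If b c1 c2 => if bev b m then den c1 m else den c2 m
  | Rep c => iter N (den c) m
  end.
End Semantics.

(** A round of [Rep] adds the test, the increment and the jump back. The final 3 are the reset of
    the counter, the last test and the exit jump. *)
Fixpoint cost N (c : cmd) :=
  match c with
  | Skip => 0
  | Seq c1 c2 => cost N c1 + cost N c2
  | If _ c1 c2 => cost N c1 + cost N c2 + 2
  | Rep c => N * (cost N c + 3) + 3
  | _ => 1
  end.

Lemma cost_poly c : exists C k, forall N, cost N c <= C * N.+1 ^ k.
Proof.
elim: c => [|a p v|p|p|c1 [C1 [k1 h1]] c2 [C2 [k2 h2]]|b c1 [C1 [k1 h1]] c2 [C2 [k2 h2]]|c [C [k h]]] /=;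
  try by [exists 0, 0|exists 1, 0].
- exists (C1 + C2), (k1 + k2) => N; rewrite mulnDl leq_add //.
    by apply: leq_trans (h1 N) _; rewrite leq_mul2l leq_pexp2l ?orbT ?leq_addr.
  by apply: leq_trans (h2 N) _; rewrite leq_mul2l leq_pexp2l ?orbT ?leq_addl.
- exists (C1 + C2 + 2), (k1 + k2) => N; rewrite !mulnDl leq_add //; last first.
    by rewrite -[leqLHS]muln1 leq_mul2l expn_gt0.
  rewrite leq_add //.
    by apply: leq_trans (h1 N) _; rewrite leq_mul2l leq_pexp2l ?orbT ?leq_addr.
  by apply: leq_trans (h2 N) _; rewrite leq_mul2l leq_pexp2l ?orbT ?leq_addl.
exists (C + 6), k.+1 => N; have := h N; rewrite expnS.
by have : 0 < N.+1 ^ k by [rewrite expn_gt0]; move: (N.+1 ^ k) => X; nia.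
Qed.

(** * Compilation of loop programs to jump code *)

Section Compile.
(* Tracks [lb] and above are the loop counters, one per nesting depth. *)
Variables (ka lb kt : nat).
Hypotheses (ka_ge : 1 < ka) (ka_lb : ka.+2 < lb) (lb_kt : lb <= kt).

Definition rp p := (ka <= p < lb).
Definition wp p := (ka.+1 < p < lb).

(** Only the tests [BA] and [BE] correspond to a single instruction; the others have to be
    eliminated beforehand. The depth [d] selects the loop counter. *)
Fixpoint wfc d (c : cmd) :=
  match c with
  | Skip => true
  | Set_ a p v => (1 < a < ka) && rp p
  | Zero p | Inc p => wp p
  | Seq c1 c2 => wfc d c1 && wfc d c2
  | If (BA a p) c1 c2 => [&& a < ka, rp p, wfc d c1 & wfc d c2]
  | If (BE p q) c1 c2 => [&& rp p, rp q, wfc d c1 & wfc d c2]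
  | If _ _ _ => false
  | Rep c => (lb + d <= kt) && wfc d.+1 c
  end.

Fixpoint clen c :=
  match c with
  | Skip => 0
  | Seq c1 c2 => clen c1 + clen c2
  | If _ c1 c2 => (clen c1 + clen c2).+2
  | Rep c => clen c + 5
  | _ => 1
  end.

(** Always taken on a nonempty input: the two pointers stay at 0 and at [N], and [IJP] jumps on
    inequality. *)
Definition jmp l := IJP ka ka.+1 l.

Definition branch b l :=
  match b with
  | BA a p => IJA a p l
  | BE p q => IJP p q l
  | _ => jmp l
  end.

Fixpoint compile d off c : seq instr :=
  match c with
  | Skip => [::]
  | Set_ a p v => [:: ISet a p v]
  | Zero p => [:: IZero p]
  | Inc p => [:: IInc p]
  | Seq c1 c2 => compile d off c1 ++ compile d (off + clen c1) c2
  | If b c1 c2 =>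
    branch b (off + (clen c1).+2) :: compile d off.+1 c1 ++
    jmp (off + (clen c1 + clen c2).+2) :: compile d (off + (clen c1).+2) c2
  | Rep c =>
    [:: IZero (lb + d); IJP (lb + d) ka.+1 (off + 3); jmp (off + (clen c + 5))] ++
    compile d.+1 (off + 3) c ++ [:: IInc (lb + d); jmp off.+1]
  end.

Lemma size_compile d off c : size (compile d off c) = clen c.
Proof.
elim: c d off => //= [c1 h1 c2 h2|b c1 h1 c2 h2|c h] d off.
- by rewrite size_cat h1 h2.
- by rewrite size_cat /= h1 h2 addnS.
- by rewrite size_cat /= h; lia.
Qed.

Definition nohalt i := if i is IHalt _ then false else true.

Lemma compile_nohalt d off c : all nohalt (compile d off c).
Proof.
elim: c d off => //= [c1 h1 c2 h2|b c1 h1 c2 h2|c h] d off.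
- by rewrite all_cat h1 h2.
- by rewrite all_cat /= h1 h2; case: b.
- by rewrite all_cat /= h.
Qed.

Lemma compile_wf code d off c : wfc d c -> off + clen c < size code ->
  all (wf_instr ka kt code) (compile d off c).
Proof.
elim: c d off => [|a p v|p|p|c1 h1 c2 h2|b c1 h1 c2 h2|c h] d off //=; rewrite ?andbT.
- by case/andP=> -> /=; rewrite /rp /wf_ptr; lia.
- by rewrite /wp /wf_wptr; lia.
- by rewrite /wp /wf_wptr; lia.
- by case/andP=> w1 w2 hs; rewrite all_cat h1 // ?h2 //; lia.
- move=> w hs.
  have [wb w1 w2] : [/\ wf_instr ka kt code (branch b (off + (clen c1).+2)), wfc d c1 & wfc d c2].
    case: b w => //= [a p|p q]; case/and4P=> ha hb -> ->; split=> //.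
      by rewrite ha /=; move: hb; rewrite /rp /wf_ptr; lia.
    by move: ha hb; rewrite /rp /wf_ptr; lia.
  rewrite all_cat wb h1 // /=; last by lia.
  by rewrite h2 // ?andbT /wf_ptr; lia.
- case/andP=> hd w hs; rewrite all_cat /= h //; last by lia.
  by rewrite /wf_ptr /wf_wptr; lia.
Qed.

Section Run.
Variable code : seq instr.

Definition seg off s := forall i, i < size s ->
  instr_at code (off + i) = nth (IHalt false) s i.

Lemma seg_cat off s1 s2 : seg off (s1 ++ s2) -> seg off s1 /\ seg (off + size s1) s2.
Proof.
move=> h; split=> i hi.
  by rewrite h ?nth_cat ?hi // size_cat; lia.
rewrite -addnA h ?size_cat ?nth_cat; last by lia.
by rewrite ltnNge leq_addr addKn.
Qed.

Lemma seg_cons off x s : seg off (x :: s) -> instr_at code off = x /\ seg off.+1 s.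
Proof.
move=> h; split; first by have := h 0 isT; rewrite addn0.
by move=> i hi; rewrite addSnnS h.
Qed.

Variable N : nat.
Hypothesis N0 : 0 < N.

Notation step := (step1 ka code).
Notation dn := (den ka.+2 N).

(** Equality up to the pointers that belong to the translation: the loop counters from [lb] on, and
    later, with a lower bound in place of [lb], the scratch pointers too. *)
Definition agree (m m' : store) := (forall a i, arr m a i = arr m' a i) /\
  (forall p, p < lb -> ptr m p = ptr m' p).

Definition fixed (m : store) := ptr m ka = 0 /\ ptr m ka.+1 = N.

Lemma fixed_set_ptr m p x : wp p -> fixed m -> fixed (set_ptr p x m).
Proof.
by rewrite /wp /fixed /= => hp [-> ->]; split; case: eqP => // e; lia.
Qed.

Lemma fixed_den d c m : wfc d c -> fixed m -> fixed (dn c m).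
Proof.
elim: c d m => [|a p v|p|p|c1 h1 c2 h2|b c1 h1 c2 h2|c h] d m //= w hm.
- exact: fixed_set_ptr.
- by case: eqP => // _; apply: fixed_set_ptr.
- by case/andP: w => w1 w2; apply: h2 w2 _; apply: h1 w1 _.
- have [w1 w2] : wfc d c1 /\ wfc d c2 by case: b w => //= ? ? /and4P[].
  by case: ifP => _; [apply: h1 w1 _|apply: h2 w2 _].
- case/andP: w => _ w.
  have: forall k, fixed (iter k (dn c) m) by elim=> //= k; apply: h w.
  exact.
Qed.

Definition go off l k (c c' : nat * store) :=
  iter k step c = c' /\ forall i, i < k -> off <= (iter i step c).1 < l.

Lemma go1 off l c c' : off <= c.1 < l -> step c = c' -> go off l 1 c c'.
Proof. by move=> h e; split=> // -[|]. Qed.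

Lemma go_trans off l k k' c c' c'' :
  go off l k c c' -> go off l k' c' c'' -> go off l (k + k') c c''.
Proof.
move=> [e b] [e' b']; split; first by rewrite addnC iterD e.
move=> i hi; case: (ltnP i k) => [/b //|hk].
have -> : i = (i - k) + k by lia.
by rewrite iterD e; apply: b'; lia.
Qed.

Lemma go_weaken off l off' l' k c c' : off' <= off -> l <= l' -> go off l k c c' -> go off' l' k c c'.
Proof. by move=> h h' [e b]; split=> // i /b; lia. Qed.

Lemma step_jmp off l m : fixed m -> instr_at code off = jmp l -> step (off, m) = (l, m).
Proof. by move=> [h h'] /= ->; rewrite /= h h'; case: eqP => //; lia. Qed.

Lemma agree_fixed m m' : agree m m' -> fixed m' -> fixed m.
Proof. by move=> [_ h] [h1 h2]; split; rewrite h // ; lia. Qed.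

Lemma branch_ok d b c1 c2 l off m m' : wfc d (If b c1 c2) -> agree m m' ->
  instr_at code off = branch b l ->
  step (off, m) = (if bev ka.+2 N b m' then off.+1 else l, m).
Proof.
move=> w [h1 h2] /= ->; case: b w => //= [a p|p q] /and4P[hp hq _ _]; rewrite /rp in hp hq.
  by rewrite h1 h2 //; lia.
by rewrite !h2 //; lia.
Qed.

(** The last conjunct is what makes nested loops work: code compiled at depth [d] writes no counter
    of smaller depth, so the counter of an enclosing loop survives the body. *)
Lemma compile_ok c d off m m' : wfc d c -> seg off (compile d off c) -> agree m m' -> fixed m' ->
  exists k m1, [/\ k <= cost N c, go off (off + clen c) k (off, m) (off + clen c, m1),
    agree m1 (dn c m') & forall d', d' < d -> ptr m1 (lb + d') = ptr m (lb + d')].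
Proof.
elim: c d off m m' => [|a p v|p|p|c1 h1 c2 h2|b c1 h1 c2 h2|c h] d off m m' w sg ag fx.
- by exists 0, m; rewrite addn0.
- have /= [e _] := seg_cons sg; exists 1, (set_arr a (ptr m p) v m); split=> //.
    by apply: go1; rewrite /= ?e ?addn1 //; lia.
  case: ag => ha hp; move: w => /= /andP[_]; rewrite /rp => w.
  by split=> [a' i|] //=; rewrite hp ?ha //; lia.
- have /= [e _] := seg_cons sg; exists 1, (set_ptr p 0 m); split=> //.
  + by apply: go1; rewrite /= ?e ?addn1 //; lia.
  + by case: ag => ha hp; split=> // q hq /=; rewrite hp.
  + by move=> d' _ /=; move: w; rewrite /= /wp; case: eqP => //; lia.
- have /= [e _] := seg_cons sg.
  exists 1, (if ptr m p == N then m else set_ptr p (ptr m p).+1 m); split=> //.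
  + apply: go1; rewrite /= ?e ?addn1 //; first by lia.
    by have [_ ->] := agree_fixed ag fx.
  + move: w; rewrite /= /wp => w; case: (ag) => ha hp; rewrite hp; last lia.
    by case: eqP => // _; split=> // q hq /=; rewrite hp.
  + by move=> d' _ /=; move: w; rewrite /= /wp; case: ifP => //= _; case: eqP => //; lia.
- case/andP: w => w1 w2; have [s1 s2] := seg_cat sg; rewrite size_compile in s2.
  have [k1 [m1 [hk1 g1 a1 p1]]] := h1 _ _ _ _ w1 s1 ag fx.
  have [k2 [m2 [hk2 g2 a2 p2]]] := h2 _ _ _ _ w2 s2 a1 (fixed_den w1 fx).
  exists (k1 + k2), m2; split=> /=.
  + by lia.
  + rewrite addnA; apply: go_trans (go_weaken _ _ g1) (go_weaken _ _ g2); lia.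
  + by [].
  + by move=> d' hd; rewrite p2 ?p1.
- have [e {}sg] := seg_cons sg; have [s1 {}sg] := seg_cat sg; rewrite size_compile in sg.
  have [e' s2] := seg_cons sg.
  have [w1 w2] : wfc d c1 /\ wfc d c2 by case: (b) w => //= ? ? /and4P[].
  have ce : (off.+1 + clen c1).+1 = off + (clen c1).+2 by lia.
  rewrite ce in s2.
  have st1 := branch_ok w ag e.
  rewrite [dn (If _ _ _) _]/=; case: (bev _ _ _ _) st1 => st1.
    have [k1 [m1 [hk1 g1 a1 p1]]] := h1 _ _ _ _ w1 s1 ag fx.
    exists (1 + (k1 + 1)), m1; split=> //=; first lia.
    apply: go_trans (go1 _ st1) _; first by rewrite /=; lia.
    apply: go_trans (go_weaken _ _ g1) (go1 _ _); [lia|lia|rewrite /=; lia|].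
    by apply: step_jmp => //; apply: agree_fixed a1 (fixed_den w1 fx).
  have [k2 [m2 [hk2 g2 a2 p2]]] := h2 _ _ _ _ w2 s2 ag fx.
  exists (1 + k2), m2; split=> //=; first lia.
  apply: go_trans (go1 _ st1) _; first by rewrite /=; lia.
  have -> : off + (clen c1 + clen c2).+2 = off + (clen c1).+2 + clen c2 by lia.
  apply: go_weaken g2; lia.
- case/andP: w => hd w.
  have [e0 {}sg] := seg_cons sg; have [e1 {}sg] := seg_cons sg; have [e2 {}sg] := seg_cons sg.
  have [s1 {}sg] := seg_cat sg; rewrite size_compile in sg.
  have [e3 {}sg] := seg_cons sg; have [e4 {}sg] := seg_cons sg.
  set l := off + clen (Rep c); have el : l = off + clen c + 5 by rewrite /l /=; lia.
  (* This is the situation at the loop test after [j] rounds, with the counter equal to [j]. The 1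
     in the cost is the reset of the counter. *)
  have loop j : j <= N -> exists k m1, [/\ k <= 1 + j * (cost N c + 3),
      go off l k (off, m) (off.+1, m1), agree m1 (iter j (dn c) m'), ptr m1 (lb + d) = j &
      forall d', d' < d -> ptr m1 (lb + d') = ptr m (lb + d')].
    elim: j => [|j IH] hj.
      exists 1, (set_ptr (lb + d) 0 m); split=> //=.
      + by apply: go1; rewrite /= ?e0 //; lia.
      + by case: ag => ha hp; split=> // q hq /=; rewrite hp //; case: eqP => //; lia.
      + by rewrite eqxx.
      + by move=> d' hd'; case: eqP => //; lia.
    have [|k [m1 [hk g a1 pj pd]]] := IH; first lia.
    have fj : fixed (iter j (dn c) m').
      by elim: (j) => //= j' IHj; apply: fixed_den w _.
    have f1 := agree_fixed a1 fj.
    have e5 : step (off.+1, m1) = (off + 3, m1).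
      by rewrite /step1 e1 pj; case: f1 => _ ->; case: eqP => //; lia.
    have ce : off.+3 = off + 3 by lia.
    rewrite ce in s1.
    have [k1 [m2 [hk1 g1 a2 p2]]] := h _ _ _ _ w s1 a1 fj.
    have f2 := agree_fixed a2 (fixed_den w fj).
    pose m3 := set_ptr (lb + d) j.+1 m2.
    have e6 : step (off + 3 + clen c, m2) = ((off + 3 + clen c).+1, m3).
      rewrite ce in e3; rewrite /step1 e3 p2 // pj; case: f2 => _ ->.
      by case: eqP => //; lia.
    have f3 : fixed m3 by case: f2 => h1 h2; split; rewrite /m3 /=; case: eqP => //; lia.
    have e7 : step ((off + 3 + clen c).+1, m3) = (off.+1, m3).
      by rewrite ce in e4; apply: step_jmp.
    exists (k + (1 + (k1 + (1 + 1)))), m3; split.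
    + by rewrite mulSn; lia.
    + apply: go_trans g _; apply: go_trans (go1 _ e5) _; first by rewrite /= el; lia.
      apply: go_trans (go_weaken _ _ g1) _; rewrite ?el; try lia.
      by apply: go_trans (go1 _ e6) (go1 _ e7); rewrite /=; lia.
    + case: a2 => ha hp; split=> [a i|q hq] /=; first by rewrite ha.
      by case: eqP => [|_]; [lia|rewrite hp].
    + by rewrite /m3 /= eqxx.
    + move=> d' hd'; rewrite /m3 /=; case: eqP => [|_]; first lia.
      by rewrite p2 ?pd //; lia.
  have [k [m1 [hk g a1 pj pd]]] := loop N (leqnn _).
  have fj : fixed (iter N (dn c) m').
    have: forall i, fixed (iter i (dn c) m') by elim=> //= i; apply: fixed_den w.
    exact.
  have f1 := agree_fixed a1 fj.
  have e5 : step (off.+1, m1) = (off.+2, m1).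
    by rewrite /step1 e1 pj; case: f1 => _ ->; rewrite eqxx.
  have e6 : step (off.+2, m1) = (l, m1) by apply: step_jmp.
  exists (k + (1 + 1)), m1; split=> //; first by rewrite /=; lia.
  by apply: go_trans g _; apply: go_trans (go1 _ e5) (go1 _ e6); rewrite /= el; lia.
Qed.

End Run.

(* Runs [body] after [ini] until bit [da] of cell 0 is set; then bit [aa] of
   cell 0 is the answer. *)
Definition main_code da aa ini body :=
  let l := clen ini in
  compile 0 0 ini ++ [:: IJA da ka (l + 4); IJA aa ka (l + 3); IHalt true; IHalt false] ++
  compile 0 (l + 4) body ++ [:: jmp l].

Theorem main_ok da aa ini body (m0 : store) N I :
  let code := main_code da aa ini body in
  let s i := iter i (den ka.+2 N body) (den ka.+2 N ini m0) in
  0 < N -> wfc 0 ini -> wfc 0 body -> fixed N m0 ->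
  (forall i, i < I -> arr (s i) da 0 = false) -> arr (s I) da 0 ->
  exists k, [/\ k <= cost N ini + I * (cost N body + 2) + 2,
    forall i, i < k -> (iter i (step1 ka code) (0, m0)).1 < size code /\
      nohalt (instr_at code (iter i (step1 ka code) (0, m0)).1),
    (iter k (step1 ka code) (0, m0)).1 < size code &
    instr_at code (iter k (step1 ka code) (0, m0)).1 = IHalt (arr (s I) aa 0)].
Proof.
move=> code s N0 wi wb fx hI hD; set l := clen ini.
have szc : size code = l + clen body + 5.
  by rewrite /code /main_code !(size_cat, size_compile) /= -/l; lia.
have sg0 : seg code 0 code by move=> i hi.
have [si sg1] := seg_cat sg0; rewrite size_compile add0n -/l in sg1.
have [e0 {}sg1] := seg_cons sg1; have [e1 {}sg1] := seg_cons sg1.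
have [e2 {}sg1] := seg_cons sg1; have [e3 {}sg1] := seg_cons sg1.
have ce : l.+4 = l + 4 by lia.
rewrite ce in sg1; have [sb {}sg1] := seg_cat sg1; rewrite size_compile in sg1.
have [e4 _] := seg_cons sg1.
pose okp pc := (pc < size code) && nohalt (instr_at code pc).
have oks off s0 k c c' : seg code off s0 -> all nohalt s0 -> off + size s0 <= size code ->
    go code off (off + size s0) k c c' -> forall i, i < k -> okp (iter i (step1 ka code) c).1.
  move=> hs hn hsz [_ hg] i /hg hi; rewrite /okp; set pc := (iter _ _ _).1 in hi *.
  have -> : pc = off + (pc - off) by lia.
  rewrite hs; last by lia.
  by rewrite (all_nthP _ hn) ?andbT; lia.
pose path k c c' := iter k (step1 ka code) c = c' /\
  forall i, i < k -> okp (iter i (step1 ka code) c).1.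
have path_trans k k' c c' c'' : path k c c' -> path k' c' c'' -> path (k + k') c c''.
  move=> [e b] [e' b']; split; first by rewrite addnC iterD e.
  move=> i hi; case: (ltnP i k) => [/b //|hk].
  have -> : i = (i - k) + k by lia.
  by rewrite iterD e; apply: b'; lia.
have path1 c c' : okp c.1 -> step1 ka code c = c' -> path 1 c c'.
  by move=> h e; split=> // -[|].
have fxs i : fixed N (s i).
  by rewrite /s; elim: i => /= [|i IH]; [exact: (fixed_den N0 wi fx)|exact: (fixed_den N0 wb IH)].
have ag0 : agree m0 m0 by [].
have loop j : j <= I -> exists k m1, [/\ k <= cost N ini + j * (cost N body + 2),
    path k (0, m0) (l, m1) & agree m1 (s j)].
  elim: j => [|j IH] hj.
    have [k [m1 [hk g a1 _]]] := compile_ok N0 wi si ag0 fx.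
    exists k, m1; split=> //; first by lia.
    split; first by case: g.
    apply: (oks _ _ _ _ _ si (compile_nohalt _ _ _)); rewrite size_compile ?szc; first by lia.
    exact: g.
  have [|k [m1 [hk p1 a1]]] := IH; first lia.
  have f1 := agree_fixed N0 a1 (fxs j).
  have st0 : step1 ka code (l, m1) = (l + 4, m1).
    by rewrite /step1 e0; case: (a1) (f1) => ha _ [-> _]; rewrite ha hI.
  have [k2 [m2 [hk2 g2 a2 _]]] := compile_ok N0 wb sb a1 (fxs j).
  have f2 := agree_fixed N0 a2 (fxs j.+1).
  have st2 : step1 ka code (l + 4 + clen body, m2) = (l, m2) by apply: (step_jmp N0 _ e4).
  exists (k + (1 + (k2 + 1))), m2; split=> //; first by lia.
  apply: path_trans p1 (path_trans _ _ _ _ _ (path1 _ _ _ st0) (path_trans _ _ _ _ _ _ (path1 _ _ _ st2))).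
  - by rewrite /okp [_.1]/= e0 szc andbT; lia.
  - split; first by case: g2.
    apply: (oks _ _ _ _ _ sb (compile_nohalt _ _ _)); rewrite size_compile ?szc; first by lia.
    exact: g2.
  - by rewrite /okp [_.1]/= e4 szc andbT; lia.
have [k [m1 [hk p1 a1]]] := loop I (leqnn _).
have f1 := agree_fixed N0 a1 (fxs I).
have st0 : step1 ka code (l, m1) = (l.+1, m1).
  by rewrite /step1 e0; case: (a1) (f1) => ha _ [-> _]; rewrite ha hD.
have st1 : step1 ka code (l.+1, m1) = (if arr (s I) aa 0 then l.+2 else l + 3, m1).
  by rewrite /step1 e1; case: (a1) (f1) => ha _ [-> _]; rewrite ha.
have [e b] : path (k + (1 + 1)) (0, m0) (if arr (s I) aa 0 then l.+2 else l + 3, m1).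
  apply: path_trans p1 (path_trans _ _ _ _ _ (path1 _ _ _ st0) (path1 _ _ _ st1)).
  - by rewrite /okp [_.1]/= e0 szc andbT; lia.
  - by rewrite /okp [_.1]/= e1 szc andbT; lia.
exists (k + (1 + 1)); split.
- by lia.
- by move=> i /b /andP.
- by rewrite e /= szc; case: ifP; lia.
- have c3 : l.+3 = l + 3 by lia.
  by rewrite e /=; case: ifP => _ //; rewrite -c3.
Qed.

Lemma main_wf da aa ini body : da < ka -> aa < ka -> wfc 0 ini -> wfc 0 body ->
  all (wf_instr ka kt (main_code da aa ini body)) (main_code da aa ini body).
Proof.
move=> hda haa wi wb; set code := main_code da aa ini body.
have szc : size code = clen ini + clen body + 5.
  by rewrite /code /main_code !(size_cat, size_compile) /=; lia.
rewrite {2}/code /main_code /= all_cat compile_wf //=; last by rewrite szc; lia.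
rewrite all_cat compile_wf //=; last by rewrite szc; lia.
by rewrite hda haa szc /wf_ptr; lia.
Qed.

End Compile.

(** * Elimination of compound tests *)

Lemma ptr_set p x m q : ptr (set_ptr p x m) q = if q == p then x else ptr m q.
Proof. by []. Qed.

Definition upto r p c := Seq (Zero r) (Rep (If (BE r p) Skip (Seq c (Inc r)))).

(** Invariant rule for [upto]. Among the [N] rounds of [Rep] the first [x] execute the body; the
    others find [r] equal to [p] and do nothing. Hence the counter is [minn k x] after [k]
    rounds. *)
Lemma den_upto np N r p c m x (Inv : nat -> store -> Prop) : r != p ->
  ptr m p = x -> x <= N -> Inv 0 (set_ptr r 0 m) ->
  (forall k s, k < x -> Inv k s -> ptr s r = k -> ptr s p = x ->
    [/\ ptr (den np N c s) r = k, ptr (den np N c s) p = x &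
        Inv k.+1 (set_ptr r k.+1 (den np N c s))]) ->
  let m' := den np N (upto r p c) m in [/\ Inv x m', ptr m' r = x & ptr m' p = x].
Proof.
move=> rp px xN h0 hS /=; set f := fun s => _.
suff h k : let s := iter k f (set_ptr r 0 m) in
    [/\ Inv (minn k x) s, ptr s r = minn k x & ptr s p = x].
  by have := h N; rewrite (minn_idPr xN).
elim: k => [|k]; first by rewrite min0n /= eqxx eq_sym (negbTE rp).
rewrite iterS; move: (iter k f _) => s [hi hr hp].
rewrite /f hp; case: (ltnP k x) => hk; last first.
  have e1 : minn k x = x by lia.
  have e2 : minn k.+1 x = x by lia.
  by rewrite e1 in hi hr; rewrite hr e2 eqxx.
rewrite hr; have e1 : minn k x = k by lia.
have e2 : minn k.+1 x = k.+1 by lia.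
rewrite e1 in hi hr; rewrite e1 e2; case: eqP => [|_]; first lia.
have [h1 h2 h3] := hS _ _ hk hi hr hp.
rewrite h1; case: eqP => [|_]; first lia.
by split=> //=; rewrite ?eqxx // eq_sym (negbTE rp).
Qed.

Definition bounded N (m : store) := forall p, ptr m p <= N.

Lemma den_bounded np N c m : bounded N m -> bounded N (den np N c m).
Proof.
elim: c m => //= [p|p|c1 h1 c2 h2|b c1 h1 c2 h2|c h] m hm.
- by move=> q /=; case: eqP.
- by case: eqP => // ne q /=; case: eqP => // _; have := hm p; lia.
- exact/h2/h1.
- by case: ifP => _; [apply: h1|apply: h2].
- have: forall k, bounded N (iter k (den np N c) m) by elim=> //= k; apply: h.
  exact.
Qed.

Section Desugar.
(* Pointers [sb], [sb + 1] and [sb + 2] are scratch. *)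
Variables (ka sb N : nat).
Hypothesis ka_sb : ka.+2 < sb.

Notation np := ka.+2.
Notation den := (den np N).
Notation agree := (agree sb).

(** Computes the matrix address [n.+1 + p * n + q] in [sb] by increments alone. Saturation at [N]
    produces the [minn] of [BAdj]. *)
Definition seek p q :=
  Seq (upto sb np Skip) (Seq (Inc sb)
  (Seq (upto sb.+1 p (upto sb.+2 np (Inc sb))) (upto sb.+2 q (Inc sb)))).

(** The branches are handed down as continuations: a negation exchanges them, and a conjunction uses
    the else branch in both of its tests. *)
Fixpoint lowif b c1 c2 :=
  match b with
  | BA _ _ | BE _ _ => If b c1 c2
  | BN b => lowif b c2 c1
  | BAnd b b' => lowif b (lowif b' c1 c2) c2
  | BAdj p q => Seq (seek p q) (If (BA 0 sb) c1 c2)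
  | BLe p q =>
    Seq (Zero sb) (Seq (Rep (If (BE sb p) Skip (If (BE sb q) Skip (Inc sb))))
      (If (BE sb p) c1 c2))
  end.

Fixpoint low c :=
  match c with
  | Seq c1 c2 => Seq (low c1) (low c2)
  | If b c1 c2 => lowif b (low c1) (low c2)
  | Rep c => Rep (low c)
  | _ => c
  end.

Fixpoint wfb b :=
  match b with
  | BA _ p => p < sb
  | BE p q | BAdj p q | BLe p q => (p < sb) && (q < sb)
  | BN b => wfb b
  | BAnd b b' => wfb b && wfb b'
  end.

Fixpoint wfh c :=
  match c with
  | Skip => true
  | Set_ _ p _ | Zero p | Inc p => p < sb
  | Seq c1 c2 => wfh c1 && wfh c2
  | If b c1 c2 => [&& wfb b, wfh c1 & wfh c2]
  | Rep c => wfh c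
  end.

Lemma agree_trans m1 m2 m3 : agree m1 m2 -> agree m2 m3 -> agree m1 m3.
Proof. by move=> [h1 h2] [h3 h4]; split=> [a i|p hp]; rewrite ?h1 ?h2 ?h3 ?h4. Qed.

Lemma agree_scratch m p x : sb <= p -> agree (set_ptr p x m) m.
Proof. by move=> hp; split=> //= q; case: eqP => //; lia. Qed.

Lemma agree_set_ptr m m' p x : agree m m' -> agree (set_ptr p x m) (set_ptr p x m').
Proof. by move=> [h1 h2]; split=> //= q /h2 ->. Qed.

Lemma agree_bev b m m' : wfb b -> agree m m' -> bev np N b m = bev np N b m'.
Proof.
move=> w [h1 h2]; elim: b w => /= [a p hp|p q /andP[hp hq]|p q /andP[hp hq]|p q /andP[hp hq]|b h /h -> //|b h b' h' /andP[/h -> /h' -> //]].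
all: by rewrite ?h1 !h2.
Qed.

Lemma seek_ok p q m : p < sb -> q < sb -> bounded N m ->
  agree (den (seek p q) m) m /\
  ptr (den (seek p q) m) sb = minn N ((ptr m np).+1 + ptr m p * ptr m np + ptr m q).
Proof.
move=> hp hq bm; set n := ptr m np; have nN : n <= N by apply: bm.
have incP s y : agree s m -> ptr s sb = minn N y ->
    [/\ agree (den (Inc sb) s) m, ptr (den (Inc sb) s) sb = minn N y.+1 &
      forall r, r != sb -> ptr (den (Inc sb) s) r = ptr s r].
  move=> ag e /=; case: eqP => hN; first by split=> //; lia.
  split; last by move=> r /negbTE /= ->.
    by apply: agree_trans ag; apply: agree_scratch; lia.
  by rewrite /= eqxx; lia.
pose m1 := den (upto sb np Skip) m; pose m2 := den (Inc sb) m1.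
pose m3 := den (upto sb.+1 p (upto sb.+2 np (Inc sb))) m2.
have [|||||[a1 e1] e1' _] := @den_upto np N sb np Skip m n (fun k s => agree s m /\ ptr s sb = minn N k) => //.
- by lia.
- by split; [apply: agree_scratch; lia|rewrite /= eqxx; lia].
- move=> k s hk [ag e] er en; split=> //; split.
    by apply: agree_trans ag; apply: agree_scratch; lia.
  by rewrite /= eqxx; lia.
rewrite -/m1 in a1 e1.
have [a2 e2 _] := incP _ _ a1 e1; rewrite -/m2 in a2 e2.
have [|||||[a3 e3] _ _] := @den_upto np N sb.+1 p (upto sb.+2 np (Inc sb)) m2 (ptr m p)
  (fun k s => agree s m /\ ptr s sb = minn N (n.+1 + k * n)).
- by lia.
- by case: a2 => _ ->.
- exact: bm.
- split; first by apply: agree_trans a2; apply: agree_scratch; lia.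
  by rewrite /=; case: eqP => [|_]; [lia|rewrite e2; lia].
- move=> k s hk [ag e] er ep.
  have [|||||[b1 [b2 b3]] b4 b5] := @den_upto np N sb.+2 np (Inc sb) s n
    (fun j t => agree t m /\ ptr t sb = minn N (n.+1 + k * n + j) /\ ptr t sb.+1 = k).
  + by lia.
  + by case: ag => _ ->.
  + by [].
  + split; first by apply: agree_trans ag; apply: agree_scratch; lia.
    by rewrite /= er; split; case: eqP => //; try lia; rewrite e addn0.
  + move=> j t hj [c1 [c2 c3]] c4 c5.
    have [d1 d2 d3] := incP _ _ c1 c2.
    split; [by rewrite d3 //; lia|by rewrite d3 //; lia|].
    split; first by apply: agree_trans d1; apply: agree_scratch; lia.
    rewrite !ptr_set addnS d2 d3 ?c3; last by lia.
    by split; case: eqP => //; lia.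
  split; [exact: b3|by case: b1 => _ -> |].
  split; first by apply: agree_trans b1; apply: agree_scratch; lia.
  have -> : n.+1 + k.+1 * n = n.+1 + k * n + n by lia.
  by rewrite -b2 ptr_set; case: eqP => //; lia.
rewrite -/m3 in a3 e3.
have [|||||[a4 e4] _ _] := @den_upto np N sb.+2 q (Inc sb) m3 (ptr m q)
  (fun k s => agree s m /\ ptr s sb = minn N (n.+1 + ptr m p * n + k)).
- by lia.
- by case: a3 => _ ->.
- exact: bm.
- split; first by apply: agree_trans a3; apply: agree_scratch; lia.
  by rewrite /=; case: eqP => [|_]; [lia|rewrite addn0].
- move=> k s hk [ag e] er ep.
  have [d1 d2 d3] := incP _ _ ag e.
  split; [by rewrite d3 //; lia|by rewrite d3 //; lia|].
  split; first by apply: agree_trans d1; apply: agree_scratch; lia.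
  by rewrite addnS -d2 ptr_set; case: eqP => //; lia.
exact: (conj a4 e4).
Qed.

Lemma le_ok p q m (f : cmd) : p < sb -> q < sb -> bounded N m ->
  f = Seq (Zero sb) (Rep (If (BE sb p) Skip (If (BE sb q) Skip (Inc sb)))) ->
  agree (den f m) m /\ ptr (den f m) sb = minn (ptr m p) (ptr m q).
Proof.
move=> hp hq bm -> /=; set g := fun s => _.
have bp := bm p; have bq := bm q.
suff h k : k <= N -> agree (iter k g (set_ptr sb 0 m)) m /\
    ptr (iter k g (set_ptr sb 0 m)) sb = minn k (minn (ptr m p) (ptr m q)).
  by have [//|h1 h2] := h N; split=> //; rewrite h2; lia.
elim: k => [_|k IH kN].
  by split; [apply: agree_scratch; lia|rewrite /= eqxx; lia].
rewrite iterS; move: IH; move: (iter k g _) => s [|[h1 h2] e]; first lia.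
have ag : agree s m by [].
rewrite /g e !h2 //; case: eqP => [ep|np]; first by split=> //; lia.
case: eqP => [eq|nq]; first by split=> //; lia.
case: eqP => [|_]; first lia.
split; first by apply: agree_trans ag; apply: agree_scratch; lia.
by rewrite /= eqxx; lia.
Qed.

(** The branches are compared with arbitrary functions on stores, because the then branch of the
    outer test of a conjunction is itself a lowered conditional and has to be matched with a
    conditional function. *)
Lemma lowif_ok b c1 c2 (f1 f2 : store -> store) m m' : wfb b ->
  (forall m m', agree m m' -> bounded N m -> bounded N m' -> agree (den c1 m) (f1 m')) ->
  (forall m m', agree m m' -> bounded N m -> bounded N m' -> agree (den c2 m) (f2 m')) ->
  agree m m' -> bounded N m -> bounded N m' ->
  agree (den (lowif b c1 c2) m) (if bev np N b m' then f1 m' else f2 m').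
Proof.
elim: b c1 c2 f1 f2 m m' => [a p|p q|p q|p q|b IH|b IH b' IH'] c1 c2 f1 f2 m m' w h1 h2 ag bm bm'.
- by rewrite -(agree_bev w ag) /=; case: ifP => _; [apply: h1|apply: h2].
- by rewrite -(agree_bev w ag) /=; case: ifP => _; [apply: h1|apply: h2].
- rewrite -(agree_bev w ag); case/andP: w => hp hq.
  have [ag' e] := seek_ok hp hq bm.
  have b' : bounded N (den (seek p q) m) by apply: den_bounded.
  have -> : den (lowif (BAdj p q) c1 c2) m = den (If (BA 0 sb) c1 c2) (den (seek p q) m) by [].
  move: (den (seek p q) m) ag' e b' => s ag' e b'.
  rewrite /= e; case: (ag') => -> _.
  by case: ifP => _; [apply: h1|apply: h2] => //; apply: agree_trans ag.
- rewrite -(agree_bev w ag); case/andP: w => hp hq.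
  have [ag' e] := le_ok hp hq bm erefl.
  set c0 := Seq _ _ in ag' e.
  have b' : bounded N (den c0 m) by apply: den_bounded.
  have -> : den (lowif (BLe p q) c1 c2) m = den (If (BE sb p) c1 c2) (den c0 m) by [].
  move: (den c0 m) ag' e b' => s ag' e b'.
  rewrite /= e; case: (ag') => _ -> //.
  have -> : (minn (ptr m p) (ptr m q) == ptr m p) = (ptr m p <= ptr m q) by lia.
  by case: ifP => _; [apply: h1|apply: h2] => //; apply: agree_trans ag.
- rewrite /=; have := IH c2 c1 f2 f1 m m' w h2 h1 ag bm bm'.
  by case: (bev _ _ _ _).
- case/andP: w => w w' /=.
  have := IH (lowif b' c1 c2) c2 (fun s => if bev np N b' s then f1 s else f2 s) f2 m m' w _ h2 ag bm bm'.
  have h s s' : agree s s' -> bounded N s -> bounded N s' ->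
      agree (den (lowif b' c1 c2) s) (if bev np N b' s' then f1 s' else f2 s').
    exact: IH'.
  by move=> /(_ h); case: (bev _ _ b _) => //=; case: (bev _ _ b' _).
Qed.

Lemma low_ok c m m' : wfh c -> agree m m' -> bounded N m -> bounded N m' ->
  agree (den (low c) m) (den c m').
Proof.
elim: c m m' => [|a p v|p|p|c1 h1 c2 h2|b c1 h1 c2 h2|c h] m m' w ag bm bm'.
- by [].
- by case: ag => ha hp; split=> //= a' i; rewrite hp // ha.
- exact: agree_set_ptr.
- rewrite /=; have hp := ag.2 _ w; rewrite hp; case: eqP => // _; exact: agree_set_ptr.
- case/andP: w => w1 w2 /=; apply: h2 => //; try exact: den_bounded.
  exact: h1.
- case/and3P: w => w w1 w2 /=.
  by apply: lowif_ok => // s s' ags bs bs'; [apply: h1|apply: h2].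
- rewrite /=; move: {1 3}N => k.
  have: [/\ agree (iter k (den (low c)) m) (iter k (den c) m'),
     bounded N (iter k (den (low c)) m) & bounded N (iter k (den c) m')].
    elim: k => [//|k [ag1 b1 b2]] /=.
    by split; [apply: h|apply: den_bounded|apply: den_bounded].
  by case.
Qed.

End Desugar.

(** After this only the number [I] of rounds of [body] matters: everything else is polynomial in the
    input length. *)
Theorem search_machine ka sb lb kt da aa ini body :
  [&& 1 < ka, ka.+2 < sb, sb < lb, lb <= kt, da < ka & aa < ka] ->
  wfh sb ini -> wfh sb body ->
  wfc ka lb kt 0 (low ka sb ini) -> wfc ka lb kt 0 (low ka sb body) ->
  exists M C k, forall w I,
    let N := size w in
    let s i := iter i (den ka.+2 N body) (den ka.+2 N ini (mem0 ka w)) in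
    0 < N -> (forall i, i < I -> arr (s i) da 0 = false) -> arr (s I) da 0 ->
    tm_decides_within M w (I.+1 * (C * N.+1 ^ k)) N (arr (s I) aa 0).
Proof.
move=> /and5P[ka1 ka_sb sb_lb lb_kt /andP[hda haa]] wi wb wci wcb.
set ini' := low ka sb ini in wci; set body' := low ka sb body in wcb.
have [Ci [ki hi]] := cost_poly ini'; have [Cb [kb hb]] := cost_poly body'.
(* The additional power of [N.+1] pays for the [4 * N + 8] steps per instruction, which are at most
   [8 * N.+1]. *)
exists (machine ka kt (main_code ka lb da aa ini' body')), (8 * (Ci + Cb + 5)), (ki + kb).+1.
move=> w I N s N0 hI hD.
pose s' i := iter i (den ka.+2 N body') (den ka.+2 N ini' (mem0 ka w)).
have bm : bounded N (mem0 ka w) by move=> p /=; case: ifP.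
have ag i : [/\ agree sb (s' i) (s i), bounded N (s' i) & bounded N (s i)].
  elim: i => [|i [ag b1 b2]]; rewrite /s /s' /=.
    by split; [apply: low_ok|apply: den_bounded|apply: den_bounded].
  by split; [apply: low_ok|apply: den_bounded|apply: den_bounded].
have as' a i : arr (s' i) a 0 = arr (s i) a 0 by have [[-> _] _ _] := ag i.
have fx : fixed ka N (mem0 ka w).
  by rewrite /fixed /= eqxx; split=> //; case: eqP => //; lia.
have ka_lb : ka.+2 < lb by lia.
have [||k [hk h1 h2 h3]] := @main_ok ka lb kt ka1 ka_lb lb_kt da aa ini' body' (mem0 ka w) N I N0 wci wcb fx.
- by move=> i /hI <-; apply: as'.
- by move: hD; rewrite -as'.
have wf := main_wf ka1 ka_lb lb_kt hda haa wci wcb.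
have [||||t' [ht' h']] := @machine_correct ka kt _ ka1 _ N w k (arr (s I) aa 0) N0 erefl wf.
- by lia.
- by move=> i /h1 [-> h]; split=> //; case: (instr_at _ _) h.
- by [].
- by rewrite h3; congr IHalt; apply: as'.
exists t'; split=> //; apply: leq_trans ht' _.
have hX : 0 < N.+1 ^ ki by rewrite expn_gt0.
have hY : 0 < N.+1 ^ kb by rewrite expn_gt0.
have := hi N; have := hb N; rewrite expnS expnD.
move: (N.+1 ^ ki) (N.+1 ^ kb) hX hY => X Y hX hY hb' hi'.
have hi2 : cost N ini' <= Ci * (X * Y).
  by apply: leq_trans hi' _; rewrite leq_mul2l leq_pmulr ?orbT.
have hb2 : cost N body' <= Cb * (X * Y).
  by apply: leq_trans hb' _; rewrite leq_mul2l leq_pmull ?orbT.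
have hZ : 0 < X * Y by rewrite muln_gt0 hX.
move: (X * Y) hi2 hb2 hZ => Z hi2 hb2 hZ.
have k1 : k <= I.+1 * ((Ci + Cb + 4) * Z).
  apply: leq_trans hk _.
  apply: (@leq_trans (I.+1 * (Ci * Z + Cb * Z + 4))); first by nia.
  by rewrite leq_mul2l /=; nia.
apply: (@leq_trans (k * (8 * N.+1) + N.+1)); first by nia.
apply: (@leq_trans (I.+1 * ((Ci + Cb + 4) * Z) * (8 * N.+1) + I.+1 * Z * (8 * N.+1))).
  by rewrite leq_add // ?leq_mul2r ?k1 ?orbT //; nia.
by rewrite -mulnDl -mulnDr; nia.
Qed.

(** * The search program *)

(* Tracks below 20 hold arrays, [f...] being flags stored in cell 0; pointers
   start at 20, scratch pointers at 30 and loop counters at 40.  [aNCH] holds the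
   negated choices ([false] puts the vertex into the set), so that the blank
   track encodes the first leaf. *)
Notation aIN := 0 (only parsing).
Notation aT := 2 (only parsing).
Notation aF := 3 (only parsing).
Notation aU := 4 (only parsing).
Notation aW := 5 (only parsing).
Notation aS := 6 (only parsing).
Notation aQ := 7 (only parsing).
Notation aD := 8 (only parsing).
Notation aB := 9 (only parsing).
Notation aNCH := 10 (only parsing).
Notation fROOT := 11 (only parsing).
Notation fPH := 12 (only parsing).
Notation fFAIL := 13 (only parsing).
Notation fFIN := 14 (only parsing).
Notation fDONE := 15 (only parsing).
Notation fACC := 16 (only parsing).
Notation pO := 20 (only parsing).
Notation pN := 22 (only parsing).
Notation pCUR := 23 (only parsing).
Notation pD := 24 (only parsing).
Notation pV := 25 (only parsing).
Notation pX := 26 (only parsing).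
Notation pY := 27 (only parsing).

Notation "c ;; d" := (Seq c d) (at level 60, right associativity).

(** A failed search leaves [v] at [n], so the test [BE v pN] that follows asks whether nothing was
    found. *)
Definition Find v b := Zero v ;; Rep (If (BE v pN) Skip (If b Skip (Inc v))).
Definition Count x a := Zero x ;; upto pV pN (If (BA a pV) (Inc x) Skip).
Definition Copy y x := upto y x Skip.
Definition Flag f v := Set_ f pO v.

Definition Take v := Set_ aS v true ;; Set_ aQ v true.
Definition AddB := Set_ aB pV true ;; Set_ aQ pV true.
Definition Drop := Set_ aQ pCUR false ;; Copy pCUR pN.

(** A terminal becomes the root without any choice. If there are no terminals, the undecided
    vertices are offered as roots one after the other. *)
Definition RootStep :=
  Find pV (BA aW pV) ;;
  If (BE pV pN)
    (Find pV (BA aU pV) ;;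
     If (BE pV pN) (Flag fFAIL true)
       (Set_ aU pV false ;;
        If (BA aNCH pD) Skip (Take pV ;; Flag fROOT true) ;; Inc pD))
    (Set_ aW pV false ;; Take pV ;; Flag fROOT true).

(** An empty queue ends a phase. The second set starts from a vertex of the other terminal set or,
    if that set is empty, from any vertex outside the first set, because an empty set does not count
    as connected. *)
Definition PopStep :=
  Find pCUR (BA aQ pCUR) ;;
  If (BE pCUR pN)
    (If (BA fPH pO)
       (Find pV (BAnd (BA aF pV) (BN (BA aB pV))) ;;
        If (BE pV pN) (Flag fFIN true) (Flag fFAIL true))
       (Find pV (BA aW pV) ;;
        If (BE pV pN)
          (Find pV (BA aF pV) ;;
           If (BE pV pN) (Find pV (BN (BA aS pV))) Skip ;;
           If (BE pV pN) (Flag fFAIL true) (AddB ;; Flag fPH true))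
          (Flag fFAIL true)))
    Skip.

(** A terminal neighbour needs no choice, since it belongs to the set anyway. Every child pays the
    debt of the current vertex, but only a nonterminal child incurs a debt of its own. *)
Definition GrowStep :=
  Find pV (BAnd (BA aW pV) (BAdj pCUR pV)) ;;
  If (BE pV pN)
    (Find pV (BAnd (BA aU pV) (BAdj pCUR pV)) ;;
     If (BE pV pN)
       (If (BA aD pCUR) (Flag fFAIL true) Drop)
       (Set_ aU pV false ;;
        If (BA aNCH pD) Skip
          (Take pV ;; Set_ aD pCUR false ;; Set_ aD pV true) ;; Inc pD))
    (Set_ aW pV false ;; Take pV ;; Set_ aD pCUR false) ;;
  Count pX aD ;; Count pY aW ;; If (BLe pX pY) Skip (Flag fFAIL true).

Definition OtherStep :=
  Find pV (BAnd (BAnd (BN (BA aS pV)) (BN (BA aB pV))) (BAdj pCUR pV)) ;;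
  If (BE pV pN) Drop AddB.

Definition MicroStep :=
  If (BA fFAIL pO) Skip (If (BA fFIN pO) Skip
  (If (BA fROOT pO)
    (If (BE pCUR pN) PopStep (If (BA fPH pO) OtherStep GrowStep))
    RootStep)).

Definition Reinit :=
  upto pV pN
    (Set_ aS pV false ;; Set_ aQ pV false ;; Set_ aD pV false ;; Set_ aB pV false ;;
     If (BA aT pV) (Set_ aW pV true) (Set_ aW pV false) ;;
     If (BA aT pV) (Set_ aU pV false)
       (If (BA aF pV) (Set_ aU pV false) (Set_ aU pV true))) ;;
  Flag fROOT false ;; Flag fPH false ;; Flag fFAIL false ;; Flag fFIN false ;;
  Copy pCUR pN ;; Zero pD.

(** The last of the [pD] choices used that is still [false] becomes [true], and the later ones are
    reset. If all are [true], [pX] stays at [pD] and the enumeration is over. *)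
Definition Next :=
  Copy pX pD ;; upto pV pD (If (BA aNCH pV) Skip (Copy pX pV)) ;;
  If (BE pX pD) (Flag fDONE true)
    (Set_ aNCH pX true ;;
     upto pV pD (If (BLe pV pX) Skip (Set_ aNCH pV false))).

Definition Body :=
  Reinit ;; Rep MicroStep ;;
  If (BA fFIN pO) (Flag fDONE true ;; Flag fACC true) Next.

Definition Swap :=
  upto pV pN (If (BA aT pV)
    (Set_ aT pV false ;; Set_ aF pV true)
    (If (BA aF pV) (Set_ aT pV true ;; Set_ aF pV false) Skip)).

(* [pX] walks over the two rows of the input that encode the terminal sets. *)
Definition Init :=
  (Zero pN ;; Rep (If (BA aIN pN) (Inc pN) Skip)) ;;
  Copy pX pN ;; Inc pX ;; upto pY pN (upto pV pN (Inc pX)) ;;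
  upto pV pN (If (BA aIN pX) (Set_ aT pV true) Skip ;; Inc pX) ;;
  upto pV pN (If (BA aIN pX) (Set_ aF pV true) Skip ;; Inc pX) ;;
  Count pX aT ;; Count pY aF ;; If (BLe pX pY) Skip Swap.

Lemma progs_wf : [/\ wfh 30 Init, wfh 30 Body,
  wfc 20 40 50 0 (low 20 30 Init) & wfc 20 40 50 0 (low 20 30 Body)].
Proof. by split; vm_compute. Qed.

(** * Denotations of the basic loops *)

Section Den.
Variables (n N : nat).
Hypothesis nN : n < N.

Notation den := (den pN N).

Lemma bev_ext b m m' : (forall a i, arr m a i = arr m' a i) ->
  (forall p, ptr m p = ptr m' p) -> bev pN N b m = bev pN N b m'.
Proof.
move=> h1 h2; elim: b => //= [a p|p q|p q|p q|b ->|b -> b' ->] //.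
all: by rewrite ?h1 !h2.
Qed.

(* An optional vertex as the value of a pointer: [n] encodes [None]. *)
Definition oval (o : option 'I_n) : nat := if o is Some v then v else n.

Lemma oval_eq o : (oval o == n) = ~~ o.
Proof. by case: o => [v|] /=; rewrite ?eqxx // ltn_eqF. Qed.

Definition first (P : pred 'I_n) : option 'I_n := ohead (filter P (enum 'I_n)).

Variant first_spec (P : pred 'I_n) : option 'I_n -> Type :=
  | FirstSome v of P v : first_spec P (Some v)
  | FirstNone of (forall v, ~~ P v) : first_spec P None.

Lemma firstP P : first_spec P (first P).
Proof.
rewrite /first; case e: (filter P (enum 'I_n)) => [|v s] /=; constructor.
  move=> v; apply/negP => Pv; have : v \in filter P (enum 'I_n) by rewrite mem_filter Pv mem_enum.
  by rewrite e.
have : v \in filter P (enum 'I_n) by rewrite e mem_head.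
by rewrite mem_filter => /andP[].
Qed.

Lemma oval_first (P : pred 'I_n) (f : nat -> bool) : (forall i : 'I_n, f i = P i) ->
  oval (first P) = find f (iota 0 n).
Proof.
move=> h; rewrite /first -val_enum_ord find_map.
have -> : find (preim val f) (enum 'I_n) = find P (enum 'I_n) by apply: eq_find => i /=; rewrite h.
case e: (filter P (enum 'I_n)) => [|v s] /=.
  have : ~~ has P (enum 'I_n) by rewrite has_filter e.
  by move/hasNfind ->; rewrite size_enum_ord.
have hp : has P (enum 'I_n) by rewrite has_filter e.
have hv : v = nth v (enum 'I_n) (find P (enum 'I_n)).
  have := e; move: hp {e}; elim: (enum 'I_n) => //= x r IH.
  by case: ifP => [_ _ [->]|_] //.
rewrite [in LHS]hv nth_enum_ord //.
by have := hp; rewrite has_find size_enum_ord.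
Qed.

Definition same_but (X : pred nat) (m' m : store) :=
  arr m' = arr m /\ forall p, ~~ X p -> ptr m' p = ptr m p.

Lemma den_Find v b m (P : pred 'I_n) : v != pN -> ptr m pN = n ->
  (forall i : 'I_n, bev pN N b (set_ptr v i m) = P i) ->
  same_but (pred1 v) (den (Find v b) m) m /\ ptr (den (Find v b) m) v = oval (first P).
Proof.
move=> vN en hP; rewrite (oval_first (f := fun i => bev pN N b (set_ptr v i m))) //.
set f := fun i => _; rewrite /=; set g := fun s => _.
suff h k : [/\ arr (iter k g (set_ptr v 0 m)) = arr m,
    forall p, p != v -> ptr (iter k g (set_ptr v 0 m)) p = ptr m p &
    ptr (iter k g (set_ptr v 0 m)) v = minn k (find f (iota 0 n))].
  have [h1 h2 h3] := h N; split; first by split.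
  have := find_size f (iota 0 n); rewrite size_iota h3; lia.
elim: k => [|k].
  by split=> //= [p /negbTE -> //|]; rewrite eqxx min0n.
rewrite iterS; move: (iter k g _) => s [h1 h2 h3].
have le_n := find_size f (iota 0 n); rewrite size_iota in le_n.
rewrite /g h3 h2 1?eq_sym // en; case: eqP => [e|ne]; first by split=> //; lia.
have -> : bev pN N b s = f (minn k (find f (iota 0 n))).
  apply: bev_ext => [a i|p]; first by rewrite h1.
  by rewrite ptr_set; case: eqVneq => [->|ne2] //; exact: h2.
case: (ltnP k (find f (iota 0 n))) => hk; last first.
  have e1 : minn k (find f (iota 0 n)) = find f (iota 0 n) by lia.
  have e2 : minn k.+1 (find f (iota 0 n)) = find f (iota 0 n) by lia.
  rewrite e1 in ne h3 *; rewrite e2.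
  have hh : has f (iota 0 n) by rewrite has_find size_iota; lia.
  by have := nth_find 0 hh; rewrite nth_iota ?add0n => [->|]; [split|lia].
have e1 : minn k (find f (iota 0 n)) = k by lia.
have e2 : minn k.+1 (find f (iota 0 n)) = k.+1 by lia.
rewrite e1 in h3 *; rewrite e2.
have := before_find 0 hk; rewrite nth_iota ?add0n => [->|]; last lia.
case: eqP => [|_]; first lia.
by split=> [//|p ne2|] /=; rewrite ?eqxx ?(negbTE ne2) ?h2.
Qed.

Lemma den_Copy y x m : y != x -> ptr m x <= N ->
  same_but (pred1 y) (den (Copy y x) m) m /\ ptr (den (Copy y x) m) y = ptr m x.
Proof.
move=> yx hx.
have [||h1 h2 _] := den_upto (np := pN) (c := Skip) (Inv := fun _ s => same_but (pred1 y) s m) yx erefl hx.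
- by split=> // p /negbTE /= ->.
- by move=> k s _ [i1 i2] i3 i4; split=> //; split=> // p /[dup] /negbTE /= e /i2; rewrite e.
by [].
Qed.

Lemma den_Count x a m : x != pN -> x != pV -> ptr m pN = n ->
  same_but (pred2 x pV) (den (Count x a) m) m /\
  ptr (den (Count x a) m) x = #|[set v : 'I_n | arr m a v]|.
Proof.
move=> xN xV en.
rewrite (_ : den _ m = den (upto pV pN (If (BA a pV) (Inc x) Skip)) (set_ptr x 0 m)) //.
have [|||||[h1 h2] _ _] := @den_upto pN N pV pN (If (BA a pV) (Inc x) Skip) (set_ptr x 0 m) n
  (fun k s => same_but (pred2 x pV) s m /\ ptr s x = count (arr m a) (iota 0 k)) => //.
- by rewrite /= eq_sym (negbTE xN).
- by lia.
- split; last by rewrite /= (negbTE xV) eqxx.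
  by split=> // p /=; case: eqP => // _; case: eqP.
- move=> k s hk [[i1 i2] i3] i4 i5.
  have hc : count (arr m a) (iota 0 k) <= k by have := count_size (arr m a) (iota 0 k); rewrite size_iota.
  have -> : den (If (BA a pV) (Inc x) Skip) s =
      if arr m a k then set_ptr x (count (arr m a) (iota 0 k)).+1 s else s.
    by rewrite /= i1 i4 i3; case: ifP => // _; case: eqP => //; lia.
  split; [by case: ifP => //= _; rewrite eq_sym (negbTE xV)|by case: ifP => //= _; rewrite eq_sym (negbTE xN)|].
  have -> : count (arr m a) (iota 0 k.+1) = count (arr m a) (iota 0 k) + arr m a k.
    by rewrite -addn1 iotaD count_cat /= addn0.
  split.
    split; first by case: ifP.
    by move=> p /[dup] /i2 e /=; case: eqP => //= ne1; case: eqP => //= ne2 _; case: ifP => //= _; case: eqP.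
  by case: ifP => _ /=; rewrite (negbTE xV) ?eqxx ?i3 ?addn1 ?addn0.
split=> //; rewrite h2 cardE size_filter.
rewrite -val_enum_ord count_map enumT; apply: eq_count => i /=.
by rewrite inE.
Qed.

End Den.

(** * Search states and correctness of the program *)

(* [sU]: undecided vertices; [sW]: terminals not reached yet; [sS]: vertices
   reached from the root; [sQ]: reached vertices still to be processed, with
   [scur] the one being processed; [sD]: reached nonterminals that still owe a
   child; [sB]: the second connected set, grown once [sph] holds. *)
Record sst n := Sst {
  sU : {set 'I_n}; sW : {set 'I_n}; sS : {set 'I_n}; sQ : {set 'I_n};
  sD : {set 'I_n}; sB : {set 'I_n}; scur : option 'I_n;
  sroot : bool; sph : bool; sfail : bool; sfin : bool }.

Section Search.
Variables (n : nat) (adj : rel 'I_n) (T F : {set 'I_n}).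
Implicit Types (s : sst n) (b : bool).

Definition failed s :=
  Sst (sU s) (sW s) (sS s) (sQ s) (sD s) (sB s) (scur s) (sroot s) (sph s) true (sfin s).

Definition finished s :=
  Sst (sU s) (sW s) (sS s) (sQ s) (sD s) (sB s) (scur s) (sroot s) (sph s) (sfail s) true.

Definition dropQ s u :=
  Sst (sU s) (sW s) (sS s) (sQ s :\ u) (sD s) (sB s) None (sroot s) (sph s) (sfail s) (sfin s).

Definition addB s v :=
  Sst (sU s) (sW s) (sS s) (v |: sQ s) (sD s) (v |: sB s) (scur s) (sroot s) true (sfail s) (sfin s).

Definition takeW s v D :=
  Sst (sU s) (sW s :\ v) (v |: sS s) (v |: sQ s) D (sB s) (scur s) true (sph s) (sfail s) (sfin s).

Definition takeU s v D :=
  Sst (sU s :\ v) (sW s) (v |: sS s) (v |: sQ s) D (sB s) (scur s) true (sph s) (sfail s) (sfin s).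

Definition dropU s v :=
  Sst (sU s :\ v) (sW s) (sS s) (sQ s) (sD s) (sB s) (scur s) (sroot s) (sph s) (sfail s) (sfin s).

Definition setcur s u :=
  Sst (sU s) (sW s) (sS s) (sQ s) (sD s) (sB s) (Some u) (sroot s) (sph s) (sfail s) (sfin s).

Definition rootstep s b :=
  if first (mem (sW s)) is Some v then takeW s v (sD s)
  else if first (mem (sU s)) is Some v then if b then takeU s v (sD s) else dropU s v
  else failed s.

Definition popstep s :=
  if first (mem (sQ s)) is Some u then setcur s u
  else if sph s then
    if first (mem (F :\: sB s)) then failed s else finished s
  else if first (mem (sW s)) then failed s
  else if (if first (mem F) is Some v then Some v else first (mem (~: sS s)))
    is Some v then addB s v else failed s.

Definition check s := if #|sD s| <= #|sW s| then s else failed s.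

Definition first_nbr (A : {set 'I_n}) u := first [pred v | (v \in A) && adj u v].

Definition growstep s u b :=
  check (if first_nbr (sW s) u is Some v then takeW s v (sD s :\ u)
  else if first_nbr (sU s) u is Some v then
    if b then takeU s v (v |: (sD s :\ u)) else dropU s v
  else if u \in sD s then failed s else dropQ s u).

Definition otherstep s u :=
  if first_nbr (~: (sS s :|: sB s)) u is Some v then addB s v else dropQ s u.

Definition search_step s b :=
  if sfail s || sfin s then s
  else if sroot s then
    if scur s is Some u then if sph s then otherstep s u else growstep s u b
    else popstep s
  else rootstep s b.

(** The states whose successor may depend on the choice bit. Exactly in these states the program
    advances [pD]. *)
Definition is_decision s :=
  [&& ~~ sfail s, ~~ sfin s &
  if sroot s then
    if scur s is Some u then [&& ~~ sph s, ~~ first_nbr (sW s) u & first_nbr (sU s) u] else false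
  else ~~ first (mem (sW s)) && first (mem (sU s))].

Definition start :=
  Sst (~: (T :|: F)) T set0 set0 set0 set0 None false false false false.

(** * The program refines the abstract search step *)

Section Refine.
Variable N : nat.
Hypothesis nN : n < N.

Notation den := (den pN N).

Lemma den_if (b : bexp) c d m : den (If b c d) m = if bev pN N b m then den c m else den d m.
Proof. by []. Qed.

Lemma den_seq c d m : den (c ;; d) m = den d (den c m).
Proof. by []. Qed.

Record rel_env (m : store) : Prop := RelEnv {
  eO : ptr m pO = 0; eN : ptr m pN = n;
  eF : forall v : 'I_n, arr m aF v = (v \in F);
  eAdj : forall u v : 'I_n, arr m aIN (minn N (n.+1 + u * n + v)) = adj u v }.

Record rel_st (m : store) s : Prop := RelSt {
  rU : forall v : 'I_n, arr m aU v = (v \in sU s);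
  rW : forall v : 'I_n, arr m aW v = (v \in sW s);
  rS : forall v : 'I_n, arr m aS v = (v \in sS s);
  rQ : forall v : 'I_n, arr m aQ v = (v \in sQ s);
  rD : forall v : 'I_n, arr m aD v = (v \in sD s);
  rB : forall v : 'I_n, arr m aB v = (v \in sB s);
  rcur : ptr m pCUR = oval (scur s);
  rroot : arr m fROOT 0 = sroot s; rph : arr m fPH 0 = sph s;
  rfail : arr m fFAIL 0 = sfail s; rfin : arr m fFIN 0 = sfin s }.

(** What outlives a replay: the input, the terminal sets, the choices and the flags of the outer
    loop. *)
Record keep (m' m : store) : Prop := Keep {
  k0 : arr m' aIN = arr m aIN; k2 : arr m' aT = arr m aT; k3 : arr m' aF = arr m aF;
  k10 : arr m' aNCH = arr m aNCH; k15 : arr m' fDONE = arr m fDONE;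
  k16 : arr m' fACC = arr m fACC;
  kO : ptr m' pO = ptr m pO; kN : ptr m' pN = ptr m pN }.

Lemma keep_trans m1 m2 m3 : keep m1 m2 -> keep m2 m3 -> keep m1 m3.
Proof. by case=> ? ? ? ? ? ? ? ? [*]; split; congruence. Qed.

Lemma env_keep m m' : keep m' m -> rel_env m -> rel_env m'.
Proof. by case=> h0 _ h3 _ _ _ hO hN [*]; split=> *; rewrite ?h0 ?h3 ?hO ?hN. Qed.

Definition temps : pred nat := mem [:: pV; pX; pY].

Lemma rel_same (X : pred nat) m m' s : subpred X temps -> same_but X m' m ->
  rel_st m s -> [/\ rel_st m' s, keep m' m & ptr m' pD = ptr m pD].
Proof.
move=> hX [h1 h2] [*]; have hX' p : p \notin temps -> ~~ X p by apply: contra; apply: hX.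
by split; rewrite ?h2 ?hX' //; split; rewrite ?h1 ?h2 ?hX'.
Qed.

Lemma env_same (X : pred nat) m m' : subpred X temps -> same_but X m' m ->
  rel_env m -> rel_env m'.
Proof.
move=> hX [h1 h2] [*]; have hX' p : p \notin temps -> ~~ X p by apply: contra; apply: hX.
by split; rewrite ?h1 ?h2 ?hX'.
Qed.

(** [k] counts the choices that were consumed. *)
Definition result m m' s k :=
  [/\ rel_st m' s, keep m' m & ptr m' pD = ptr m pD + k].

Lemma result_trans m m1 m' s k : keep m1 m -> ptr m1 pD = ptr m pD ->
  result m1 m' s k -> result m m' s k.
Proof. by move=> h e [h1 h2 h3]; split=> //; rewrite -?e //; apply: keep_trans h2 h. Qed.

Lemma find_V (b : bexp) m s (P : pred 'I_n) (c : cmd) s' k : rel_env m -> rel_st m s ->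
  (forall i : 'I_n, bev pN N b (set_ptr pV i m) = P i) ->
  (forall m', rel_env m' -> rel_st m' s -> arr m' = arr m -> ptr m' pCUR = ptr m pCUR ->
     ptr m' pD = ptr m pD -> ptr m' pV = oval (first P) -> result m' (den c m') s' k) ->
  result m (den (Find pV b ;; c) m) s' k.
Proof.
move=> he hr hP hc.
have [h1 h2] := den_Find nN (isT : pV != pN) (eN he) hP.
have sX : subpred (pred1 pV) temps by move=> p /eqP ->.
have [h3 h4 h5] := rel_same sX h1 hr.
apply: (@result_trans _ (den (Find pV b) m)) => //.
by apply: hc => //; [exact: (env_same sX h1 he)|case: h1|case: h1 => _ ->].
Qed.

Ltac fin_rel hr hv :=
  split=> [?|?|?|?|?|?|||||] /=;
  rewrite ?hv ?(rU hr) ?(rW hr) ?(rS hr) ?(rQ hr) ?(rD hr) ?(rB hr) ?(rcur hr)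
    ?(rroot hr) ?(rph hr) ?(rfail hr) ?(rfin hr) ?inE -?val_eqE //=;
  try (do ?case: eqP => //=; by rewrite ?orbT ?orbF ?andbT ?andbF).

Lemma den_RootStep m s : rel_env m -> rel_st m s -> ptr m pD < N ->
  ~~ sfail s -> ~~ sfin s -> ~~ sroot s ->
  result m (den RootStep m) (rootstep s (~~ arr m aNCH (ptr m pD))) (is_decision s).
Proof.
move=> he hr hd nf nn nr; rewrite /rootstep /is_decision nf nn (negbTE nr).
apply: (find_V he hr) => [i|m1 he1 hr1 ea ec ed ev]; first by rewrite /= (rW hr).
rewrite den_if [bev _ _ _ _]/= ev (eN he1) oval_eq.
case: firstP ev => [v hv|hW] ev.
  rewrite /= ev (eO he1); split; last by rewrite addn0.
    by fin_rel hr1 ev.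
  by split.
apply: (find_V he1 hr1) => [i|m2 he2 hr2 ea2 ec2 ed2 ev2]; first by rewrite /= (rU hr1).
rewrite den_if [bev _ _ _ _]/= ev2 (eN he2) oval_eq.
have hdN : (ptr m pD == N) = false by apply/eqP; lia.
case: firstP ev2 => [v hv|hU] ev2; last first.
  rewrite /= (eO he2); split; last by rewrite addn0.
    by fin_rel hr2 ev2.
  by split.
rewrite /= ev2 /= ed2 ed ea2 ea; case: (arr m aNCH (ptr m pD)); rewrite /= ed2 ed hdN.
  by split; [fin_rel hr2 ev2|split|rewrite /= ed2 ed addn1].
split; [|by split|by rewrite /= ed2 ed addn1].
by rewrite (eO he2); fin_rel hr2 ev2.
Qed.

Lemma result_comp m m1 m2 s1 s2 k1 k2 :
  result m m1 s1 k1 -> result m1 m2 s2 k2 -> result m m2 s2 (k1 + k2).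
Proof.
move=> [_ h1 e1] [h2 h3 e2]; split=> //; first exact: keep_trans h3 h1.
by rewrite e2 e1 addnA.
Qed.

Lemma den_Drop m s u : rel_env m -> rel_st m s -> scur s = Some u ->
  result m (den Drop m) (dropQ s u) 0.
Proof.
move=> he hr hu; set m1 := set_arr aQ (ptr m pCUR) false m.
have [|[h1 h2] h3] := @den_Copy N pCUR pN m1 isT; first by rewrite /= (eN he); lia.
have -> : den Drop m = den (Copy pCUR pN) m1 by [].
move: (den _ m1) h1 h2 h3 => m2 h1 h2 h3.
split; last by rewrite h2 ?addn0.
  have hc := rcur hr; rewrite hu /= in hc.
  split=> [?|?|?|?|?|?|||||]; rewrite ?h1 ?h3 /= ?(eN he) ?hc
    ?(rU hr) ?(rW hr) ?(rS hr) ?(rQ hr) ?(rD hr) ?(rB hr)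
    ?(rroot hr) ?(rph hr) ?(rfail hr) ?(rfin hr) ?inE -?val_eqE //=.
  by case: eqP.
by split; rewrite ?h1 ?h2.
Qed.

Lemma den_check m s : rel_env m -> rel_st m s ->
  result m (den (Count pX aD ;; Count pY aW ;; If (BLe pX pY) Skip (Flag fFAIL true)) m)
    (check s) 0.
Proof.
move=> he hr; rewrite den_seq.
have [h1 c1] := @den_Count n N nN pX aD m isT isT (eN he).
have sX : subpred (pred2 pX pV) temps by move=> p /orP[] /eqP ->.
have sY : subpred (pred2 pY pV) temps by move=> p /orP[] /eqP ->.
have [hr1 hk1 hd1] := rel_same sX h1 hr; have he1 := env_same sX h1 he.
move: (den _ m) h1 c1 hr1 hk1 hd1 he1 => m1 h1 c1 hr1 hk1 hd1 he1.
rewrite den_seq.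
have [h2 c2] := @den_Count n N nN pY aW m1 isT isT (eN he1).
have [hr2 hk2 hd2] := rel_same sY h2 hr1; have he2 := env_same sY h2 he1.
have eX : ptr (den (Count pY aW) m1) pX = ptr m1 pX by case: h2 => _ ->.
move: (den _ m1) h2 c2 hr2 hk2 hd2 he2 eX => m2 h2 c2 hr2 hk2 hd2 he2 eX.
rewrite den_if [bev _ _ _ _]/= eX c1 c2.
have -> : [set v : 'I_n | arr m aD v] = sD s by apply/setP=> v; rewrite inE (rD hr).
have -> : [set v : 'I_n | arr m1 aW v] = sW s by apply/setP=> v; rewrite inE (rW hr1).
have hk := keep_trans hk2 hk1; rewrite /check; case: ifP => _.
  by split=> //; rewrite addn0 -hd1 -hd2.
rewrite /= (eO he2); split.
- by fin_rel hr2 c2.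
- by case: hk => *; split.
- by rewrite /= addn0 -hd1 -hd2.
Qed.

Lemma nbrE (A : {set 'I_n}) u : first_nbr A u = first [pred v | (v \in A) && adj u v].
Proof. by []. Qed.

Lemma den_OtherStep m s u : rel_env m -> rel_st m s -> scur s = Some u -> sph s ->
  result m (den OtherStep m) (otherstep s u) 0.
Proof.
move=> he hr hu hph; have hc := rcur hr; rewrite hu /= in hc.
apply: (find_V he hr (P := [pred v | (v \in ~: (sS s :|: sB s)) && adj u v]))
    => [i|m1 he1 hr1 ea ec ed ev].
  by rewrite /= (eN he) hc (eAdj he) (rS hr) (rB hr) !inE negb_or.
rewrite den_if [bev _ _ _ _]/= ev (eN he1) oval_eq /otherstep nbrE.
case: firstP ev => [v hv|hW] ev; last exact: den_Drop.
by rewrite /= ev; split; [fin_rel hr1 ev|split|rewrite addn0].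
Qed.

Lemma den_GrowStep m s u : rel_env m -> rel_st m s -> ptr m pD < N -> scur s = Some u ->
  ~~ sfail s -> ~~ sfin s -> sroot s -> ~~ sph s ->
  result m (den GrowStep m) (growstep s u (~~ arr m aNCH (ptr m pD))) (is_decision s).
Proof.
move=> he hr hd hu nf nn nr nph; have hc := rcur hr; rewrite hu /= in hc.
have -> : is_decision s = ~~ first_nbr (sW s) u && first_nbr (sU s) u by rewrite /is_decision nf nn nr hu nph.
rewrite /growstep; set s1 := (X in check X).
set k := nat_of_bool _.
apply: (find_V he hr (P := [pred v | (v \in sW s) && adj u v]))
    => [i|m1 he1 hr1 ea ec ed ev].
  by rewrite /= (eN he) hc (eAdj he) (rW hr).
have hc1 : ptr m1 pCUR = u by rewrite ec.
rewrite den_seq.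
suff h : result m1 (den (If (BE pV pN)
    (Find pV (BAnd (BA aU pV) (BAdj pCUR pV)) ;;
     If (BE pV pN)
       (If (BA aD pCUR) (Flag fFAIL true) Drop)
       (Set_ aU pV false ;;
        If (BA aNCH pD) Skip
          (Take pV ;; Set_ aD pCUR false ;; Set_ aD pV true) ;; Inc pD))
    (Set_ aW pV false ;; Take pV ;; Set_ aD pCUR false)) m1) s1 k.
  rewrite -(addn0 k); apply: result_comp (h) _.
  by case: h => h1 h2 _; apply: den_check => //; apply: env_keep h2 he1.
rewrite den_if [bev _ _ _ _]/= ev (eN he1) oval_eq /s1 /k -nbrE.
rewrite -nbrE in ev; rewrite /first_nbr in ev *.
case: firstP ev => [v hv|hW] ev.
  by rewrite /= ev /= hc1; split; [fin_rel hr1 ev|split|rewrite /= addn0].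
apply: (find_V he1 hr1 (P := [pred v | (v \in sU s) && adj u v]))
    => [i|m2 he2 hr2 ea2 ec2 ed2 ev2].
  by rewrite /= (eN he1) hc1 (eAdj he1) (rU hr1).
have hc2 : ptr m2 pCUR = u by rewrite ec2.
rewrite den_if [bev _ _ _ _]/= ev2 (eN he2) oval_eq.
case: firstP ev2 => [v hv|hU] ev2; last first.
  rewrite den_if [bev _ _ _ _]/= hc2 (rD hr2); case: ifP => _; last exact: den_Drop.
  by rewrite /= (eO he2); split; [fin_rel hr2 ev2|split|rewrite addn0].
have hdN : (ptr m pD == N) = false by apply/eqP; lia.
rewrite /= ev2 /= ed2 ed ea2 ea hc2; case: (arr m aNCH (ptr m pD)); rewrite /= ed2 ed hdN.
  by split; [fin_rel hr2 ev2|split|rewrite /= ed2 ed addn1].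
by split; [fin_rel hr2 ev2|split|rewrite /= ed2 ed addn1].
Qed.

(** This search moves [pCUR], which is part of the represented state, so it falls outside
    [find_V]. *)
Lemma find_cur m s : rel_env m -> rel_st m s -> scur s = None ->
  let m' := den (Find pCUR (BA aQ pCUR)) m in
  if first (mem (sQ s)) is Some u then result m m' (setcur s u) 0 /\ ptr m' pCUR = u
  else result m m' s 0 /\ ptr m' pCUR = n.
Proof.
move=> he hr hc m'.
have [|h1 h2] := @den_Find n N nN pCUR (BA aQ pCUR) m (mem (sQ s)) isT (eN he).
  by move=> i; rewrite /= (rQ hr).
rewrite -/m' in h1 h2; case: h1 => h0 h1.
case: firstP h2 => [u hu|hQ] h2; split=> //; split.
all: try by split; rewrite ?h0 ?h1.
all: try by rewrite h1 // addn0.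
all: by case: hr => *; split; rewrite ?h0 ?h2 ?hc.
Qed.

Lemma den_PopStep m s : rel_env m -> rel_st m s -> scur s = None ->
  ~~ sfail s -> ~~ sfin s -> sroot s ->
  result m (den PopStep m) (popstep s) 0.
Proof.
move=> he hr hc nf nn nr; rewrite /popstep /PopStep den_seq.
have := find_cur he hr hc.
case: firstP => [u hu|hQ] [h ec].
  rewrite den_if [bev _ _ _ _]/= ec; case: h => h1 h2 h3.
  by rewrite (kN h2) (eN he) ltn_eqF.
case: h => h1 h2 h3; have he1 := env_keep h2 he.
apply: result_trans h2 _ _; first by rewrite h3 addn0.
move: (den _ m) ec h1 h3 he1 => m1 ec hr1 _ he1 {he hr}.
rewrite den_if [bev _ _ _ _]/= ec (eN he1) eqxx den_if [bev _ _ _ _]/= (eO he1) (rph hr1).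
case: ifP => hph.
  apply: (find_V he1 hr1 (P := mem (F :\: sB s))) => [i|m2 he2 hr2 ea2 ec2 ed2 ev2].
    by rewrite /= (eF he1) (rB hr1) inE andbC.
  rewrite den_if [bev _ _ _ _]/= ev2 (eN he2) oval_eq.
  case: firstP ev2 => [v hv|hU] ev2; rewrite /= (eO he2); by (split; [fin_rel hr2 ev2|split|rewrite addn0]).
apply: (find_V he1 hr1 (P := mem (sW s))) => [i|m2 he2 hr2 ea2 ec2 ed2 ev2].
  by rewrite /= (rW hr1).
rewrite den_if [bev _ _ _ _]/= ev2 (eN he2) oval_eq.
case: firstP ev2 => [v hv|hU] ev2.
  by rewrite /= (eO he2); split; [fin_rel hr2 ev2|split|rewrite addn0].
apply: (find_V he2 hr2 (P := mem F)) => [i|m3 he3 hr3 ea3 ec3 ed3 ev3].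
  by rewrite /= (eF he2).
have fin m4 o : rel_env m4 -> rel_st m4 s -> ptr m4 pV = oval o ->
  result m4 (den (If (BE pV pN) (Flag fFAIL true) (AddB ;; Flag fPH true)) m4)
    (if o is Some v then addB s v else failed s) 0.
  move=> he4 hr4 ev; rewrite den_if [bev _ _ _ _]/= ev (eN he4) oval_eq.
  by case: o ev => [v|] /= ev; rewrite ?ev (eO he4);
    (split; [fin_rel hr4 ev|split|rewrite addn0]).
rewrite den_seq.
have -> : den (If (BE pV pN) (Find pV (BN (BA aS pV))) Skip) m3 =
  if ptr m3 pV == ptr m3 pN then den (Find pV (BN (BA aS pV))) m3 else m3 by [].
rewrite ev3 (eN he3) oval_eq.
case: firstP ev3 => [v hv|hF] ev3; first exact: (fin _ (Some v)).
apply: (find_V (c := If (BE pV pN) (Flag fFAIL true) (AddB ;; Flag fPH true)) he3 hr3 (P := mem (~: sS s))) => [i|m4 he4 hr4 ea4 ec4 ed4 ev4].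
  by rewrite /= (rS hr3) inE.
exact: (fin _ (first _)).
Qed.

Theorem den_MicroStep m s : rel_env m -> rel_st m s -> ptr m pD < N ->
  result m (den MicroStep m) (search_step s (~~ arr m aNCH (ptr m pD))) (is_decision s).
Proof.
move=> he hr hd; rewrite /MicroStep !den_if [bev _ _ (BA fFAIL _) _]/= [bev _ _ (BA fFIN _) _]/=
  [bev _ _ (BA fROOT _) _]/= [bev _ _ (BE _ _) _]/= [bev _ _ (BA fPH _) _]/=.
rewrite (eO he) (rfail hr) (rfin hr) (rroot hr) (rph hr) (rcur hr) (eN he) oval_eq.
have idle : is_decision s = false -> result m m s (is_decision s) by move=> ->; split; rewrite ?addn0.
rewrite /search_step; case: (boolP (sfail s)) => nf /=; first by apply: idle; rewrite /is_decision nf.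
case: (boolP (sfin s)) => nn /=; first by apply: idle; rewrite /is_decision nn andbF.
case: (boolP (sroot s)) => nr; last exact: den_RootStep.
case hu: (scur s) => [u|] /=; last first.
  have -> : is_decision s = false by rewrite /is_decision nr hu !andbF.
  exact: den_PopStep.
case: (boolP (sph s)) => hph; last exact: den_GrowStep.
have -> : is_decision s = false by rewrite /is_decision nr hu hph !andbF.
exact: den_OtherStep.
Qed.

End Refine.
End Search.

(** * Enumeration of the leaves *)

(* A running state holds the negated choices that lead to the current leaf. *)
Inductive odometer := Running of nat -> bool | Done of bool.

(* The leaf after the last one below the node reached by the first [d] choices. *)
Fixpoint onext (f : nat -> bool) d :=
  if d is d'.+1 then
    if f d' then onext f d' else Running (fun j => if j < d' then f j else j == d')
  else Done false.

Section Odometer.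
Variables (X : Type) (stp : X -> bool -> X) (isdec acc : X -> bool).
Hypothesis nondec : forall x b, ~~ isdec x -> stp x b = stp x true.

Fixpoint run k x d (f : nat -> bool) :=
  if k is k'.+1 then run k' (stp x (~~ f d)) (d + isdec x) f else (x, d).

Lemma run_ext k x d f g : f =1 g -> run k x d f = run k x d g.
Proof. by move=> e; elim: k x d => //= k IH x d; rewrite e IH. Qed.

Fixpoint tree_leaves k x :=
  if k is k'.+1 then
    tree_leaves k' (stp x true) + (if isdec x then tree_leaves k' (stp x false) else 0)
  else 1.

Fixpoint hasacc k x :=
  if k is k'.+1 then
    hasacc k' (stp x true) || isdec x && hasacc k' (stp x false)
  else acc x.

Variables (K : nat) (x0 : X) (R : nat -> odometer -> Prop).
Hypothesis R_ext : forall I f g, f =1 g -> R I (Running f) -> R I (Running g).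
Hypothesis R_step : forall I f, R I (Running f) ->
  (forall j, (run K x0 0 f).2 <= j -> f j = false) ->
  R I.+1 (if acc (run K x0 0 f).1 then Done true else onext f (run K x0 0 f).2).

Lemma onext_ext I f g d : (forall j, j < d -> f j = g j) -> R I (onext f d) -> R I (onext g d).
Proof.
elim: d => //= d IH h; rewrite -h //; case: ifP => _; first by apply: IH => j hj; apply: h; lia.
by apply: R_ext => j; case: ltnP => // hj; apply: h; lia.
Qed.

(** A subtree is entered at its leftmost leaf, whose choices from [d] on are all [false], and it is
    left for [onext f d]. At a decision, leaving the first subtree flips choice [d] and thus enters
    the second one at its leftmost leaf; leaving the second one carries over to smaller depths,
    since choice [d] is now [true]. The hypothesis on [run] says that the first [d] choices of [f]
    lead to the node [x]. *)
Lemma enumerate_below k x d f I : (forall j, d <= j -> f j = false) ->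
  (forall g, (forall j, j < d -> g j = f j) -> run K x0 0 g = run k x d g) ->
  R I (Running f) ->
  exists J, [/\ J <= tree_leaves k x, forall i, i < J -> exists g, R (I + i) (Running g) &
    R (I + J) (if hasacc k x then Done true else onext f d)].
Proof.
elim: k x d f I => [|k IH] x d f I hf hr hR.
  have e := hr f (fun _ _ => erefl).
  exists 1; split=> // [i|]; first by rewrite ltnS leqn0 => /eqP ->; exists f; rewrite addn0.
  by have := R_step hR; rewrite e addn1; apply.
rewrite /=; case: (boolP (isdec x)) => hx /=; last first.
  rewrite orbF addn0; apply: IH => // g /hr ->.
  by rewrite /= (negbTE hx) addn0 nondec.
have fd : f d = false by apply: hf.
have [j hj|g hg|J1 [l1 r1 h1]] := IH (stp x true) d.+1 f I _ _ hR.
- by apply: hf; lia.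
- rewrite hr; last by move=> j hj; apply: hg; lia.
  by rewrite /= hx hg // fd addn1.
case: (hasacc _ (stp x true)) h1 => h1.
  by exists J1; split=> //; lia.
rewrite /= fd in h1; set f' := fun j => _ in h1.
have [j hj|g hg|J2 [l2 r2 h2]] := IH (stp x false) d.+1 f' (I + J1) _ _ h1.
- by rewrite /f' ltnNge; have -> : d <= j; [lia|apply/eqP; lia].
- rewrite hr; last by move=> j hj; rewrite hg /f' ?hj //; lia.
  by rewrite /= hx hg // /f' ltnn eqxx addn1.
exists (J1 + J2); split; first by lia.
  move=> i hi; case: (ltnP i J1) => [/r1 //|hi'].
  by have [|g hg] := r2 (i - J1); [lia|exists g; rewrite -addnA subnKC in hg].
rewrite addnA; case: (hasacc _ _) h2 => //=; rewrite /f' ltnn eqxx.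
by apply: onext_ext => j ->.
Qed.

Theorem enumerate : R 0 (Running (fun _ => false)) ->
  exists I, [/\ I <= tree_leaves K x0, forall i, i < I -> exists g, R i (Running g) &
    R I (Done (hasacc K x0))].
Proof.
move=> h0; have [//|//|I [h1 h2 h3]] := @enumerate_below K x0 0 _ 0 _ _ h0.
by exists I; split=> //; move: h3; rewrite add0n; case: (hasacc _ _).
Qed.

End Odometer.

Lemma stp_nondec n (adj : rel 'I_n) F s b : ~~ is_decision adj s -> search_step adj F s b = search_step adj F s true.
Proof.
rewrite /is_decision /search_step; case: (sfail s) => //=; case: (sfin s) => //=; case: (sroot s).
  case: (scur s) => // u; case: (sph s) => //=; rewrite /growstep.
  by case: (first_nbr _ (sW s) u) => //=; case: (first_nbr _ (sU s) u).
by rewrite /rootstep; case: (first (mem (sW s))) => //=; case: (first (mem (sU s))).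
Qed.

(** * One leaf per round of the main loop *)

Section Body.
Variables (n : nat) (adj : rel 'I_n) (T F : {set 'I_n}) (N : nat).
Hypothesis nN : n < N.

Notation den := (den pN N).
Notation rel_env := (rel_env adj F N).
Notation stp := (search_step adj F).
Notation isdec := (is_decision adj).
Notation run := (run stp isdec).

Definition rel_inp (m : store) := rel_env m /\ forall v : 'I_n, arr m aT v = (v \in T).

Definition rel_odo (m : store) o :=
  match o with
  | Running f => [/\ arr m fDONE 0 = false, arr m fACC 0 = false & arr m aNCH =1 f]
  | Done b => arr m fDONE 0 = true /\ arr m fACC 0 = b
  end.

Lemma den_Reinit m : rel_inp m ->
  [/\ rel_env (den Reinit m), rel_st (den Reinit m) (start T F), keep (den Reinit m) m &
     ptr (den Reinit m) pD = 0].
Proof.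
move=> [he hT]; rewrite /Reinit den_seq.
set c := (X in upto pV pN X).
have [|||[hk hv] _ _] := @den_upto pN N pV pN c m n (fun k s => keep s m /\
  forall v : 'I_n, v < k -> [/\ arr s aU v = (v \in ~: (T :|: F)), arr s aW v = (v \in T),
    arr s aS v = false, arr s aQ v = false & arr s aD v = false /\ arr s aB v = false]) isT (eN he).
- exact: ltnW.
- by split=> //; split.
- move=> k s hk [[e0 e2 e3 e10 e15 e16 eo en] hv] ek eN'.
  have -> : den c s = (if arr m aT k then set_arr aU k false else
      if arr m aF k then set_arr aU k false else set_arr aU k true)
    ((if arr m aT k then set_arr aW k true else set_arr aW k false)
    (set_arr aB k false (set_arr aD k false (set_arr aQ k false (set_arr aS k false s))))).
    rewrite /= ek e2; case ET: (arr m aT k); rewrite /= ?e2 ?e3 ek ET //.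
    by case: (arr m aF k).
  split.
  + by case: ifP => //= _; case: ifP.
  + by case: ifP => //= _; case: ifP.
  split; first by case: ifP => _; [|case: ifP => _]; split.
  move=> v hvk; case: (ltnP v k) => hvk'.
    have ne : (nat_of_ord v == k) = false by apply/eqP; lia.
    have [h1 h2 h3 h4 [h5 h6]] := hv v hvk'.
    by case: ifP => _; [|case: ifP => _]; rewrite /= ne.
  have ev : k = v by lia.
  by rewrite ev hT (eF he) !inE; case: ifP => _; [|case: ifP => _]; rewrite /= !eqxx.
move: (den _ m) hk hv => m1 hk hv.
have he1 := env_keep hk he.
pose o := ptr m1 pO; pose m2 := set_arr fFIN o false (set_arr fFAIL o false
  (set_arr fPH o false (set_arr fROOT o false m1))).
rewrite -[X in [/\ rel_env X, _, _ & _]]/(set_ptr pD 0 (den (Copy pCUR pN) m2)).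
rewrite -[X in [/\ _, rel_st X _, _ & _]]/(set_ptr pD 0 (den (Copy pCUR pN) m2)).
rewrite -[X in [/\ _, _, keep X _ & _]]/(set_ptr pD 0 (den (Copy pCUR pN) m2)).
rewrite -[X in [/\ _, _, _ & ptr X _ = _]]/(set_ptr pD 0 (den (Copy pCUR pN) m2)).
have [|[h1 h2] h3] := @den_Copy N pCUR pN m2 isT; first by rewrite /= (eN he1); lia.
have eo : o = 0 by rewrite /o (eO he1).
move: (den _ m2) h1 h2 h3 => m3 h1 h2 h3.
have hk3 : keep (set_ptr pD 0 m3) m.
  by case: hk => *; split; rewrite /= ?h1 ?h2.
split=> //; first exact: env_keep hk3 he.
have hv' v := hv v (ltn_ord v).
split=> [v|v|v|v|v|v|||||] /=; rewrite ?h1 /= ?eo ?inE //; try by case: (hv' v) => // ? ? ? ? [].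
  by case: (hv' v) => ->; rewrite !inE.
by rewrite h3 /= (eN he1).
Qed.

Lemma den_iter_Micro k m s : rel_env m -> rel_st m s -> ptr m pD + k <= N ->
  let m' := iter k (den MicroStep) m in
  [/\ rel_env m', rel_st m' (run k s (ptr m pD) (arr m aNCH)).1, keep m' m &
    ptr m' pD = (run k s (ptr m pD) (arr m aNCH)).2 /\ ptr m' pD <= ptr m pD + k].
Proof.
elim: k m s => [|k IH] m s he hr hk; first by split=> //; split=> //; rewrite addn0.
have [|h1 h2 h3] := den_MicroStep nN he hr; first by lia.
rewrite iterSr [run _ _ _ _]/=; have he1 := env_keep h2 he.
have b1 : isdec s <= 1 by case: (isdec s).
have [|r1 r2 r3 [r4 r5]] := IH _ _ he1 h1; first by rewrite h3; lia.
move: r2 r4 r5; rewrite h3 (k10 h2) => r2 r4 r5.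
by split=> //; [apply: keep_trans r3 h2|split=> //; lia].
Qed.

(** The position that [onext] flips, or [d] if there is none; this is the value that [Next] leaves
    in [pX]. *)
Definition lastf (f : nat -> bool) d := fix lastf k :=
  if k is k'.+1 then if f k' then lastf k' else k' else d.

Lemma onextE f d k : k <= d -> onext f k = if lastf f d k == d then Done false
  else Running (fun j => if j < lastf f d k then f j else j == lastf f d k).
Proof.
elim: k => [|k IH] hk /=; first by rewrite eqxx.
case: (f k); first by apply: IH; lia.
by case: eqP => //; lia.
Qed.

Lemma lastf_le f d k : k <= d -> lastf f d k <= d.
Proof. by elim: k => //= k IH hk; case: (f k); [apply: IH|]; lia. Qed.

Lemma den_Next m d f : ptr m pO = 0 -> ptr m pD = d -> d <= N ->
  rel_odo m (Running f) -> (forall j, d <= j -> f j = false) ->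
  [/\ rel_odo (den Next m) (onext f d), ptr (den Next m) pO = 0,
     ptr (den Next m) pN = ptr m pN &
     forall a i, a < 4 -> arr (den Next m) a i = arr m a i].
Proof.
move=> eo ed dN [hD hA hf] hz; rewrite /Next den_seq.
have dN' : ptr m pD <= N by rewrite ed.
have [[h1 h2] h3] := @den_Copy N pX pD m isT dN'.
move: (den _ m) h1 h2 h3 => m1 h1 h2 h3; rewrite ed in h3.
have [||||[hk hv] _ hd2] := @den_upto pN N pV pD (If (BA aNCH pV) Skip (Copy pX pV)) m1 d
  (fun k s => same_but (mem [:: pX; pV]) s m /\ ptr s pX = lastf f d k) isT.
- by rewrite h2.
- by [].
- split; last by [].
  by split=> // p; rewrite !inE negb_or => /andP[n1 n2] /=; rewrite (negbTE n2) h2.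
- move=> k s hk [[e1 e2] e3] ek ed'; rewrite den_if [bev _ _ _ _]/= e1 ek hf.
  have [//|[c1 c2] c3] := @den_Copy N pX pV s isT; first by rewrite ek; lia.
  rewrite [den Skip _]/=.
  set s' := if _ then _ else _.
  have hs' : [/\ arr s' = arr s, forall p, p != pX -> ptr s' p = ptr s p & ptr s' pX = lastf f d k.+1].
    by rewrite /s' /=; case: (f k); split; rewrite // c3.
  case: hs' => d1 d2 d3; split; [by rewrite d2|by rewrite d2|split].
    split; first by rewrite /= d1.
    move=> p hp; move: (hp); rewrite !inE negb_or => /andP[n1 n2] /=.
    by rewrite (negbTE n2) d2 ?e2.
  by rewrite /= d3.
rewrite den_seq; move: (den _ m1) hk hv hd2 => m2 [e1 e2] e3 e4.
rewrite den_if [bev _ _ _ _]/= e3 e4 (onextE f (leqnn d)); case: eqP => [_|/eqP ne].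
  have eo2 : ptr m2 pO = 0 by rewrite e2.
  split; [by rewrite /= eo2 e1|by []|by rewrite /= e2|move=> a i ha].
  by rewrite /= e1; case: eqP => // e; lia.
set l := lastf f d d in e3 ne *; have ld : l <= d by apply: lastf_le.
rewrite den_seq [den (Set_ _ _ _) _]/= e3; set m3 := set_arr _ _ _ _.
have [||||[hk hv hj] _ _] := @den_upto pN N pV pD (If (BLe pV pX) Skip (Set_ aNCH pV false)) m3 d
  (fun k s => [/\ forall p, p != pV -> ptr s p = ptr m3 p, forall a i, a != aNCH -> arr s a i = arr m3 a i &
    forall j, arr s aNCH j = if (l < j) && (j < k) then false else arr m3 aNCH j]) isT.
- by rewrite /= e4.
- by [].
- split=> // [p /negbTE /= -> //|j]; by rewrite andbF.
- move=> k s hk [f1 f2 f3] ek edk.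
  have -> : den (If (BLe pV pX) Skip (Set_ aNCH pV false)) s = if k <= l then s else set_arr aNCH k false s.
    by rewrite /= ek f1 // e3.
  split; [by case: ifP|by case: ifP|split].
  + by move=> p np; rewrite /= (negbTE np); case: ifP => _; rewrite /= f1.
  + by move=> a i na; rewrite -f2 //; case: ifP => //= _; rewrite (negbTE na).
  + move=> j; case: (leqP k l) => hkl; rewrite /= f3.
      by have -> : (l < j) && (j < k.+1) = (l < j) && (j < k) by lia.
    by case: eqP => [->|ne1] /=; [rewrite hkl ltnSn|have -> : (j < k.+1) = (j < k) by lia].
split.
- split; rewrite ?hv //= ?e1 //.
  move=> j; rewrite hj /= e1 hf; case: (ltnP l j) => hj1 /=.
    have -> : j < l = false by lia.
    by have -> : (j == l) = false; [lia|case: ltnP => // /hz].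
  by case: eqP => [->|ne1]; [rewrite ltnn|have -> : j < l by lia].
- by rewrite hk // /m3 /= e2.
- by rewrite hk // /m3 /= e2.
- move=> a i ha; rewrite hv /m3 /= ?e1; last by lia.
  by case: eqP => // e; lia.
Qed.

Lemma den_Body m f : rel_inp m -> rel_odo m (Running f) ->
  let r := run N (start T F) 0 f in
  (forall j, r.2 <= j -> f j = false) ->
  rel_inp (den Body m) /\ rel_odo (den Body m) (if sfin r.1 then Done true else onext f r.2).
Proof.
move=> hi [hD hA hf] r hz; rewrite /Body den_seq.
have [he1 hr1 hk1 hd1] := den_Reinit hi.
move: (den _ m) he1 hr1 hk1 hd1 => m1 he1 hr1 hk1 hd1.
have [|he2 hr2 hk2 [hd2 hd2']] := den_iter_Micro (k := N) he1 hr1; first by rewrite hd1.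
rewrite den_seq [den (Rep _) _]/=; move: (iter N _ m1) he2 hr2 hk2 hd2 hd2' => m2 he2 hr2 hk2 hd2 hd2'.
have hk := keep_trans hk2 hk1.
have er : run N (start T F) (ptr m1 pD) (arr m1 aNCH) = r.
  by rewrite hd1 /r (k10 hk1); apply: run_ext.
rewrite er in hr2 hd2.
rewrite den_if [bev _ _ _ _]/= (eO he2) (rfin hr2).
have hi2 : rel_inp m2 by split=> // v; rewrite (k2 hk); case: hi => _ ->.
case: ifP => _.
  rewrite /= (eO he2); split=> //; split; last by case: hi2.
  by case: he2 => *; split.
have ho : rel_odo m2 (Running f) by split; rewrite ?(k15 hk) ?(k16 hk) ?(k10 hk).
have dN : r.2 <= N by rewrite -hd2; move: hd2'; rewrite hd1.
have [h1 h2 h3 h4] := den_Next (eO he2) hd2 dN ho hz.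
split=> //; case: hi2 => -[q1 q2 q3 q4] q5; split; last by move=> v; rewrite h4.
by split=> *; rewrite ?h3 ?h4.
Qed.

Theorem search_enumerate m : rel_inp m -> rel_odo m (Running (fun _ => false)) ->
  exists I, [/\ I <= tree_leaves stp isdec N (start T F),
    forall i, i < I -> arr (iter i (den Body) m) fDONE 0 = false,
    arr (iter I (den Body) m) fDONE 0 = true &
    arr (iter I (den Body) m) fACC 0 = hasacc stp isdec (@sfin n) N (start T F)].
Proof.
move=> hi ho.
pose R i o := rel_inp (iter i (den Body) m) /\ rel_odo (iter i (den Body) m) o.
have [||||I [h1 h2 [_ h3]]] := @enumerate _ stp isdec (@sfin n) _ N (start T F) R.
- by move=> x b; apply: stp_nondec.
- by move=> i f g e [r1 [r2 r3 r4]]; split=> //; split=> // j; rewrite r4.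
- by move=> i f [r1 r2] hz; have := den_Body r1 r2 hz.
- by [].
exists I; case: h3 => h3 h4; split=> //.
by move=> i /h2 [g [_ []]].
Qed.

End Body.

(** * Decoding the input *)

Lemma nth_allpairs (A B C : Type) (f : A -> B -> C) s t x0 y0 z0 i j :
  i < size s -> j < size t ->
  nth z0 [seq f x y | x <- s, y <- t] (i * size t + j) = f (nth x0 s i) (nth y0 t j).
Proof.
elim: s i => //= x s IH [|i] hi hj; rewrite nth_cat size_map.
  by rewrite mul0n add0n hj (nth_map y0).
by rewrite mulSn ltnNge -!addnA leq_addr addKn IH.
Qed.

Section Encode.
Variables (n : nat) (adj : rel 'I_n) (Z1 Z2 : {set 'I_n}).

Notation w := (encode adj Z1 Z2).

Lemma size_encode : size w = n.+1 + n * n + n + n.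
Proof.
rewrite /encode !size_cat size_nseq size_allpairs 2!size_map !size_enum_ord /=; lia.
Qed.

Lemma nth_encode_lt i : i < n -> nth false w i.
Proof. by move=> h; rewrite /encode nth_cat size_nseq h nth_nseq h. Qed.

Lemma nth_encode_n : nth false w n = false.
Proof. by rewrite /encode nth_cat size_nseq ltnn subnn. Qed.

Lemma nth_encode_tail i : nth false w (n.+1 + i) = nth false
  ([seq adj i j | i <- enum 'I_n, j <- enum 'I_n] ++
   [seq i \in Z1 | i <- enum 'I_n] ++ [seq i \in Z2 | i <- enum 'I_n]) i.
Proof.
rewrite /encode nth_cat size_nseq; case: ltnP => [|_]; first by lia.
by rewrite addSn -addnS addKn.
Qed.

Lemma nth_encode_adj (u v : 'I_n) : nth false w (n.+1 + u * n + v) = adj u v.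
Proof.
rewrite -addnA nth_encode_tail nth_cat size_allpairs !size_enum_ord.
have -> : u * n + v < n * n by have := ltn_ord u; have := ltn_ord v; nia.
have := @nth_allpairs _ _ _ adj (enum 'I_n) (enum 'I_n) u v false u v.
by rewrite !size_enum_ord !nth_ord_enum => ->.
Qed.

Lemma nth_encode_Z1 (v : 'I_n) : nth false w (n.+1 + n * n + v) = (v \in Z1).
Proof.
rewrite -addnA nth_encode_tail nth_cat size_allpairs !size_enum_ord ltnNge leq_addr addKn /=.
rewrite nth_cat size_map !size_enum_ord ltn_ord (nth_map v) ?nth_ord_enum //.
by rewrite !size_enum_ord.
Qed.

Lemma nth_encode_Z2 (v : 'I_n) : nth false w (n.+1 + n * n + n + v) = (v \in Z2).
Proof.
rewrite -!addnA nth_encode_tail nth_cat size_allpairs !size_enum_ord ltnNge leq_addr addKn /=.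
rewrite nth_cat size_map !size_enum_ord ltnNge leq_addr addKn /=.
by rewrite (nth_map v) ?nth_ord_enum // !size_enum_ord.
Qed.

End Encode.

(** * Reading and ordering the terminal sets *)

Section InitProgram.
Variables (n N : nat).
Hypothesis nN : n < N.

Notation den := (den pN N).

Definition ReadRow a := upto pV pN (If (BA aIN pX) (Set_ a pV true) Skip ;; Inc pX).

Lemma den_ReadRow a m base : 0 < a -> ptr m pN = n -> ptr m pX = base -> base + n <= N ->
  (forall i, arr m a i = false) ->
  [/\ forall a' i, a' != a -> arr (den (ReadRow a) m) a' i = arr m a' i,
    forall v, v < n -> arr (den (ReadRow a) m) a v = arr m aIN (base + v),
    ptr (den (ReadRow a) m) pX = base + n &
    forall p, p \notin [:: pV; pX] -> ptr (den (ReadRow a) m) p = ptr m p].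
Proof.
move=> a0 en ex hN ha.
have [|||[h1 h2 h3 h4] _ _] := @den_upto pN N pV pN (If (BA aIN pX) (Set_ a pV true) Skip ;; Inc pX) m n
  (fun k s => [/\ forall a' i, a' != a -> arr s a' i = arr m a' i,
    forall v, arr s a v = (v < k) && arr m aIN (base + v),
    ptr s pX = base + k & forall p, p \notin [:: pV; pX] -> ptr s p = ptr m p]) isT en.
- exact: ltnW.
- split=> //=; first by rewrite addn0.
  by move=> p; rewrite !inE negb_or => /andP[/negbTE -> _].
- move=> k s hk [h1 h2 h3 h4] ek ekn.
  set c := _ ;; _.
  have -> : den c s = set_ptr pX (base + k).+1
      (if arr m aIN (base + k) then set_arr a k true s else s).
    rewrite /= h3 h1; last by case: (a) a0.
    have ne : (base + k == N) = false by apply/eqP; lia.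
    by case: (arr m aIN (base + k)); rewrite /= h3 ?ek ne.
  split; [by case: ifP|by case: ifP|split].
  + by move=> a' i na /=; case: ifP => _ /=; rewrite ?(negbTE na) h1.
  + move=> v; have -> : (v < k.+1) = (v == k) || (v < k) by lia.
    rewrite /=; case: ifP => hb /=; rewrite ?eqxx /= h2; case: (eqVneq v k) => //= ->.
      by rewrite hb.
    by rewrite hb andbF.
  + by rewrite /= addnS.
  + move=> p; rewrite !inE negb_or => /andP[/negbTE p1 /negbTE p2]; rewrite /= p1 p2.
    by case: ifP => _ /=; apply: h4; rewrite !inE p1 p2.
by split=> // v hv; rewrite h2 hv.
Qed.

Lemma den_Swap (T F : {set 'I_n}) m : [disjoint T & F] -> ptr m pN = n ->
  (forall v : 'I_n, arr m aT v = (v \in T)) -> (forall v : 'I_n, arr m aF v = (v \in F)) ->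
  [/\ forall v : 'I_n, arr (den Swap m) aT v = (v \in F),
    forall v : 'I_n, arr (den Swap m) aF v = (v \in T),
    forall a i, a \notin [:: aT; aF] -> arr (den Swap m) a i = arr m a i &
    forall p, p != pV -> ptr (den Swap m) p = ptr m p].
Proof.
move=> dTF en hT hF; rewrite /Swap; set c := (X in upto pV pN X).
have [|||[h1 h2 h3] _ _] := @den_upto pN N pV pN c m n
  (fun k s => [/\ forall v : 'I_n, (arr s aT v = if v < k then v \in F else v \in T) /\
       (arr s aF v = if v < k then v \in T else v \in F),
    forall a i, a \notin [:: aT; aF] -> arr s a i = arr m a i &
    forall p, p != pV -> ptr s p = ptr m p]) isT en.
- exact: ltnW.
- by split=> [v|//|p /negbTE /= -> //]; split; [apply: hT|apply: hF].
- move=> k s hk [h1 h2 h3] ek ekn.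
  have [hkT hkF] := h1 (Ordinal hk).
  rewrite /= ltnn in hkT hkF.
  have -> : den c s = if Ordinal hk \in T then set_arr aF k true (set_arr aT k false s)
     else if Ordinal hk \in F then set_arr aF k false (set_arr aT k true s) else s.
    by rewrite /= ek hkT hkF; case: (Ordinal hk \in T) => //=; case: (Ordinal hk \in F).
  split; [by case: ifP => // _; case: ifP|by case: ifP => // _; case: ifP|split].
  + move=> v; have [hv1 hv2] := h1 v.
    have -> : (v < k.+1) = (v == Ordinal hk) || (v < k) by rewrite -val_eqE /=; lia.
    case: (eqVneq v (Ordinal hk)) => [->|ne] /=.
      case: (boolP (Ordinal hk \in T)) => hT' /=; rewrite ?eqxx /=.
        by have := disjointFr dTF hT' => ->.
      by case: (boolP (Ordinal hk \in F)) => hF' /=; rewrite ?eqxx //= hkT hkF (negbTE hT') (negbTE hF').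
    have ne' : (nat_of_ord v == k) = false by apply/negbTE; move: ne; rewrite -val_eqE.
    by case: ifP => _; [|case: ifP => _]; rewrite /= ?ne' /= ?hv1 ?hv2.
  + move=> a i; rewrite !inE negb_or => /andP[/negbTE n1 /negbTE n2].
    by case: ifP => _; [|case: ifP => _]; rewrite /= ?n1 ?n2 /= h2 // !inE n1 n2.
  + by move=> p np; rewrite /= (negbTE np); case: ifP => _; [|case: ifP => _]; apply: h3.
split=> // v; have [] := h1 v; by rewrite ltn_ord.
Qed.

Lemma den_findN m f : (forall i, arr m aIN i = f i) -> (forall i, i < n -> f i) -> f n = false ->
  let m' := den (Zero pN ;; Rep (If (BA aIN pN) (Inc pN) Skip)) m in
  [/\ arr m' = arr m, ptr m' pN = n & forall p, p != pN -> ptr m' p = ptr m p].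
Proof.
move=> hf h1 h0; rewrite /=; set g := fun s => _.
suff h k : [/\ arr (iter k g (set_ptr pN 0 m)) = arr m,
    ptr (iter k g (set_ptr pN 0 m)) pN = minn k n &
    forall p, p != pN -> ptr (iter k g (set_ptr pN 0 m)) p = ptr m p].
  by have [a1 a2 a3] := h N; split=> //; rewrite a2; lia.
elim: k => [|k]; first by split=> //= [|p /negbTE -> //]; rewrite min0n.
rewrite iterS; move: (iter k g _) => s [a1 a2 a3]; rewrite /g a1 hf a2.
case: (ltnP k n) => hk.
  have -> : minn k.+1 n = k.+1 by lia.
  rewrite h1 //; case: eqP => [|_]; first lia.
  by split=> //= p np; rewrite (negbTE np) a3.
have e1 : minn k n = n by lia.
have e2 : minn k.+1 n = n by lia.
by rewrite h0 e2; split=> //; rewrite a2.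
Qed.

End InitProgram.

Theorem den_Init n (adj : rel 'I_n) (Z1 Z2 : {set 'I_n}) : [disjoint Z1 & Z2] ->
  let w := encode adj Z1 Z2 in let N := size w in
  let m := den pN N Init (mem0 20 w) in
  rel_inp adj (if #|Z1| <= #|Z2| then Z1 else Z2) (if #|Z1| <= #|Z2| then Z2 else Z1) N m /\
  rel_odo m (Running (fun _ => false)).
Proof.
move=> dZ w N; rewrite /Init.
have eN : N = n.+1 + n * n + n + n by apply: size_encode.
have nN : n < N by lia.
set m0 := mem0 20 w; rewrite den_seq.
have [h1 h2 h3] := @den_findN n N nN m0 (nth false w) (fun _ => erefl)
  (nth_encode_lt adj Z1 Z2) (nth_encode_n adj Z1 Z2).
move: (den pN N _ m0) h1 h2 h3 => m1 h1 h2 h3.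
have [|[a1 a2] a3] := @den_Copy N pX pN m1 isT; first by rewrite h2; lia.
rewrite den_seq; move: (den pN N _ m1) a1 a2 a3 => m2 a1 a2 a3.
have b0 : ptr m2 pO = 0 by rewrite a2 // h3.
have bN : ptr m2 pN = n by rewrite a2.
rewrite den_seq.
have -> : den pN N (Inc pX) m2 = set_ptr pX n.+1 m2 by rewrite /= a3 h2; case: eqP => //; lia.
(* The double loop carries [pX] across the adjacency matrix, from cell [n.+1] to cell
   [n.+1 + n * n]. *)
have [|||[c1 c2 c3] _ _] := @den_upto pN N pY pN (upto pV pN (Inc pX)) (set_ptr pX n.+1 m2) n
  (fun k s => [/\ arr s = arr m2, ptr s pX = n.+1 + k * n & ptr s pO = 0 /\ ptr s pN = n]) isT bN.
- exact: ltnW.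
- by split=> //=; rewrite mul0n addn0.
- move=> k s hk [e1 e2 [e3 e4]] ek ekn.
  have [|||[d1 d2 [d3 [d4 d5]]] _ _] := @den_upto pN N pV pN (Inc pX) s n
    (fun j s => [/\ arr s = arr m2, ptr s pX = n.+1 + k * n + j & ptr s pO = 0 /\ ptr s pN = n /\ ptr s pY = k]) isT e4.
  + exact: ltnW.
  + by split=> //=; rewrite addn0.
  + move=> j t hj [f1 f2 [f3 [f4 f5]]] ej ejn.
    have -> : den pN N (Inc pX) t = set_ptr pX (n.+1 + k * n + j).+1 t.
      by rewrite /= f2; case: eqP => //; rewrite eN; nia.
    by split=> //; split=> //=; rewrite addnS.
  by split=> //; split=> //=; rewrite d2 mulSn; lia.
rewrite den_seq; move: (den pN N _ (set_ptr pX _ _)) c1 c2 c3 => m3 c1 c2 [c3 c4].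
have arr3 a i : arr m3 a i = arr m0 a i by rewrite c1 a1 h1.
have [||d1 d2 d3 d4] := @den_ReadRow n N nN aT m3 (n.+1 + n * n) isT c4 c2; first by lia.
  by move=> i; rewrite arr3.
rewrite den_seq; move: (den pN N _ m3) d1 d2 d3 d4 => m4 d1 d2 d3 d4.
have [||||e1 e2 e3 e4] := @den_ReadRow n N nN aF m4 (n.+1 + n * n + n) isT.
- by rewrite d4.
- exact: d3.
- by lia.
- by move=> i; rewrite d1 ?arr3.
rewrite den_seq; move: (den pN N _ m4) e1 e2 e3 e4 => m5 e1 e2 e3 e4.
have hT5 (v : 'I_n) : arr m5 aT v = (v \in Z1).
  by rewrite e1 // d2 // arr3 -(nth_encode_Z1 adj Z1 Z2).
have hF5 (v : 'I_n) : arr m5 aF v = (v \in Z2).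
  by rewrite e2 // d1 // arr3 -(nth_encode_Z2 adj Z1 Z2).
have arr5 a i : a \notin [:: aT; aF] -> arr m5 a i = arr m0 a i.
  by rewrite !inE negb_or => /andP[n1 n2]; rewrite e1 // d1 // arr3.
have pN5 : ptr m5 pN = n by rewrite e4 // d4.
have pO5 : ptr m5 pO = 0 by rewrite e4 // d4.
have [[f1 f2] f3] := @den_Count n N nN pX aT m5 isT isT pN5.
rewrite den_seq; move: (den pN N _ m5) f1 f2 f3 => m6 f1 f2 f3.
have pN6 : ptr m6 pN = n by rewrite f2.
have [[g1 g2] g3] := @den_Count n N nN pY aF m6 isT isT pN6.
rewrite den_seq; move: (den pN N _ m6) g1 g2 g3 => m7 g1 g2 g3.
have e7 : arr m7 = arr m5 by rewrite g1 f1.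
have pN7 : ptr m7 pN = n by rewrite g2.
have pO7 : ptr m7 pO = 0 by rewrite g2 // f2.
rewrite den_if [bev _ _ _ _]/= g3 g2 // f3 f1.
have -> : [set v : 'I_n | arr m5 aT v] = Z1 by apply/setP=> v; rewrite inE.
have -> : [set v : 'I_n | arr m5 aF v] = Z2 by apply/setP=> v; rewrite inE.
have adj0 (u v : 'I_n) : arr m0 aIN (minn N (n.+1 + u * n + v)) = adj u v.
  have -> : minn N (n.+1 + u * n + v) = n.+1 + u * n + v.
    by have := ltn_ord u; have := ltn_ord v; rewrite eN; nia.
  exact: nth_encode_adj.
case: ifP => _.
  split; last by split; rewrite ?e7 ?arr5 // => j; rewrite arr5.
  split; last by move=> v; rewrite e7.
  by split=> // *; rewrite e7 // arr5.
have hT7 (v : 'I_n) : arr m7 aT v = (v \in Z1) by rewrite e7.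
have hF7 (v : 'I_n) : arr m7 aF v = (v \in Z2) by rewrite e7.
have [k1 k2 k3 k4] := @den_Swap n N nN Z1 Z2 m7 dZ pN7 hT7 hF7.
split; last by split; rewrite ?k3 ?e7 ?arr5 // => j; rewrite k3 // e7 arr5.
split; last by move=> v; rewrite k1.
by split=> *; rewrite ?k4 ?k2 // k3 // e7 arr5.
Qed.

(** * The number of leaves *)

Lemma leq_expl a b n : a <= b -> a ^ n <= b ^ n.
Proof. by case: n => // n h; rewrite leq_exp2r. Qed.

(* [debt_weight j / 40 ^ j] is the sum of the [(9 / 8) ^ i] for [i < j]. *)
Fixpoint debt_weight j := if j is j'.+1 then 40 * (45 ^ j' + debt_weight j') else 0.

Lemma debt_weight_ge j : 40 ^ j.+1 <= debt_weight j.+1.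
Proof.
rewrite expnS /= leq_mul2l /= (leq_trans _ (leq_addr _ _)) //.
by case: j => // j; rewrite leq_exp2r.
Qed.

(** Divided by [40 ^ j], the claim bounds the sum of the [(9 / 8) ^ i], [i < j], by [(8 / 5) ^ j].
    The induction step needs the next summand [(9 / 8) ^ j] to be at most [3 / 5] of [(8 / 5) ^ j];
    this fails for [j = 1] and holds from [j = 2] on, where the induction starts. *)
Lemma debt_weight_le j : debt_weight j <= 64 ^ j.
Proof.
case: j => [|[|j]] //.
suff : debt_weight j.+2 <= 64 ^ j.+2 /\ 5 * 45 ^ j.+2 <= 3 * 64 ^ j.+2 by case.
elim: j => [|j]; first by split; vm_compute.
rewrite [debt_weight j.+3]/= -/(debt_weight j.+2).
rewrite (expnS 64 j.+2) (expnS 45 j.+2).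
by move: (45 ^ j.+2) (64 ^ j.+2) (debt_weight j.+2) => x y z []; lia.
Qed.

Section Count.
Variables (n : nat) (adj : rel 'I_n) (T F : {set 'I_n}).
Hypothesis adj_irr : forall x, adj x x = false.
Implicit Types s : sst n.

Notation stp := (search_step adj F).
Notation isdec := (is_decision adj).
Notation leaves := (tree_leaves stp isdec).
Notation nbr := (first_nbr adj).

Definition nb (A : {set 'I_n}) u := [set v in A | adj u v].

Lemma nbrP (A : {set 'I_n}) u : first_spec [pred v | (v \in A) && adj u v] (nbr A u).
Proof. exact: firstP. Qed.

Lemma isdec_stop s : sfail s || sfin s || sroot s && sph s -> isdec s = false.
Proof.
rewrite /is_decision; case: (sfail s) => //=; case: (sfin s) => //= /andP[-> ->].
by case: (scur s).
Qed.

Lemma stop_stp s b : sfail s || sfin s || sroot s && sph s ->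
  sfail (stp s b) || sfin (stp s b) || sroot (stp s b) && sph (stp s b).
Proof.
rewrite /search_step; case e: (sfail s || sfin s) => /=; first by rewrite e.
case/andP=> hr hp; rewrite hr; case: (scur s) => [u|].
  by rewrite hp /otherstep; case: (first_nbr _ _ _) => [v|] /=; rewrite hr ?hp ?orbT.
rewrite /popstep; case: (first _) => [u|] /=; first by rewrite hr hp orbT.
by rewrite hp; case: (first _) => /=; rewrite ?orbT.
Qed.

(** No choice is read after a failure, after success or while the second set grows, so the subtree
    is a single path. *)
Lemma leaves_stop k s : sfail s || sfin s || sroot s && sph s -> leaves k s = 1.
Proof.
by elim: k s => //= k IH s h; rewrite isdec_stop // addn0 IH // stop_stp.
Qed.


Lemma sU_check s : sU (check s) = sU s.
Proof. by rewrite /check; case: ifP. Qed.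

Lemma sU_stp s b : ~~ isdec s -> sU (stp s b) = sU s.
Proof.
rewrite /search_step /is_decision; case: (sfail s) => //=; case: (sfin s) => //=.
case: (sroot s); last first.
  rewrite /rootstep; case: (first _) => //=; by case: (first _).
case: (scur s) => [u|]; last first.
  rewrite /popstep; case: (first _) => //=; case: (sph s); first by case: (first _).
  case: (first _) => //; by case: (first (mem F)) => //; case: (first _).
case: (sph s) => /=; first by rewrite /otherstep; case: (first_nbr _ _ _).
rewrite /growstep sU_check; case: (first_nbr _ _ _) => //=; case: (first_nbr _ _ _) => //=.
by case: ifP.
Qed.

Lemma sU_dec s : isdec s -> exists2 v, v \in sU s & forall b, sU (stp s b) = sU s :\ v.
Proof.
rewrite /search_step /is_decision; case: (sfail s) => //=; case: (sfin s) => //=.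
case: (sroot s).
  case: (scur s) => // u; case: (sph s) => //= /andP[].
  rewrite /growstep; case: nbrP => //= _ _; case: nbrP => //= v /andP[hv _] _.
  by exists v => // b; rewrite sU_check; case: b.
rewrite /rootstep => /andP[]; case: firstP => //= _ _; case: firstP => // v hv _.
by exists v => // -[].
Qed.

(** Both outcomes of a decision remove the same vertex from [sU], and no other step changes [sU]. *)
Lemma leaves_exp2 k s : leaves k s <= 2 ^ #|sU s|.
Proof.
elim: k s => [|k IH] s /=; first by rewrite expn_gt0.
case: (boolP (isdec s)) => h; last by rewrite addn0 -(sU_stp true h).
have [v hv e] := sU_dec h.
rewrite (cardsD1 v) hv expnS mul2n -addnn -(e true) leq_add //.
by rewrite (e true) -(e false).
Qed.

Definition slack s := #|sW s| - #|sD s|.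

(* Weight of the subtree below [s], times [40 ^ #|sU s|]: an undecided vertex
   counts [8 / 5], or [9 / 8] if it is a neighbour of the current vertex, and
   each unit of slack counts [8]. *)
Definition weight s :=
  if scur s is Some u then
    let j := #|nb (sU s) u| in 64 ^ (#|sU s| - j) * 8 ^ slack s *
      (if (u \in sD s) && ~~ nbr (sW s) u then debt_weight j else 45 ^ j)
  else 64 ^ #|sU s| * 8 ^ slack s.

Lemma nb_le (A : {set 'I_n}) u : #|nb A u| <= #|A|.
Proof. by apply: subset_leq_card; apply/subsetP=> v; rewrite inE => /andP[]. Qed.

Lemma card_nbD1 (A : {set 'I_n}) u v : v \in A -> adj u v -> #|nb A u| = #|nb (A :\ v) u|.+1.
Proof.
move=> hv huv; rewrite (cardsD1 v) inE hv huv add1n; congr _.+1.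
by apply: eq_card => x; rewrite !inE andbA.
Qed.

Lemma check_cases s : (#|sD s| <= #|sW s| /\ check s = s) \/ (sfail (check s) /\ sroot (check s) = sroot s).
Proof. by rewrite /check; case: ifP; [left|right]. Qed.

(** Write [L] for the number of leaves, [u] for the number of undecided vertices and [w] for the
    weight divided by [40 ^ u]; the claim is [L <= 1 + u * w]. The 1 is there because a branch about
    to fail has a leaf but may have weight 0. At a decision the children satisfy [w1 + w0 <= w], and
    [w >= 1], so [L <= 2 + (u - 1) * w <= 1 + u * w]. *)
Lemma leaves_weight k s : sroot s -> [disjoint sD s & sU s] -> #|sD s| <= #|sW s| ->
  leaves k s * 40 ^ #|sU s| <= 40 ^ #|sU s| + #|sU s| * weight s.
Proof.
elim: k s => [|k IH] s hr hd hw; first by rewrite mul1n leq_addr.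
case: (boolP (sfail s || sfin s || sroot s && sph s)) => [h|].
  by rewrite leaves_stop // mul1n leq_addr.
rewrite hr /= !negb_or => /andP[/andP[nf nn] np].
have one s' : sfail s' || sfin s' || sroot s' && sph s' -> sU s' = sU s ->
    leaves k s' * 40 ^ #|sU s| <= 40 ^ #|sU s| + #|sU s| * weight s.
  by move=> h _; rewrite leaves_stop // mul1n leq_addr.
have mono s' : sU s' = sU s -> sroot s' -> [disjoint sD s' & sU s'] -> #|sD s'| <= #|sW s'| ->
    weight s' <= weight s ->
    leaves k s' * 40 ^ #|sU s| <= 40 ^ #|sU s| + #|sU s| * weight s.
  move=> eU r' d' w' hwt; have := IH s' r' d' w'; rewrite eU => h; apply: leq_trans h _.
  by rewrite leq_add2l leq_mul2l hwt orbT.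
have pos8 : 0 < 8 ^ slack s by rewrite expn_gt0.
have es b : stp s b = if scur s is Some u then growstep adj s u b else popstep F s.
  by rewrite /search_step (negbTE nf) (negbTE nn) hr (negbTE np).
have ed : isdec s = if scur s is Some u then ~~ nbr (sW s) u && nbr (sU s) u else false.
  by rewrite /is_decision nf nn hr np.
rewrite [tree_leaves _ _ _ _]/= !es ed {es ed}.
case eu: (scur s) => [u|]; last first.
  rewrite addn0 /popstep (negbTE np).
  case: firstP => [u _|_].
    apply: mono => //=; rewrite /weight /= eu.
    (* When [u] becomes current, the factor [64 ^ j] of its undecided neighbours is replaced by
       [45 ^ j] or [debt_weight j], neither of which is larger. *)
    set j := #|nb _ _|; have hj : j <= #|sU s| by apply: nb_le.
    have e : 64 ^ #|sU s| = 64 ^ (#|sU s| - j) * 64 ^ j by rewrite -expnD subnK.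
    rewrite e /slack /= -!mulnA leq_mul2l; apply/orP; right.
    rewrite mulnC leq_mul2r; apply/orP; right.
    by case: ifP => _; [apply: debt_weight_le|case: (j) => // j'; rewrite leq_exp2r].
  case: (first _) => [w|]; first exact: one.
  case: (first (mem F)) => [v|]; [|case: (first _) => [v|]].
  - by apply: one => //=; rewrite hr orbT.
  - by apply: one => //=; rewrite hr orbT.
  - exact: one.
rewrite /growstep.
set j := #|nb (sU s) u|; have hj : j <= #|sU s| by apply: nb_le.
case: nbrP => [v /andP[hv huv]|hW] /=.
  rewrite addn0; set s' := takeW _ _ _.
  have [[hc ->]|[hc hr']] := check_cases s'; last first.
    by apply: one; rewrite ?sU_check // hc.
  apply: mono => //.
    by rewrite disjoint_sym; apply: disjointWr (subD1set _ _) _; rewrite disjoint_sym.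
  (* The unreached terminal pays a possible debt of [u] without a choice, and [weight] has charged
     [45 ^ j] already before this step. The slack does not grow. *)
  rewrite /weight eu [scur s']/= eu; have -> : u \in sD s' = false by rewrite !inE eqxx.
  have -> : nbr (sW s) u = Some (odflt v (nbr (sW s) u)).
    by case: nbrP => //= /(_ v); rewrite /= hv huv.
  rewrite andbF /= -/j leq_mul2r; apply/orP; right; rewrite leq_mul2l; apply/orP; right.
  have := cardsD1 v (sW s); have := cardsD1 u (sD s); rewrite hv leq_exp2l // /slack /=.
  by case: (u \in sD s); move: #|sD s :\ u| #|sW s :\ v| #|sD s| #|sW s| => a b c d; clear; lia.
have noW : nbr (sW s) u = None.
  by case: nbrP => // v /andP[h1 h2]; have := hW v; rewrite /= h1 h2.
case: nbrP => [v /andP[hv huv]|hU] /=; last first.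
  have j0 : j = 0.
    apply/eqP; rewrite cards_eq0; apply/eqP/setP=> v; rewrite !inE.
    by apply/negbTE; apply: hU.
  rewrite addn0; case: ifP => hu.
    by apply: one; rewrite ?sU_check // /check; case: ifP.
  have -> : check (dropQ s u) = dropQ s u by rewrite /check /= hw.
  apply: mono => //; rewrite /weight eu hu /= -/j j0 muln1 subn0 /slack /=; exact: leqnn.
have [m em] : exists m, #|sU s| = m.+1 by rewrite (cardsD1 v) hv; exists #|sU s :\ v|.
have em' : #|sU s :\ v| = m by move: em; rewrite (cardsD1 v) hv add1n => -[].
have ej : j = #|nb (sU s :\ v) u|.+1 by apply: card_nbD1.
have uv : (u == v) = false by apply/eqP=> e; rewrite e adj_irr in huv.
have vD : v \notin sD s by apply/negP=> h; have := disjointFr hd h; rewrite hv.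
set s1 := check _; set s0 := check _.
have es0 : s0 = dropU s v by rewrite /s0 /check /= hw.
have h0 : leaves k s0 * 40 ^ m <= 40 ^ m + m * weight s0.
  have := IH s0; rewrite es0 /= em'; apply=> //.
  by apply: disjointWr (subD1set _ _) _.
have Jm : #|nb (sU s :\ v) u| <= m by rewrite -em'; apply: nb_le.
move: ej Jm; set J := #|nb (sU s :\ v) u| => ej Jm.
have eX : m.+1 - j = m - J by rewrite ej subSS.
have X40 : 40 ^ (m - J) <= 64 ^ (m - J) by case: (m - J) => // i; rewrite leq_exp2r.
have Y40 : 40 ^ J.+1 <= 45 ^ J.+1 by rewrite leq_exp2r.
have e40 : 40 ^ m.+1 = 40 ^ (m - J) * 40 ^ J.+1 by rewrite -expnD addnS subnK.
have ws : weight s = 64 ^ (m - J) * 8 ^ slack s *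
    (if u \in sD s then debt_weight J.+1 else 45 ^ J.+1).
  by rewrite /weight eu -/j em eX noW andbT ej.
have ws0 : weight s0 = 64 ^ (m - J) * 8 ^ slack s *
    (if u \in sD s then debt_weight J else 45 ^ J).
  by rewrite es0 /weight /= eu em' -/J noW andbT.
(* Here [w >= 1]: [u] still has an undecided neighbour, so even its debt weight has the summand
   1. *)
have big : 40 ^ m.+1 <= weight s.
  rewrite ws e40 -mulnA leq_mul //.
  apply: (@leq_trans (1 * (if u \in sD s then debt_weight J.+1 else 45 ^ J.+1))).
    by rewrite mul1n; case: ifP => _ //; apply: debt_weight_ge.
  by rewrite leq_mul2r pos8 orbT.
have [w1 h1 hw1] : exists2 w1, leaves k s1 * 40 ^ m <= 40 ^ m + m * w1 &
    40 * (w1 + weight s0) <= weight s.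
  rewrite /s1; set s' := takeU _ _ _; clearbody s0.
  have cD := cardsD1 u (sD s).
  have cD' : #|sD s'| = #|sD s :\ u|.+1 by rewrite /= cardsU1 !inE (negbTE vD) andbF add1n.
  have [[hc ->]|[hc hr']] := check_cases s'; last first.
    exists 0; first by rewrite leaves_stop ?hc // mul1n leq_addr.
    rewrite ws ws0 add0n mulnCA leq_mul2l; apply/orP; right.
    case: ifP => _ /=; first by rewrite leq_mul2l leq_addl orbT.
    by rewrite expnS leq_mul2r orbT.
  have ws1 : weight s' = 64 ^ (m - J) * 8 ^ slack s' * 45 ^ J.
    by rewrite /weight [scur s']/= eu [sU s']/= em' -/J [sD s']/= !inE uv eqxx.
  exists (weight s').
    have := IH s'; rewrite [sU s']/= em'; apply=> //.
    rewrite disjoints_subset; apply/subsetP=> x; rewrite !inE.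
    case: (eqVneq x v) => //= xv /andP[_ xD].
    by have := disjointFr hd xD => ->.
  (* If [u] was in debt, [v] takes over the debt and the slack is unchanged; this is the recursion
     defining [debt_weight]. Otherwise the slack drops by one, and [40 * (1 + 8) = 8 * 45]. *)
  rewrite ws1 ws0 ws -!mulnA -mulnDr mulnCA leq_mul2l; apply/orP; right.
  rewrite cD' in hc; rewrite /= in hc.
  move: hc cD; rewrite /slack cD' [sW s']/=.
  case: (u \in sD s) => hc cD.
    have -> : #|sW s| - #|sD s :\ u|.+1 = #|sW s| - #|sD s| by rewrite cD add1n.
    by rewrite -mulnDr mulnCA.
  have -> : #|sW s| - #|sD s| = (#|sW s| - #|sD s :\ u|.+1).+1.
    by rewrite cD add0n subnSK.
  rewrite [8 ^ _.+1]expnS expnS; move: (8 ^ _) (45 ^ _) => x y.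
  by clear; lia.
rewrite em mulnDl (expnS 40 m) mulnCA [X in _ + X <= _]mulnCA.
have : 40 * (m * w1 + m * weight s0) <= m * weight s by rewrite -mulnDr mulnCA leq_mul2l hw1 orbT.
move: big h0 h1; rewrite (expnS 40 m) (mulSn m).
move: (m * weight s) (m * w1) (m * weight s0) (leaves k s1 * 40 ^ m) (leaves k s0 * 40 ^ m) (40 ^ m) (weight s).
by clear; move=> *; lia.
Qed.

(** Refusing a vertex as root removes it from [sU]; accepting it starts a search with slack 0, to
    which [leaves_weight] applies. The factor [#|sU s|.+1] counts these starts. *)
Lemma leaves_rootless k s : ~~ sroot s -> sW s = set0 -> sD s = set0 -> scur s = None ->
  leaves k s * 40 ^ #|sU s| <= #|sU s|.+1 * (40 ^ #|sU s| + #|sU s| * 64 ^ #|sU s|).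
Proof.
have triv m : 1 * 40 ^ m <= m.+1 * (40 ^ m + m * 64 ^ m) by rewrite leq_mul // leq_addr.
elim: k s => [|k IH] s hr hW hD hc //.
case: (boolP (sfail s || sfin s)) => [h|]; first by rewrite leaves_stop ?h.
rewrite negb_or => /andP[nf nn].
have fW : first (mem (sW s)) = None by case: firstP => // v /=; rewrite hW inE.
have es b : stp s b = if first (mem (sU s)) is Some v
    then if b then takeU s v (sD s) else dropU s v else failed s.
  by rewrite /search_step (negbTE nf) (negbTE nn) (negbTE hr) /rootstep fW.
have ed : isdec s = first (mem (sU s)) :> bool.
  by rewrite /is_decision nf nn (negbTE hr) fW.
rewrite [tree_leaves _ _ _ _]/= !es ed {es ed}.
case: firstP => [v hv|_]; last by rewrite leaves_stop //= addn0.
have [m em] : exists m, #|sU s| = m.+1.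
  by exists #|sU s :\ v|; have := cardsD1 v (sU s); rewrite (hv : v \in sU s).
have em' : #|sU s :\ v| = m.
  by have := cardsD1 v (sU s); rewrite (hv : v \in sU s) em add1n => -[].
have := IH (dropU s v) hr hW hD hc; rewrite [sU _]/= em'.
have := @leaves_weight k (takeU s v (sD s)) isT; rewrite [sU _]/= [sD _]/= em' hD cards0 => /(_ _ isT).
have -> : weight (takeU s v set0) = 64 ^ m.
  by rewrite /weight /= hc em' /slack /= hW !cards0 muln1.
rewrite em (expnS 40) (expnS 64) /= mulnDl.
have dj : [disjoint (@set0 'I_n) & sU s :\ v] by rewrite disjoints_subset sub0set.
move=> /(_ dj); move: (leaves k _) (leaves k _) (40 ^ m) (64 ^ m) => a b x y; clear; nia.
Qed.

Lemma leaves_start k m : #|~: (T :|: F)| = m ->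
  leaves k (start T F) * 40 ^ m <= m.+1 * (40 ^ m + m * (64 ^ m * 8 ^ #|T|)).
Proof.
move=> em; case: (eqVneq T set0) => [T0|/set0Pn [v0 hv0]].
  have := @leaves_rootless k (start T F) isT T0 erefl erefl; rewrite [sU _]/= em.
  by rewrite T0 cards0 muln1.
case: k => [|k]; first by rewrite leq_mul // leq_addr.
have [v hv ef] : exists2 v, v \in T & first (mem T) = Some v.
  by case: firstP => [v hv|/(_ v0)]; [exists v|rewrite /= hv0].
have es b : stp (start T F) b = takeW (start T F) v set0.
  by rewrite /search_step /= /rootstep /= ef.
have ed : isdec (start T F) = false by rewrite /is_decision /= ef.
rewrite [tree_leaves _ _ _ _]/= es ed addn0.
have := @leaves_weight k (takeW (start T F) v set0) isT.
rewrite [sU _]/= [sD _]/= cards0 em => h.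
apply: leq_trans (h _ isT) _; first by rewrite disjoints_subset sub0set.
have hw : weight (takeW (start T F) v set0) <= 64 ^ m * 8 ^ #|T|.
  rewrite /weight /= em leq_mul2l; apply/orP; right.
  by rewrite leq_exp2l // /slack /= cards0 subn0 subset_leq_card // subD1set.
rewrite mulSn (leq_trans (_ : _ <= 40 ^ m + m * (64 ^ m * 8 ^ #|T|))) ?leq_addr //.
by rewrite leq_add2l leq_mul2l hw orbT.
Qed.

End Count.

(** * Comparison of the two leaf bounds with [1.78 ^ n] *)

Section Rates.
(* The constants are kept abstract, since conversion would unfold large unary
   numbers such as [8 ^ 10]. *)
Variables (a b d p q : nat).
Hypotheses (ad : a * a = d) (ab : a <= b) (bd : b <= d) (a0 : 0 < a).
Hypotheses (qp : q <= p) (rate2 : 2 ^ 9 * q ^ 11 <= p ^ 11).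
Hypothesis rate8 : b ^ 10 * d * q ^ 11 <= (p * a) ^ 11.

Lemma subset_bound n m : 11 * m <= 9 * n -> 2 ^ m * q ^ n <= p ^ n.
Proof.
move=> h; rewrite -(@leq_exp2r _ _ 11) // expnMn -!expnM.
apply: (@leq_trans (2 ^ (9 * n) * q ^ (n * 11))).
  by rewrite leq_mul2r leq_exp2l // (mulnC m) h orbT.
by rewrite expnM (mulnC n 11) !(expnM _ 11) -expnMn; apply: leq_expl.
Qed.

(** For the intended values this is [(8 / 5) ^ m * 8 ^ t <= 1.78 ^ n]. Replacing one terminal of
    each set by two nonterminals multiplies the left side by [8 / 25], which is where [b <= d]
    enters; so the worst case is the largest ratio [t = n / 11] with [m = 9 * n / 11], and [rate8]
    is this case for [n = 11]. *)
Lemma weight_bound n m t : m + 2 * t <= n -> 11 * t <= n ->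
  b ^ m * b ^ t * q ^ n <= p ^ n * a ^ m.
Proof.
move=> hm ht; rewrite -(@leq_exp2r _ _ 11) // !expnMn -!expnM.
have [r er] : exists r, n = m + 2 * t + r by exists (n - (m + 2 * t)); rewrite subnKC.
have p5 : 0 < a ^ (22 * t + 11 * r) by rewrite expn_gt0 a0.
rewrite -(leq_pmul2r p5).
have -> : p ^ (n * 11) * a ^ (m * 11) * a ^ (22 * t + 11 * r) = ((p * a) ^ 11) ^ n.
  by rewrite -mulnA -expnD -expnM expnMn; congr (_ ^ _ * _ ^ _); rewrite 1?mulnC // er; clear; lia.
apply: leq_trans (leq_expl n rate8).
have -> : (b ^ 10 * d * q ^ 11) ^ n = b ^ (10 * n) * d ^ n * q ^ (n * 11).
  by rewrite 2!expnMn -!expnM (mulnC 11).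
rewrite -expnD mulnAC leq_mul2r; apply/orP; right.
have e5 : a ^ (22 * t + 11 * r) <= d ^ (11 * t) * b ^ (11 * r).
  have -> : 22 * t = 2 * (11 * t) by rewrite mulnA.
  rewrite expnD expnM -mulnn ad leq_mul2l; apply/orP; right; exact: leq_expl.
apply: leq_trans (leq_mul (leqnn _) e5) _.
rewrite mulnCA -expnD.
have -> : m * 11 + t * 11 + 11 * r = 10 * n + (n - 11 * t) by move: hm ht; rewrite er; clear; lia.
rewrite expnD mulnCA leq_mul2l; apply/orP; right.
have e25 : d ^ n = d ^ (11 * t) * d ^ (n - 11 * t) by rewrite -expnD subnKC.
by rewrite e25 leq_mul2l; apply/orP; right; apply: leq_expl.
Qed.

Lemma search_bound n t f m L : t <= f -> m + t + f = n -> L <= 2 ^ m ->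
  L * (b * a) ^ m <= m.+1 * ((b * a) ^ m + m * ((b * b) ^ m * b ^ t)) ->
  L * q ^ n <= n.+1 ^ 2 * p ^ n.
Proof.
move=> tf en h2 h40; have sq : 0 < n.+1 ^ 2 by rewrite expn_gt0.
case: (leqP n (11 * t)) => hn.
  apply: (@leq_trans (1 * p ^ n)); last by rewrite leq_mul2r sq orbT.
  rewrite mul1n; apply: leq_trans (@subset_bound n m _); last by move: tf en hn; clear; lia.
  by rewrite leq_mul2r h2 orbT.
have key : (b * b) ^ m * b ^ t * q ^ n <= p ^ n * (b * a) ^ m.
  rewrite !expnMn -!mulnA [leqRHS]mulnCA leq_mul2l; apply/orP; right.
  by rewrite mulnA; apply: weight_bound; move: tf en hn; clear; lia.
have key0 : (b * a) ^ m * q ^ n <= p ^ n * (b * a) ^ m.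
  by rewrite mulnC leq_mul2r leq_expl ?orbT.
have p40 : 0 < (b * a) ^ m by rewrite expn_gt0 muln_gt0 a0 (leq_trans a0 ab).
move: (b * a) (b * b) h40 key key0 p40 => x y h40 key key0 p40.
rewrite -(leq_pmul2r p40) mulnAC.
apply: (@leq_trans (m.+1 * (x ^ m + m * (y ^ m * b ^ t)) * q ^ n)); first by rewrite leq_mul2r h40 orbT.
apply: (@leq_trans (m.+1 * (m.+1 * (p ^ n * x ^ m)))).
  by rewrite -mulnA mulnDl leq_mul2l /= mulSn leq_add // -mulnA leq_mul2l key orbT.
rewrite !mulnA leq_mul2r; apply/orP; right; rewrite leq_mul2r; apply/orP; right.
by rewrite -mulnn leq_mul // ltnS -en -addnA leq_addr.
Qed.

End Rates.

(** The numbers 5 and 8 stem from the weights [8 / 5] and [8], with [40 = 8 * 5], [64 = 8 * 8] and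
    [25 = 5 * 5]; and [89 / 50 = 1.78]. *)
Lemma leaves_numeric n t f m L : t <= f -> m + t + f = n -> L <= 2 ^ m ->
  L * 40 ^ m <= m.+1 * (40 ^ m + m * (64 ^ m * 8 ^ t)) -> L * 50 ^ n <= n.+1 ^ 2 * 89 ^ n.
Proof.
have r2 : 2 ^ 9 * 50 ^ 11 <= 89 ^ 11 by lia.
have r8 : 8 ^ 10 * 25 * 50 ^ 11 <= (89 * 5) ^ 11 by lia.
exact: (@search_bound 5 8 25 89 50 erefl isT isT isT isT r2 r8).
Qed.

(** * Soundness *)

Section Reach.
Variables (n : nat) (adj : rel 'I_n).
Hypothesis adj_sym : forall x y, adj x y = adj y x.
Implicit Types A B X Y Z : {set 'I_n}.

Definition closed_in A Y :=
  [forall x in A, forall y in A, (x \in Y) && adj x y ==> (y \in Y)].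

Lemma closed_inP A Y :
  reflect (forall x y, x \in A -> y \in A -> x \in Y -> adj x y -> y \in Y) (closed_in A Y).
Proof.
apply: (iffP forall_inP) => [h x y xA yA xY xy|h x xA].
  by have /forall_inP /(_ y yA) := h x xA; rewrite xY xy.
by apply/forall_inP => y yA; apply/implyP => /andP[]; apply: h.
Qed.

(** For [r] in [A] this is connectivity of [A], stated as an induction principle: a property of [r]
    that passes along the edges inside [A] holds on all of [A]. *)
Definition reach A r := forall Y, r \in Y -> closed_in A Y -> A \subset Y.

Lemma reach_connected A r : r \in A -> reach A r -> induced_connected adj A.
Proof.
move=> rA h; split; first by apply/set0Pn; exists r.
set e := [rel u v | _].
have sym : connect_sym e.
  by apply: sym_connect_sym => u v; rewrite /= adj_sym [(u \in A) && _]andbC.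
have hr : A \subset [set y | connect e r y].
  apply: h; first by rewrite inE connect0.
  apply/closed_inP => u v uA vA; rewrite !inE => ru uv.
  by apply: connect_trans ru (connect1 _); rewrite /= uv uA vA.
have {}hr x : x \in A -> connect e r x by move/(subsetP hr); rewrite inE.
by move=> x y xA yA; apply: connect_trans (hr _ yA); rewrite sym hr.
Qed.

Lemma connected_reach A r : induced_connected adj A -> r \in A -> reach A r.
Proof.
move=> [_ h] rA Y rY /closed_inP hY; apply/subsetP=> x xA.
have /connectP [p hp ->] := h r x rA xA.
elim: p r rA rY hp => //= y p IH r rA rY /andP[/and3P[ry _ yA] hp].
by apply: IH hp => //; apply: hY rY ry.
Qed.

Lemma reach1 r : reach [set r] r.
Proof. by move=> Y rY _; rewrite sub1set. Qed.

Lemma reachU1 A r u v : reach A r -> u \in A -> adj u v -> reach (v |: A) r.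
Proof.
move=> h uA uv Y rY /closed_inP hY.
have AY : A \subset Y.
  by apply: h => //; apply/closed_inP => x y xA yA; apply: hY; rewrite !inE ?xA ?yA orbT.
rewrite subUset sub1set AY andbT; apply: (hY u v) => //; rewrite ?inE ?eqxx ?uA ?orbT //.
exact: (subsetP AY).
Qed.

(** For [r] in [A], the vertex set of the component of [r] in the graph induced on [A]. *)
Definition component A r := \bigcap_(Y : {set 'I_n} | (r \in Y) && closed_in A Y) Y.

Lemma component_closed A r : closed_in A (component A r).
Proof.
apply/closed_inP => x y xA yA /bigcapP hx xy; apply/bigcapP => Y /andP[rY hY].
by apply: (closed_inP _ _ hY) xy => //; apply: hx; rewrite rY.
Qed.

Lemma component_root A r : r \in component A r.
Proof. by apply/bigcapP => Y /andP[]. Qed.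

Lemma component_sub A r Y : r \in Y -> closed_in A Y -> component A r \subset Y.
Proof. by move=> rY hY; apply: bigcap_inf; rewrite rY. Qed.

Lemma component_subset A r : r \in A -> component A r \subset A.
Proof. by move=> rA; apply: component_sub => //; apply/closed_inP. Qed.

Lemma reach_component A r : reach (component A r) r.
Proof.
move=> Y rY /closed_inP hY.
have h : component A r \subset component A r :&: Y.
  apply: component_sub; first by rewrite inE component_root.
  apply/closed_inP => x y xA yA /setIP[xK xY] xy.
  have yK := closed_inP _ _ (component_closed A r) _ _ xA yA xK xy.
  by rewrite inE yK; apply: hY xY xy.
by apply: subset_trans h (subsetIr _ _).
Qed.

(** The part of [X] that is cut off from [r] when [v] is deleted. *)
Definition beyond X r v := (X :\ v) :\: component (X :\ v) r.

Lemma beyond_nbr X r v x y : x \in X -> y \in beyond X r v -> adj x y ->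
  x \in beyond X r v \/ x = v.
Proof.
move=> xX /setDP[yX yK] xy; case: (eqVneq x v) => [->|xv]; first by right.
left; rewrite !inE xv xX !andbT; apply: contra yK => xK.
by apply: (closed_inP _ _ (component_closed _ _)) xy => //; rewrite !inE xv.
Qed.

(** The complement of [Z] contains [r] and is closed within [X], hence it contains [X]. *)
Lemma beyond_empty X r Z : reach X r -> r \notin Z -> Z \subset X ->
  (forall x y, x \in X -> y \in Z -> adj x y -> x \in Z) -> Z = set0.
Proof.
move=> hX rZ ZX h; apply/setP=> z; rewrite inE; apply/negP => zZ.
have : X \subset ~: Z.
  apply: hX; first by rewrite inE.
  apply/closed_inP => x y xX yX; rewrite !inE => xZ xy; apply: contra xZ => yZ.
  exact: h xy.
by move/subsetP/(_ z (subsetP ZX _ zZ)); rewrite inE zZ.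
Qed.

End Reach.

(** * Every accepting leaf is a solution *)

Section Sound.
Variables (n : nat) (adj : rel 'I_n) (T F : {set 'I_n}).
Hypothesis adj_sym : forall x y, adj x y = adj y x.
Hypothesis TF : [disjoint T & F].
Implicit Types s : sst n.

Notation stp := (search_step adj F).
Notation isdec := (is_decision adj).
Notation reach := (reach adj).

(** [sS] and [sB] are the future solution sets. The queue serves the first set and later the second
    one, hence the case distinction in [s_Q]; the second set may start only when [sW] is empty,
    which makes [s_T] say that the first set contains [T]. *)
Record sound s : Prop := Sound {
  s_root : sroot s -> exists2 r, r \in sS s & reach (sS s) r;
  s_rootless : ~~ sroot s -> [/\ sS s = set0, sQ s = set0, scur s = None & ~~ sph s];
  s_T : T \subset sS s :|: sW s;
  s_F : [disjoint sS s :|: (sU s :|: sW s) & F];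
  s_Q : sQ s \subset if sph s then sB s else sS s;
  s_cur : forall u, scur s = Some u -> u \in sQ s;
  s_ph : sph s -> [/\ sW s = set0, exists2 r, r \in sB s & reach (sB s) r & [disjoint sB s & sS s]];
  s_B : ~~ sph s -> sB s = set0;
  s_fin : sfin s -> sph s /\ F \subset sB s }.

Lemma sound_start : sound (start T F).
Proof.
split=> //=; first by rewrite subsetUr.
  rewrite set0U disjoint_subset; apply/subsetP=> x; rewrite !inE.
  by case: (boolP (x \in T)) => [xT|] /=; rewrite ?orbF ?orbT // => _; rewrite (disjointFr TF xT).
Qed.

Lemma sound_fail s : sound s -> sound (failed s).
Proof. by case=> *; split. Qed.

Lemma sound_check s : sound s -> sound (check s).
Proof. by rewrite /check; case: ifP => // _; apply: sound_fail. Qed.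

Lemma disjU (A B : {set 'I_n}) : A \subset B -> [disjoint B & F] -> [disjoint A & F].
Proof. exact: disjointWl. Qed.

Lemma sound_takeW s v D : sound s -> v \in sW s -> ~~ sph s ->
  (sroot s -> exists2 u, u \in sS s & adj u v) -> sound (takeW s v D).
Proof.
case=> h1 h2 h3 h4 h5 h6 h7 h8 h9 hv np hu; split=> //=.
- move=> _; case: (boolP (sroot s)) => hr.
    have [r r1 r2] := h1 hr; have [u u1 u2] := hu hr.
    by exists r; [rewrite inE r1 orbT|apply: reachU1 u2].
  by have [-> _ _ _] := h2 hr; exists v; rewrite setU0; [rewrite inE|apply: reach1].
- apply: subset_trans h3 _; apply/subsetP=> x; rewrite !inE.
  by case: (eqVneq x v) => //=.
- apply: disjU h4; apply/subsetP=> x; rewrite !inE.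
  by case: (eqVneq x v) => [->|_] /=; rewrite ?hv ?orbT.
- by rewrite (negbTE np) in h5 *; apply: setUS.
- by move=> u /h6; rewrite !inE => ->; rewrite orbT.
- by rewrite (negbTE np).
Qed.

Lemma sound_takeU s v D : sound s -> v \in sU s -> ~~ sph s ->
  (sroot s -> exists2 u, u \in sS s & adj u v) -> sound (takeU s v D).
Proof.
case=> h1 h2 h3 h4 h5 h6 h7 h8 h9 hv np hu; split=> //=.
- move=> _; case: (boolP (sroot s)) => hr.
    have [r r1 r2] := h1 hr; have [u u1 u2] := hu hr.
    by exists r; [rewrite inE r1 orbT|apply: reachU1 u2].
  by have [-> _ _ _] := h2 hr; exists v; rewrite setU0; [rewrite inE|apply: reach1].
- apply: subset_trans h3 _; apply/subsetP=> x; rewrite !inE.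
  by case: (eqVneq x v) => //=.
- apply: disjU h4; apply/subsetP=> x; rewrite !inE.
  by case: (eqVneq x v) => [->|_] /=; rewrite ?hv ?orbT.
- by rewrite (negbTE np) in h5 *; apply: setUS.
- by move=> u /h6; rewrite !inE => ->; rewrite orbT.
- by rewrite (negbTE np).
Qed.

Lemma sound_dropU s v : sound s -> sound (dropU s v).
Proof.
case=> h1 h2 h3 h4 h5 h6 h7 h8 h9; split=> //=.
apply: disjU h4; apply/subsetP=> x; rewrite !inE.
by case: (x == v); case: (x \in sS s); case: (x \in sU s); case: (x \in sW s).
Qed.

Lemma sound_dropQ s u : sound s -> sroot s -> sound (dropQ s u).
Proof.
case=> h1 h2 h3 h4 h5 h6 h7 h8 h9 hr; split=> //=; first by rewrite hr.
exact: subset_trans (subD1set _ _) h5.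
Qed.

Lemma sound_step s b : sound s -> sound (stp s b).
Proof.
move=> hs; rewrite /search_step; case: ifP => // nf.
have nfin : sfin s = false by move: nf; case: (sfin s) => //; rewrite orbT.
case: (boolP (sroot s)) => hr; last first.
  have [hS hQ hc np] := s_rootless hs hr; rewrite /rootstep.
  case: firstP => [v hv|_]; first by apply: sound_takeW => //; rewrite (negbTE hr).
  case: firstP => [v hv|_]; last exact: sound_fail.
  by case: b; [apply: sound_takeU => //; rewrite (negbTE hr)|apply: sound_dropU].
case hc: (scur s) => [u|]; last first.
  rewrite /popstep; case: firstP => [u hu|hQ].
    by case: hs => *; split=> //=; [rewrite hr|move=> _ [<-]].
  case: (boolP (sph s)) => hp.
    case: firstP => [v _|hF]; first exact: sound_fail.
    case: hs => *; split=> //= _; split=> //.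
    by apply/subsetP=> x xF; have := hF x; rewrite /= inE xF andbT negbK.
  case: firstP => [v _|hW]; first exact: sound_fail.
  have W0 : sW s = set0 by apply/setP=> x; rewrite inE; apply/negbTE; apply: hW.
  have Q0 : sQ s = set0 by apply/setP=> x; rewrite inE; apply/negbTE; apply: hQ.
  have add v : v \notin sS s -> sound (addB s v).
    move=> vS; case: (hs) => h1 h2 h3 h4 h5 h6 h7 h8 h9; split=> //=.
    - by rewrite hr.
    - by rewrite Q0 h8 // setU0.
    - by rewrite hc.
    - move=> _; rewrite h8 // setU0; split=> //; first by exists v; [rewrite inE|apply: reach1].
      by rewrite disjoints1.
    - by rewrite nfin.
  case: firstP => [v hv|_].
    apply: add; apply/negP => vS; have := disjointFr (s_F hs) (_ : v \in _).
    by rewrite !inE vS => /(_ isT); rewrite (hv : v \in F).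
  case: firstP => [v hv|_]; last exact: sound_fail.
  by apply: add; move: hv; rewrite /= inE.
have uQ := s_cur hs hc.
case: (boolP (sph s)) => hp.
  rewrite /otherstep; case: nbrP => [v /andP[]|_]; last exact: sound_dropQ.
  rewrite !inE negb_or => /andP[vS vB] uv.
  case: (hs) => h1 h2 h3 h4 h5 h6 h7 h8 h9; split=> //=.
  - by rewrite hr.
  - by move: h5; rewrite hp; apply: setUS.
  - by move=> x; rewrite hc => -[<-]; rewrite inE uQ orbT.
  - move=> _; have [q1 [r q2 q3] q4] := h7 hp; split=> //.
      exists r; first by rewrite inE q2 orbT.
      by apply: reachU1 uv => //; move: h5; rewrite hp => /subsetP; apply.
    rewrite disjoint_subset; apply/subsetP=> x; rewrite !inE => /predU1P[->//|xB].
    by rewrite (disjointFr q4 xB).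
  - by rewrite nfin.
have uS : u \in sS s by have := s_Q hs; rewrite (negbTE hp) => /subsetP; apply.
apply: sound_check; rewrite /growstep; case: nbrP => [v /andP[hv uv]|_].
  by apply: sound_takeW => // _; exists u.
case: nbrP => [v /andP[hv uv]|_]; last first.
  by case: ifP => _; [apply: sound_fail|apply: sound_dropQ].
by case: b; [apply: sound_takeU => // _; exists u|apply: sound_dropU].
Qed.

Lemma sound_fin s : sound s -> sfin s -> sroot s -> two_dcs adj T F.
Proof.
case=> h1 h2 h3 h4 h5 h6 h7 h8 h9 hf hr.
have [hp hF] := h9 hf; have [W0 [r r1 r2] dBS] := h7 hp; have [r' r3 r4] := h1 hr.
exists (sS s), (sB s); split=> //.
- by rewrite disjoint_sym.
- by rewrite W0 setU0 in h3.
- exact: (reach_connected adj_sym r3 r4).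
- exact: (reach_connected adj_sym r1 r2).
Qed.

Theorem search_sound K : hasacc stp isdec (@sfin n) K (start T F) -> two_dcs adj T F.
Proof.
suff h s : sound s -> hasacc stp isdec (@sfin n) K s -> two_dcs adj T F.
  exact/h/sound_start.
elim: K s => [|K IH] s hs /=.
  move=> hf; apply: (sound_fin hs hf); apply/negPn/negP=> hr.
  by have [_ _ _] := s_rootless hs hr; case: (s_fin hs hf) => ->.
by case/orP=> [|/andP[_]]; apply: IH; apply: sound_step.
Qed.

End Sound.

(** * Completeness *)

(* [lia] on cardinals, which it identifies only up to syntactic equality. *)
Ltac card_lia := rewrite /=; repeat (let c := fresh "c" in move: #|_| => c); clear; lia.

Section Complete.
Variables (n : nat) (adj : rel 'I_n) (T F X A2 : {set 'I_n}) (x0 : 'I_n).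
Implicit Types s : sst n.

Notation stp := (search_step adj F).
Notation isdec := (is_decision adj).
Notation reach := (reach adj).
Notation closed_in := (closed_in adj).
Notation beyond := (beyond adj).
Notation nbr := (first_nbr adj).

Hypotheses (X_reach : forall r, r \in X -> reach X r) (x0X : x0 \in X) (TX : T \subset X).
Hypothesis X_min : forall (Y : {set 'I_n}) r, r \in Y -> reach Y r -> Y \subset X -> T \subset Y -> X \subset Y.
Hypotheses (F_A2 : F \subset A2) (A2_reach : forall r, r \in A2 -> reach A2 r).
Hypotheses (A2_neq0 : A2 != set0) (XA2 : [disjoint X & A2]).

Definition rootless s := [/\ ~~ sfail s, ~~ sfin s, ~~ sroot s, scur s = None &
  [/\ ~~ sph s, X \subset sW s :|: sU s, sW s = T, [disjoint sU s & T] &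
   [/\ sS s = set0, sQ s = set0, sD s = set0 & sB s = set0]]].

(** The states on the branch that follows membership in [X]. By [g_done] a processed vertex has no
    neighbour left to reach, and by [g_D] nothing of what a debtor separates from the root has been
    reached. *)
Record growing s r : Prop := Growing {
  g_fail : ~~ sfail s; g_fin : ~~ sfin s; g_root : sroot s; g_ph : ~~ sph s;
  g_cur : forall u, scur s = Some u -> u \in sQ s;
  g_r : r \in sS s; g_S : sS s \subset X; g_X : X \subset sS s :|: (sW s :|: sU s);
  g_W : sW s \subset T; g_T : T \subset sS s :|: sW s;
  g_US : [disjoint sU s & sS s]; g_WS : [disjoint sW s & sS s]; g_UT : [disjoint sU s & T];
  g_reach : reach (sS s) r; g_Q : sQ s \subset sS s; g_B : sB s = set0;
  g_done : forall x y, x \in sS s -> x \notin sQ s -> y \in sW s :|: sU s -> ~~ adj x y;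
  g_D : forall v, v \in sD s ->
    [/\ v \in sQ s, v \notin T, v != r & [disjoint beyond X r v & sS s]] }.

(** The second set has to meet [A2] only if [F] is nonempty; for empty [F] any nonempty connected
    set outside [X] is good enough. *)
Record other s : Prop := Other {
  o_fail : ~~ sfail s; o_fin : ~~ sfin s; o_root : sroot s; o_ph : sph s;
  o_cur : forall u, scur s = Some u -> u \in sQ s;
  o_S : sS s = X; o_Q : sQ s \subset sB s;
  o_done : forall x y, x \in sB s -> x \notin sQ s -> y \notin sS s :|: sB s -> ~~ adj x y;
  o_F : F != set0 -> exists2 z, z \in sB s & z \in A2 }.

Definition live s := rootless s \/ (exists r, growing s r) \/ other s.

(** Reaching a vertex frees 3 and costs at most 2 for its place in the queue; making a queued vertex
    current frees 2 and costs 1; finishing it frees 1, and so does refusing an undecided vertex. At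
    the start the value is at most [4 * n + 1]. *)
Definition fuel s := 3 * #|~: (sS s :|: sB s)| + #|sU s| +
  2 * #|if scur s is Some u then sQ s :\ u else sQ s| + (scur s : bool) + 1.

(** Otherwise the component of [r] in [X] without [v] would be a smaller connected set containing
    [T], against the minimality of [X]. *)
Lemma beyond_T s r v : growing s r -> v \in X -> v \notin T -> v != r ->
  exists2 t, t \in T & t \in beyond X r v.
Proof.
move=> g vX vT vr; have rX := subsetP (g_S g) _ (g_r g).
set K := component adj (X :\ v) r.
have KX : K \subset X :\ v by apply: component_subset; rewrite !inE eq_sym vr.
have nTK : ~~ (T \subset K).
  apply/negP=> TK; have := X_min (component_root adj _ _) (@reach_component n adj (X :\ v) r) (subset_trans KX (subD1set _ _)) TK.
  by move/subsetP/(_ v vX)/(subsetP KX); rewrite !inE eqxx.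
case/subsetPn: nTK => t tT tK; exists t => //.
by rewrite inE tK !inE (subsetP TX) // andbT; apply: contraNneq vT => <-.
Qed.

(** Send each debtor to a terminal beyond it, which is still unreached. This is injective, because
    the parts beyond two debtors are disjoint: their intersection misses [r], and an edge inside [X]
    leaving it would put one of the debtors, a reached vertex, beyond the other. Hence [check] never
    prunes this branch. *)
Lemma card_D s r : growing s r -> #|sD s| <= #|sW s|.
Proof.
move=> g; have rX := subsetP (g_S g) _ (g_r g).
pose f v := odflt v [pick t in T :&: beyond X r v].
have fP v : v \in sD s -> f v \in T :&: beyond X r v.
  move=> vD; have [vQ vT vr _] := g_D g vD; rewrite /f; case: pickP => //= h.
  have vX : v \in X by apply: (subsetP (g_S g)); apply: (subsetP (g_Q g)).
  by have [t t1 t2] := beyond_T g vX vT vr; have := h t; rewrite inE t1 t2.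
have inj : {in sD s &, injective f}.
  move=> v v' vD vD' e; apply/eqP/negPn/negP=> ne.
  have [_ tv] := setIP (fP v vD); have [_ tv'] := setIP (fP v' vD'); rewrite -e in tv'.
  have [vQ _ _ dv] := g_D g vD; have [vQ' _ _ dv'] := g_D g vD'.
  have vS := subsetP (g_Q g) _ vQ; have vS' := subsetP (g_Q g) _ vQ'.
  have : beyond X r v :&: beyond X r v' = set0.
    apply: (beyond_empty (X_reach rX)).
    - by rewrite inE negb_and; apply/orP; left; apply/negP=> h; have := disjointFr dv h; rewrite (g_r g).
    - by apply/subsetP=> x /setIP[/setDP[/setD1P[]]].
    - move=> x y xX /setIP[yv yv'] xy; rewrite inE.
      have [hx|ex] := beyond_nbr xX yv xy; have [hx'|ex'] := beyond_nbr xX yv' xy.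
      + by rewrite hx hx'.
      + by rewrite ex' in hx; have := disjointFr dv hx; rewrite vS'.
      + by rewrite ex in hx'; have := disjointFr dv' hx'; rewrite vS.
      + by rewrite -ex -ex' eqxx in ne.
  by move/setP/(_ (f v)); rewrite inE tv tv' inE.
rewrite -(card_in_imset inj) subset_leq_card //; apply/subsetP=> _ /imsetP[v vD ->].
have /setIP[fT fv] := fP v vD; have [_ _ _ dv] := g_D g vD.
by have := subsetP (g_T g) _ fT; rewrite inE (disjointFr dv fv).
Qed.

Lemma growing_check s r : growing s r -> check s = s.
Proof. by move=> g; rewrite /check (card_D g). Qed.

(** The reached set is connected without the new vertex [v], so deleting [v] leaves all of it in the
    component of [r]. *)
Lemma beyond_new s r v : growing s r -> v \notin sS s -> [disjoint beyond X r v & v |: sS s].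
Proof.
move=> g vS; have rX := subsetP (g_S g) _ (g_r g).
have SK : sS s \subset component adj (X :\ v) r.
  apply: (g_reach g); first exact: component_root.
  apply/closed_inP => x y xS yS xK xy.
  apply: (closed_inP _ _ _ (component_closed adj (X :\ v) r)) xy => //;
    by rewrite !inE (subsetP (g_S g)) // andbT; apply: contraNneq vS => <-.
rewrite disjoint_subset; apply/subsetP=> x /setDP[xv xK]; rewrite !inE negb_or.
by move: xv; rewrite !inE => /andP[-> _] /=; apply: contra xK; apply: (subsetP SK).
Qed.

(** An edge from a reached vertex can enter the part beyond [d] only if that vertex is [d]
    itself. *)
Lemma beyond_grow s r u v d : growing s r -> scur s = Some u -> adj u v -> d \in sD s -> d != u ->
  [disjoint beyond X r d & v |: sS s].
Proof.
move=> g hu uv dD du; have [dQ _ _ dd] := g_D g dD.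
have uS : u \in sS s by apply: (subsetP (g_Q g)); apply: (g_cur g).
rewrite disjoint_subset; apply/subsetP=> x xd; rewrite !inE negb_or (disjointFr dd xd) andbT.
apply/eqP=> e; rewrite e in xd; have [h|h] := beyond_nbr (subsetP (g_S g) _ uS) xd uv.
  by have := disjointFr dd h; rewrite uS.
by rewrite h eqxx in du.
Qed.

Lemma fuel_take s s' u v : scur s = Some u -> scur s' = Some u ->
  v \notin sS s :|: sB s -> sS s' :|: sB s' = v |: (sS s :|: sB s) ->
  sQ s' = v |: sQ s -> sU s' \subset sU s -> fuel s' < fuel s.
Proof.
move=> hu hu' hv e eQ hU; rewrite /fuel hu hu' e eQ.
have e1 : ~: (v |: (sS s :|: sB s)) = ~: (sS s :|: sB s) :\ v.
  by apply/setP=> x; rewrite !inE !negb_or.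
have h1 := cardsD1 v (~: (sS s :|: sB s)); rewrite in_setC hv -e1 in h1.
have h2 : #|(v |: sQ s) :\ u| <= #|sQ s :\ u|.+1.
  apply: leq_trans (_ : #|v |: (sQ s :\ u)| <= _); last by rewrite cardsU1; case: (_ \notin _); card_lia.
  by apply: subset_leq_card; apply/subsetP=> x; rewrite !inE; case: (x == v); case: (x == u).
have h3 := subset_leq_card hU.
by move: h1 h2 h3; card_lia.
Qed.

Lemma growing_takeW s r u v : growing s r -> scur s = Some u -> v \in sW s -> adj u v ->
  growing (takeW s v (sD s :\ u)) r.
Proof.
move=> g hu vW uv; have vT := subsetP (g_W g) _ vW; have vX := subsetP TX _ vT.
have uS : u \in sS s by apply: (subsetP (g_Q g)); apply: (g_cur g).
case: (g) => h1 h2 h3 h4 h5 h6 h7 h8 h9 h10 h11 h12 h13 h14 h15 h16 h17 h18; split=> //=.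
- by move=> w /h5 hw; rewrite inE hw orbT.
- by rewrite inE h6 orbT.
- by rewrite subUset sub1set vX.
- apply: subset_trans h8 _; apply/subsetP=> x; rewrite !inE.
  by case: (x == v); case: (x \in sS s); case: (x \in sW s).
- exact: subset_trans (subD1set _ _) h9.
- apply: subset_trans h10 _; apply/subsetP=> x; rewrite !inE.
  by case: (x == v); case: (x \in sS s).
- rewrite disjoint_subset; apply/subsetP=> x xU; rewrite !inE negb_or (disjointFr h11 xU) andbT.
  by apply/eqP=> e; have := disjointFr h13 xU; rewrite e vT.
- rewrite disjoint_subset; apply/subsetP=> x; rewrite !inE negb_or => /andP[-> xW].
  by rewrite (disjointFr h12 xW).
- exact: reachU1 uv.
- exact: setUS.
- move=> x y; rewrite !inE negb_or => /orP[->//|xS] /andP[_ xQ] hy; apply: h17 => //.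
  by rewrite inE; case/orP: hy => [/andP[_ ->]//|->]; rewrite orbT.
- move=> d; rewrite !inE => /andP[du dD]; have [q1 q2 q3 q4] := h18 d dD.
  by split=> //; [rewrite q1 orbT|apply: (beyond_grow g hu)].
Qed.

Lemma growing_dropU s r v : growing s r -> v \notin X -> growing (dropU s v) r.
Proof.
case=> h1 h2 h3 h4 h5 h6 h7 h8 h9 h10 h11 h12 h13 h14 h15 h16 h17 h18 vX; split=> //=.
- apply/subsetP=> x xX; have := subsetP h8 _ xX; rewrite !inE.
  by case: eqP => // e; rewrite -e xX in vX.
- exact: disjointWl (subD1set _ _) h11.
- exact: disjointWl (subD1set _ _) h13.
- move=> x y xS xQ hy; apply: h17 => //; move: hy; rewrite !inE => /orP[->//|/andP[_ ->]].
  by rewrite orbT.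
Qed.

Lemma growing_takeU s r u v : growing s r -> scur s = Some u -> v \in sU s -> v \in X ->
  adj u v -> growing (takeU s v (v |: (sD s :\ u))) r.
Proof.
move=> g hu vU vX uv.
have uS : u \in sS s by apply: (subsetP (g_Q g)); apply: (g_cur g).
case: (g) => h1 h2 h3 h4 h5 h6 h7 h8 h9 h10 h11 h12 h13 h14 h15 h16 h17 h18; split=> //=.
- by move=> w /h5 hw; rewrite inE hw orbT.
- by rewrite inE h6 orbT.
- by rewrite subUset sub1set vX.
- apply: subset_trans h8 _; apply/subsetP=> x; rewrite !inE.
  by case: (x == v); case: (x \in sS s); case: (x \in sW s).
- apply: subset_trans h10 _; apply/subsetP=> x; rewrite !inE.
  by case: (x == v); case: (x \in sS s).
- rewrite disjoint_subset; apply/subsetP=> x; rewrite !inE negb_or => /andP[-> xU].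
  by rewrite (disjointFr h11 xU).
- rewrite disjoint_subset; apply/subsetP=> x xW; rewrite !inE negb_or (disjointFr h12 xW) andbT.
  by apply/eqP=> e; have := disjointFr h13 vU; rewrite -e (subsetP h9).
- exact: disjointWl (subD1set _ _) h13.
- exact: reachU1 uv.
- exact: setUS.
- move=> x y; rewrite !inE negb_or => /orP[->//|xS] /andP[_ xQ] hy; apply: h17 => //.
  by rewrite inE; case/orP: hy => [->//|/andP[_ ->]]; rewrite orbT.
- move=> d; rewrite !inE => /predU1P[->|/andP[du dD]].
    split; rewrite ?eqxx //; first by rewrite (disjointFr h13 vU).
      by apply/eqP=> e; have := disjointFr h11 vU; rewrite e h6.
    by apply: beyond_new g _; rewrite (disjointFr h11 vU).
  have [q1 q2 q3 q4] := h18 d dD.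
  by split=> //; [rewrite q1 orbT|apply: (beyond_grow g hu)].
Qed.

(** Without such a neighbour no edge would join [u] to the part beyond it. That part would then be
    closed in [X] and empty, but it contains a terminal. So an unpaid debt never makes this branch
    fail. *)
Lemma growing_debt s r u : growing s r -> scur s = Some u -> u \in sD s ->
  exists2 v, v \in sW s :|: sU s & adj u v.
Proof.
move=> g hu uD; have rX := subsetP (g_S g) _ (g_r g).
have [uQ uT ur du] := g_D g uD.
have uX : u \in X by apply: (subsetP (g_S g)); apply: (subsetP (g_Q g)).
have [t tT tb] := beyond_T g uX uT ur.
case: (pickP [pred v | (v \in sW s :|: sU s) && adj u v]) => [v /andP[h1 h2]|h]; first by exists v.
have : beyond X r u = set0.
  apply: (beyond_empty (X_reach rX)).
  - by apply/negP=> hr; have := disjointFr du hr; rewrite (g_r g).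
  - by apply/subsetP=> x /setDP[/setD1P[]].
  move=> x y xX yb xy; have [//|e] := beyond_nbr xX yb xy.
  have yX : y \in X by case/setDP: yb => /setD1P[].
  have := subsetP (g_X g) _ yX; rewrite inE (disjointFr du yb) /= => hy.
  by have := h y; rewrite /= hy -e xy.
by move/setP/(_ t); rewrite tb inE.
Qed.

Lemma growing_end s r : growing s r -> sQ s = set0 -> sS s = X /\ sW s = set0.
Proof.
move=> g Q0; have rX := subsetP (g_S g) _ (g_r g).
have eS : sS s = X.
  apply/eqP; rewrite eqEsubset (g_S g); apply: (X_reach rX (g_r g)).
  apply/closed_inP => x y xX yX xS xy; have := subsetP (g_X g) _ yX.
  rewrite inE => /orP[//|hy]; have := g_done g xS _ hy; by rewrite Q0 inE xy => /(_ isT).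
split=> //; apply/setP=> w; rewrite inE; apply/negP=> wW.
by have := disjointFr (g_WS g) wW; rewrite eS (subsetP TX) // (subsetP (g_W g)).
Qed.

(** At a decision the choice to follow is whether the offered vertex lies in [X]; elsewhere the
    choice bit is not read. *)
Lemma live_step s : live s -> exists b, sfin (stp s b) \/ live (stp s b) /\ fuel (stp s b) < fuel s.
Proof.
case=> [|[[r g]|o]].
- case=> nf nn nr hc [np hX hW dUT [hS hQ hD hB]].
  have es b : stp s b = rootstep s b.
    by rewrite /search_step (negbTE nf) (negbTE nn) (negbTE nr).
  have fuelE s' v : sU s' \subset sU s -> sS s' = [set v] -> sB s' = set0 -> sQ s' = [set v] -> scur s' = None -> fuel s' < fuel s.
    move=> hU e1 e2 e3 e4; rewrite /fuel hc e4 e1 e2 e3 hS hB hQ cards1 cards0 !setU0.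
    have := cardsC1 v; have := subset_leq_card hU; rewrite setC0 cardsT card_ord.
    have := ltn_ord v; card_lia.
  case e: (first (mem (sW s))) => [v|].
    exists true; right; rewrite es /rootstep e; have vW : v \in sW s by move: e; case: firstP => // w hw [<-].
    split; last by apply: (@fuelE _ v) => //=; rewrite ?hS ?hQ setU0.
    right; left; exists v; rewrite hW in vW hX; split=> //=; rewrite ?hS ?hQ ?hB ?hD ?setU0 ?hW ?hc ?sub1set ?inE //.
    + exact: (subsetP TX).
    + apply: subset_trans hX _; apply/subsetP=> x; rewrite !inE; by case: (x == v).
    + exact: subD1set.
    + by apply/subsetP=> x; rewrite !inE => ->; case: (x == v).
    + rewrite disjoint_sym disjoints1; apply/negP=> h; by have := disjointFr dUT h; rewrite vW.
    + by rewrite disjoint_sym disjoints1 !inE eqxx.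
    + exact: reach1.
    + by move=> x y ->.
    + by move=> x; rewrite inE.
  have W0 : sW s = set0.
    by apply/setP=> x; rewrite inE; move: e; case: firstP => // h _; apply/negbTE; apply: h.
  have T0 : T = set0 by rewrite -hW.
  case e': (first (mem (sU s))) => [v|]; last first.
    have := subsetP hX _ x0X; rewrite W0 set0U; move: e'; case: firstP => // h _ hx.
    by have := h x0; rewrite /= hx.
  have vU : v \in sU s by move: e'; case: firstP => // w hw [<-].
  case: (boolP (v \in X)) => vX.
    exists true; right; rewrite es /rootstep e e'.
    split; last by apply: (@fuelE _ v) => //=; rewrite ?hS ?hQ ?setU0 // subD1set.
    right; left; exists v; split=> //=; rewrite ?hS ?hQ ?hB ?hD ?setU0 ?W0 ?hc ?sub1set ?inE //.
    + apply: subset_trans hX _; rewrite W0 set0U; apply/subsetP=> x; rewrite !inE => ->; by case: (x == v).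
    + by rewrite sub0set.
    + by rewrite T0 sub0set.
    + by rewrite disjoint_sym disjoints1 !inE eqxx.
    + by rewrite disjoints_subset sub0set.
    + exact: disjointWl (subD1set _ _) dUT.
    + exact: reach1.
    + by move=> x y ->.
    + by move=> x; rewrite inE.
  exists false; right; rewrite es /rootstep e e'; split.
    left; split=> //; split=> //=.
      apply/subsetP=> x xX; have := subsetP hX _ xX; rewrite !inE.
      by case: eqP => // ex; rewrite -ex xX in vX.
    exact: disjointWl (subD1set _ _) dUT.
  rewrite /fuel /= hc; have := cardsD1 v (sU s); rewrite vU; card_lia.
- have es b : stp s b = if scur s is Some u then growstep adj s u b else popstep F s.
    by rewrite /search_step (negbTE (g_fail g)) (negbTE (g_fin g)) (g_root g) (negbTE (g_ph g)).
  case hu: (scur s) => [u|] in es *; last first.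
    exists true; right; rewrite es /popstep (negbTE (g_ph g)).
    case: firstP => [u hu'|hQ].
      split; last first.
        by rewrite /fuel /= hu; have := cardsD1 u (sQ s); rewrite (hu' : u \in sQ s); card_lia.
      by right; left; exists r; case: g => *; split=> //= ? [<-].
    have Q0 : sQ s = set0 by apply/setP=> x; rewrite inE; apply/negbTE; apply: hQ.
    have [eS W0] := growing_end g Q0.
    have add v : v \notin X -> (F != set0 -> v \in A2) -> live (addB s v) /\ fuel (addB s v) < fuel s.
      move=> vX vA; split.
        right; right; case: (g) => *; split=> //=.
        - by rewrite hu.
        - by rewrite setUS // Q0 sub0set.
        - by move=> x y; rewrite (g_B g) Q0 !setU0 => ->.
        - by move=> /vA h; exists v; rewrite ?setU11.
      rewrite /fuel /= hu Q0 (g_B g) !setU0 cards1 cards0 eS.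
      have e1 : ~: (X :|: [set v]) = ~: X :\ v by apply/setP=> x; rewrite !inE negb_or andbC.
      by rewrite e1; have := cardsD1 v (~: X); rewrite inE vX; card_lia.
    case: firstP => [w /=|_]; first by rewrite W0 inE.
    case: firstP => [v vF|hF].
      have vA : v \in A2 by apply: (subsetP F_A2).
      apply: add => //; apply/negP=> vX; by have := disjointFr XA2 vX; rewrite vA.
    case: firstP => [v vS|hS].
      apply: add; first by move: vS; rewrite /= inE eS.
      by case/set0Pn => x xF; have := hF x; rewrite /= xF.
    case/set0Pn: A2_neq0 => a aA; have := hS a; rewrite /= inE negbK eS => aX.
    by have := disjointFr XA2 aX; rewrite aA.
  rewrite /growstep in es.
  case: (nbrP adj (sW s) u) es => [v /andP[vW uv]|hW] es.
    have g' := growing_takeW g hu vW uv; exists true; right.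
    rewrite es (growing_check g'); split; first by right; left; exists r.
    apply: (fuel_take (u := u) (v := v)) => //=; rewrite ?(g_B g) ?setU0 //.
    apply/negP=> vS; have := disjointFr (g_WS g) vW; by rewrite vS.
  case: (nbrP adj (sU s) u) es => [v /andP[vU uv]|hU] es.
    case: (boolP (v \in X)) => vX.
      have g' := growing_takeU g hu vU vX uv; exists true; right.
      rewrite es (growing_check g'); split; first by right; left; exists r.
      apply: (fuel_take (u := u) (v := v)) => //=; rewrite ?(g_B g) ?setU0 ?subD1set //.
      apply/negP=> vS; have := disjointFr (g_US g) vU; by rewrite vS.
    have g' := growing_dropU g vX; exists false; right.
    rewrite es (growing_check g'); split; first by right; left; exists r.
    by rewrite /fuel /= hu; have := cardsD1 v (sU s); rewrite vU; card_lia.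
  have uD : u \notin sD s.
    apply/negP=> uD; have [v] := growing_debt g hu uD; rewrite inE => /orP[h|h] uv.
      by have := hW v; rewrite /= h uv.
    by have := hU v; rewrite /= h uv.
  rewrite (negbTE uD) in es.
  have g' : growing (dropQ s u) r.
    case: (g) => h1 h2 h3 h4 h5 h6 h7 h8 h9 h10 h11 h12 h13 h14 h15 h16 h17 h18; split=> //=.
    - exact: subset_trans (subD1set _ _) h15.
    - move=> x y xS; rewrite !inE negb_and negbK => /orP[/eqP ->|xQ].
        by case/orP=> h; [have := hW y|have := hU y]; rewrite /= h.
      by move=> hy; apply: h17; rewrite ?inE.
    - move=> d dD; have [q1 q2 q3 q4] := h18 d dD; split=> //; rewrite !inE q1 andbT.
      by apply: contraNneq uD => <-.
  exists true; right; rewrite es (growing_check g'); split; first by right; left; exists r.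
  by rewrite /fuel /= hu; card_lia.
- have es b : stp s b = if scur s is Some u then otherstep adj s u else popstep F s.
    by rewrite /search_step (negbTE (o_fail o)) (negbTE (o_fin o)) (o_root o) (o_ph o).
  exists true; rewrite es; case hu: (scur s) => [u|].
    right; rewrite /otherstep; case: nbrP => [v /andP[vSB uv]|hn].
      rewrite inE in vSB; split.
        right; right; case: (o) => h1 h2 h3 h4 h5 h6 h7 h8 h9; split=> //=.
        - by move=> w /h5 hw; rewrite inE hw orbT.
        - exact: setUS.
        - move=> x y; rewrite !inE !negb_or => /orP[->//|xB] /andP[_ xQ] /and3P[yS _ yB].
          by apply: h8 => //; rewrite inE negb_or yS.
        - by case/h9 => z zB zA; exists z; rewrite // inE zB orbT.
      apply: (fuel_take (u := u) (v := v)) => //=.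
      by rewrite setUCA.
    split; last by rewrite /fuel /= hu; card_lia.
    right; right; case: (o) => h1 h2 h3 h4 h5 h6 h7 h8 h9; split=> //=.
    - exact: subset_trans (subD1set _ _) h7.
    - move=> x y xB; rewrite !inE negb_and negbK => /orP[/eqP ->|xQ] hy.
        by have := hn y; rewrite /= !inE hy.
      by apply: h8; rewrite ?inE.
  rewrite /popstep (o_ph o); case: firstP => [u hu'|hQ].
    right; split; last first.
      by rewrite /fuel /= hu; have := cardsD1 u (sQ s); rewrite (hu' : u \in sQ s); card_lia.
    by right; right; case: o => *; split=> //= ? [<-].
  left; case: firstP => //= f; rewrite !inE => /andP[fB fF].
  have [|z zB zA] := o_F o; first by apply/set0Pn; exists f.
  (* [A2] is connected, avoids [X] and meets [sB], and no processed vertex of [sB] has a neighbour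
     left outside both sets; so [sB] has swallowed [A2] and with it [F]. *)
  have : A2 \subset sB s.
    apply: (A2_reach zA zB); apply/closed_inP => x y xA yA xB xy.
    apply/negPn/negP=> yB; have yn : y \notin sS s :|: sB s.
      rewrite inE negb_or yB andbT (o_S o).
      by apply/negP=> yX; have := disjointFr XA2 yX; rewrite yA.
    by have := o_done o xB (hQ x) yn; rewrite xy.
  by move/subsetP/(_ f (subsetP F_A2 _ fF)); rewrite (negbTE fB).
Qed.

Lemma hasacc_fin K s : sfin s -> hasacc stp isdec (@sfin n) K s.
Proof.
by elim: K s => //= K IH s h; rewrite IH // /search_step h orbT.
Qed.

Lemma hasacc_live K s : live s -> fuel s <= K -> hasacc stp isdec (@sfin n) K s.
Proof.
elim: K s => [|K IH] s hl hf; first by move: hf; rewrite /fuel addn1.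
have [b hb] := live_step hl.
have h : hasacc stp isdec (@sfin n) K (stp s b).
  by case: hb => [|[h1 h2]]; [apply: hasacc_fin|apply: IH => //; lia].
rewrite /=; case: (boolP (isdec s)) => hd; first by case: b h {hb} => ->; rewrite ?orbT.
by rewrite orbF -(stp_nondec F b hd).
Qed.

End Complete.

Theorem search_complete n (adj : rel 'I_n) (T F : {set 'I_n}) K :
  (forall x y, adj x y = adj y x) -> 4 * n + 1 <= K ->
  two_dcs adj T F -> hasacc (search_step adj F) (is_decision adj) (@sfin n) K (start T F).
Proof.
move=> adj_sym hK [A1 [A2 [dA TA FA c1 c2]]].
(* Connectedness is stated as a boolean, so that a minimal connected set between [T] and [A1] can be
   obtained from [minset_exists]. *)
pose good (Y : {set 'I_n}) := [&& T \subset Y, Y \subset A1 &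
  [exists r in Y, [forall Z : {set 'I_n}, (r \in Z) && closed_in adj Y Z ==> (Y \subset Z)]]].
have goodP (Y : {set 'I_n}) : T \subset Y -> Y \subset A1 -> forall r, r \in Y -> reach adj Y r -> good Y.
  move=> h1 h2 r rY hr; rewrite /good h1 h2; apply/exists_inP; exists r => //.
  by apply/forallP=> Z; apply/implyP=> /andP[]; apply: hr.
have [a aA] := set0Pn _ c1.1.
have [X /minsetP[/and3P[TX XA /exists_inP[x0 x0X hx0]] minX] _] :=
  minset_exists (goodP _ TA (subxx _) _ aA (connected_reach c1 aA)).
have rx0 : reach adj X x0.
  by move=> Z h1 h2; have /forallP/(_ Z) := hx0; rewrite h1 h2.
have cX := reach_connected adj_sym x0X rx0.
have h := @hasacc_live n adj T F X A2 x0.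
apply: h => //.
- by move=> r; apply: connected_reach.
- by move=> Y r rY hr YX TY; rewrite (minX Y) //; apply: goodP (subset_trans YX XA) _ rY hr.
- by move=> r; apply: connected_reach.
- by case: c2.
- exact: disjointWl XA dA.
- left; split=> //; split=> //=.
    apply/subsetP=> x xX; rewrite !inE; case: (boolP (x \in T)) => //= _.
    apply/negP=> xF; have := disjointFr dA (subsetP XA _ xX).
    by rewrite (subsetP FA).
  by rewrite disjoint_subset; apply/subsetP=> x; rewrite !inE negb_or => /andP[].
rewrite /fuel /= set0U setC0 cardsT card_ord cards0.
have := max_card (~: (T :|: F)); rewrite card_ord; move: hK; card_lia.
Qed.

(** * The running time *)

Lemma two_dcsC n (adj : rel 'I_n) Z1 Z2 : two_dcs adj Z1 Z2 -> two_dcs adj Z2 Z1.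
Proof. by move=> [A1 [A2 [h1 h2 h3 h4 h5]]]; exists A2, A1; split; rewrite // disjoint_sym. Qed.

Lemma decides_weaken M w t t' s s' b : t <= t' -> s <= s' ->
  tm_decides_within M w t s b -> tm_decides_within M w t' s' b.
Proof.
move=> ht hs [i [h1 [h2 [h3 h4]]]]; exists i; split; first exact: leq_trans ht.
by split=> //; split=> // j /h4 h; apply: leq_trans hs.
Qed.

(** [89 * 200 = 17800] stays below 17804. *)
Lemma rescale L Y n : L * 50 ^ n <= Y * 89 ^ n -> L * 10000 ^ n <= Y * 17804 ^ n.
Proof.
move=> h; have -> : 10000 = 50 * 200 by vm_compute.
apply: (@leq_trans (Y * (89 * 200) ^ n)).
  by rewrite !expnMn !mulnA leq_mul2r h orbT.
by rewrite leq_mul2l leq_expl ?orbT //; vm_compute.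
Qed.

Theorem decision_run n (adj : rel 'I_n) (Z1 Z2 : {set 'I_n}) :
  valid_instance adj Z1 Z2 ->
  let w := encode adj Z1 Z2 in let N := size w in
  exists I (b : bool), [/\ I * 50 ^ n <= n.+1 ^ 2 * 89 ^ n,
    forall i, i < I -> arr (iter i (den pN N Body) (den pN N Init (mem0 20 w))) fDONE 0 = false,
    arr (iter I (den pN N Body) (den pN N Init (mem0 20 w))) fDONE 0,
    arr (iter I (den pN N Body) (den pN N Init (mem0 20 w))) fACC 0 = b &
    (b = true <-> two_dcs adj Z1 Z2)].
Proof.
move=> [[adj_sym adj_irr] [_ dZ]] w N.
have eN : N = n.+1 + n * n + n + n by apply: size_encode.
have nN : n < N by rewrite eN; lia.
have [hi ho] := den_Init adj dZ.
set T := (if _ then Z1 else Z2) in hi; set F := (if _ then Z2 else Z1) in hi.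
have dTF : [disjoint T & F] by rewrite /T /F; case: ifP; rewrite // disjoint_sym.
have [I [h1 h2 h3 h4]] := search_enumerate nN hi ho.
exists I, (hasacc (search_step adj F) (is_decision adj) (@sfin n) N (start T F)); split=> //.
  have [m em] : exists m, #|~: (T :|: F)| = m by eexists.
  apply: leq_trans (_ : tree_leaves (search_step adj F) (is_decision adj) N (start T F) * 50 ^ n <= _).
    by rewrite leq_mul2r h1 orbT.
  apply: (@leaves_numeric n #|T| #|F| m).
  - by rewrite /T /F; case: (leqP #|Z1| #|Z2|) => // /ltnW.
  - have := cardsC (T :|: F); rewrite em cardsU (disjoint_setI0 dTF) cards0 subn0 card_ord.
    by move=> hn; rewrite -addnA addnC.
  - by rewrite -em; apply: (leaves_exp2 adj F N (start T F)).
  - exact: leaves_start.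
have two : two_dcs adj T F <-> two_dcs adj Z1 Z2.
  by rewrite /T /F; case: ifP => // _; split; apply: two_dcsC.
rewrite -two; split; first exact: search_sound.
(* [N = n * n + 3 * n + 1] is at least [4 * n + 1], so the [N] micro steps in one round of [Body]
   suffice for an accepting branch. *)
by apply: search_complete => //; rewrite eN; nia.
Qed.

(* There is a polynomial-space algorithm (Turing machine) solving
   2-Disjoint Connected Subgraphs on n-vertex graphs in time
   O(1.7804^n * poly(n)), i.e. time * 10000^n <= c * 17804^n * (n+1)^k. *)
Theorem theorem3 :
  exists (M : TM) (c k : nat),
    forall (n : nat) (adj : rel 'I_n) (Z1 Z2 : {set 'I_n}),
      valid_instance adj Z1 Z2 ->
      exists (t : nat) (b : bool),
        [/\ t * 10000 ^ n <= c * 17804 ^ n * n.+1 ^ k,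
            tm_decides_within M (encode adj Z1 Z2) t (c * n.+1 ^ k) b
          & (b = true <-> two_dcs adj Z1 Z2)].
Proof.
have [wi wb ci cb] := progs_wf.
have [M [C [k hM]]] := @search_machine 20 30 40 50 15 16 Init Body isT wi wb ci cb.
(* By [N.+1 <= 2 * n.+1 ^ 2], the factor [N.+1 ^ k] becomes [2 ^ k * n.+1 ^ (2 * k)]. The number of
   leaves brings [n.+1 ^ 2], doubled on passing from [I] to [I.+1]; the summand 2 of the constant
   covers the head positions. *)
exists M, (2 * C * 2 ^ k + 2), (2 * k + 2) => n adj Z1 Z2 hv.
have [I [b [hI h0 hD hA hb]]] := decision_run hv.
have eN : size (encode adj Z1 Z2) = n.+1 + n * n + n + n by apply: size_encode.
have N0 : 0 < size (encode adj Z1 Z2) by rewrite eN.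
have := hM _ I N0 h0 hD; rewrite hA; move: eN; set N := size _ => eN hdec.
have hN : N.+1 <= 2 * n.+1 ^ 2 by rewrite eN -mulnn; nia.
have e1 : 0 < n.+1 ^ (2 * k) by rewrite expn_gt0.
exists (I.+1 * (C * N.+1 ^ k)), b; split=> //; last first.
  apply: decides_weaken hdec => //.
  apply: (@leq_trans (2 * n.+1 ^ 2)); first exact: ltnW.
  by rewrite expnD leq_mul ?leq_addl // leq_pmull.
have hI' : I.+1 * 10000 ^ n <= 2 * n.+1 ^ 2 * 17804 ^ n.
  apply: rescale; rewrite mulSn -mulnA [leqRHS]mul2n -addnn leq_add //.
  by rewrite (leq_trans (leq_expl n (isT : 50 <= 89))) // leq_pmull // expn_gt0.
have hNk : N.+1 ^ k <= 2 ^ k * n.+1 ^ (2 * k) by rewrite expnM -expnMn leq_expl.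
rewrite mulnAC; apply: leq_trans (leq_mul hI' (leq_mul (leqnn C) hNk)) _.
rewrite expnD; move: (17804 ^ n) (n.+1 ^ 2) (n.+1 ^ (2 * k)) (2 ^ k) => y b' a p.
rewrite mulnDl mulnDl; apply: leq_trans (leq_addr _ _).
by clear; nia.
Qed.
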